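(* Assume that $\lim_{p\searrow c} F(p)/(p-c)^{\nu+1}=\kappa$ for some constants $0<\nu<\infty$ and $0<\kappa<\infty$ (so that $u^*<\infty$). Let the initial gaps $\{\eta_i\}_{i\in\mathbf{Z}}$ be i.i.d. random variables with common mean $u=E\eta_i>u^*$ and finite variance, and let $\sigma_0(0)=0$. Then for every $0<z<\infty$, $$\limsup_{t\to\infty}P\Bigl(\frac{\sigma_0(t)-ct}{t^{1-\alpha}}>z\Bigr)\le \exp\Bigl\{-A(\nu)^{-1}\frac{\kappa}{u-u^*}\,z^{\nu+2}\Bigr\}$$ and $$\liminf_{t\to\infty}P\Bigl(\frac{\sigma_0(t)-ct}{t^{1-\alpha}}>z\Bigr)\ge \exp\Bigl\{-\frac{\kappa}{u-u^*}\,z^{\nu+2}\Bigr\}.$$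
   Context: Rates: $F$ is a probability distribution function supported on $(c,1]$, where $c>0$ is the left endpoint of the support: $F(p)=0$ for $p<c$, $F(c)=0$, $F(p)>0$ for $p>c$, $F(1)=1$. The rates $\mathbf{p}=\{p_i\}_{i\in\mathbf{Z}}$ are i.i.d. with distribution $F$. The critical gap is $u^*=\int_{(c,1]}\frac{c}{p-c}\,dF(p)$. Notation: $\alpha=\frac{1}{\nu+2}$, so $1-\alpha=\frac{\nu+1}{\nu+2}$, and $A(\nu)=\frac{(\nu+2)^{\nu+2}}{(\nu+1)^{\nu+1}}$. Process: given the rates, $(N_i)_{i\in\mathbf{Z}}$ are independent Poisson processes (clocks), $N_i$ of rate $p_i$. The totally asymmetric exclusion process $\sigma(t)=(\sigma_i(t))_{i\in\mathbf{Z}}$ consists of integer-valued particle positions with $\sigma_i(t)<\sigma_{i+1}(t)$; whenever $N_i$ jumps, particle $i$ moves one step to the right provided the next site to the right is vacant (otherwise nothing happens). Initial state: $\sigma_i=\sigma_i(0)$, with $\sigma_0=0$, and the initial gaps are $\eta_i=\sigma_{i+1}-\sigma_i-1$, taking nonnegative integer values; thus $\sigma_i=\sum_{j=0}^{i-1}(\eta_j+1)$ for $i>0$ and $\sigma_i=-\sum_{j=i}^{-1}(\eta_j+1)$ for $i<0$. The initial configuration has a fixed distribution not depending on the rates (it is independent of rates and clocks). $P$ is the annealed probability measure, under which the rates, the initial configuration and the Poisson clocks are all random. *)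

(* Defs.v *)
From HB Require Import structures.
From mathcomp Require Export all_boot all_order all_algebra.
From mathcomp Require Export all_classical all_reals all_analysis.

Set Implicit Arguments.
Unset Strict Implicit.
Unset Printing Implicit Defensive.

Import Order.TTheory GRing.Theory Num.Theory.
Import numFieldNormedType.Exports.

Local Open Scope classical_set_scope.
Local Open Scope ring_scope.

(* Every set of integers is measurable, as for nat in the library. *)
HB.instance Definition _ := isPointed.Build int 0.
HB.instance Definition _ := @isMeasurable.Build default_measure_display
  int discrete_measurable discrete_measurable0
  discrete_measurableC discrete_measurableU.

Section Independence.
Context {d : measure_display} {T : measurableType d} {R : realType}.
Variable P : probability T R.

Definition mutually_independent (I : choiceType) (d' : measure_display)
    (V : measurableType d') (X : I -> T -> V) : Prop :=
  forall (s : seq I) (B : I -> set V),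
    uniq s -> (forall i, measurable (B i)) ->
    P (\bigcap_(i in [set` s]) X i @^-1` B i)
      = (\prod_(i <- s) P (X i @^-1` B i))%E.

Definition identically_distributed (I : Type) (d' : measure_display)
    (V : measurableType d') (X : I -> T -> V) : Prop :=
  forall (i j : I) (B : set V),
    measurable B -> P (X i @^-1` B) = P (X j @^-1` B).

Definition iid (I : choiceType) (d' : measure_display)
    (V : measurableType d') (X : I -> T -> V) : Prop :=
  mutually_independent X /\ identically_distributed X.

Definition independent_systems (G H : set_system T) : Prop :=
  forall A B : set T, G A -> H B -> P (A `&` B) = (P A * P B)%E.

End Independence.

Section Tasep.
Context {d : measure_display} {T : measurableType d} {R : realType}.

Definition preimages (I : Type) (J : set I) (d' : measure_display)
    (V : measurableType d') (X : I -> T -> V) : set_system T :=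
  \bigcup_(i in J) preimage_set_system setT (X i) measurable.

Definition sigma_rates (rate : int -> T -> R) : set_system T :=
  <<s preimages setT rate >>.

(* Only the times t >= 0 matter: N i t and sigma i t are unconstrained for
   t < 0. *)
Definition sigma_rates_clocks (rate : int -> T -> R) (N : int -> R -> T -> nat)
    : set_system T :=
  <<s preimages setT rate `|`
      preimages [set it : int * R | 0 <= it.2] (fun it => N it.1 it.2) >>.

Definition sigma_initial (sigma : int -> R -> T -> int) : set_system T :=
  <<s preimages setT (fun i => sigma i 0) >>.

Definition counting_path (n : R -> nat) : Prop :=
  [/\ n 0 = 0%N,
      forall s t, 0 <= s -> s <= t -> (n s <= n t)%N
    & forall t, 0 <= t -> \forall s \near t^'+, n s = n t].

(* The conditional law of the clocks given the rates: the conditional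
   probability, given all the rates, that clock i has k i l points in
   ]tt l, tt l.+1], for all i in the finite set s and all l < m, is the
   indicated product, which is tested on every event A of the sigma-algebra of
   the rates. The inequality on tt is strict because the library's
   poisson_pmf is 1, and not a point mass at 0, at parameter 0. *)
Definition poisson_given_rates (P : probability T R)
    (rate : int -> T -> R) (N : int -> R -> T -> nat) : Prop :=
  forall (A : set T) (s : seq int) (m : nat) (tt : nat -> R)
         (k : int -> nat -> nat),
    sigma_rates rate A -> uniq s ->
    0 <= tt 0%N -> (forall l, tt l < tt l.+1) ->
    P (A `&` \bigcap_(i in [set` s]) \bigcap_(l in [set l | (l < m)%N])
         [set w | N i (tt l.+1) w = (N i (tt l) w + k i l)%N])
    = (\int[P]_(w in A)
         (\prod_(i <- s) \prod_(l < m)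
            poisson_pmf (rate i w * (tt l.+1 - tt l)) (k i l))%:E)%E.

(* The exclusion dynamics driven by given clock paths. Here y, y' and n are the
   values just before time t; since the particles are ordered, the site y + 1
   is vacant iff particle i + 1 is not there. When infinitely many clocks i > 0
   stay silent up to each time t (almost sure for rates at most 1), the clocks
   and the initial positions determine x on [0, oo[. *)
Record exclusion_path (n : int -> R -> nat) (x : int -> R -> int) : Prop := {
  exclusion_order : forall i t, 0 <= t -> x i t < x (i + 1) t ;
  exclusion_right_continuous :
    forall i t, 0 <= t -> \forall s \near t^'+, x i s = x i t ;
  exclusion_jump : forall i t, 0 < t ->
    exists (y y' : int) (k : nat),
      (\forall s \near t^'-, [/\ x i s = y, x (i + 1) s = y' & n i s = k]) /\
      x i t = if (k != n i t) && (y' != y + 1) then y + 1 else y }.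

Record disordered_tasep (P : probability T R) (F : R -> R)
    (rate : int -> {RV P >-> R}) (N : int -> R -> T -> nat)
    (sigma : int -> R -> T -> int) : Prop := {
  rates_independent : mutually_independent P rate ;
  rates_distribution : forall i p, cdf (rate i) p = (F p)%:E ;
  clocks_measurable : forall i t, 0 <= t -> measurable_fun setT (N i t) ;
  clocks_counting :
    {ae P, forall w, forall i, counting_path (fun t => N i t w)} ;
  clocks_poisson : poisson_given_rates P rate N ;
  positions_measurable :
    forall i t, 0 <= t -> measurable_fun setT (sigma i t) ;
  positions_exclusion :
    {ae P, forall w,
      exclusion_path (fun i t => N i t w) (fun i t => sigma i t w)} ;
  initial_independent :
    independent_systems P (sigma_initial sigma) (sigma_rates_clocks rate N) }.

Definition initial_gap (sigma : int -> R -> T -> int) (i : int) (w : T) : int :=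
  sigma (i + 1) 0 w - sigma i 0 w - 1.

End Tasep.

Definition critical_gap {R : realType} (c : R) (F : cumulative R R) : \bar R :=
  (\int[lebesgue_stieltjes_measure F]_(p in `]c, 1%R]) (c / (p - c))%:E)%E.

Definition alpha {R : realType} (nu : R) : R := (nu + 2)^-1.

Definition Anu {R : realType} (nu : R) : R :=
  (nu + 2) `^ (nu + 2) / (nu + 1) `^ (nu + 1).

(* Main.v *)
From HB Require Import structures.
Require Import Defs.
From mathcomp Require Import all_boot all_order all_algebra.
From mathcomp Require Import all_classical all_reals all_analysis.
From mathcomp Require Import measurable_realfun.
From mathcomp Require Import ring lra zify.

Set Implicit Arguments.
Unset Strict Implicit.
Unset Printing Implicit Defensive.

Import Order.TTheory GRing.Theory Num.Theory.
Import numFieldNormedType.Exports.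

Local Open Scope classical_set_scope.
Local Open Scope ring_scope.

(* Particle 0 lies at the minimum over k of [H_k + D_k], where H_k is the sum of the
   initial gaps 0, ..., k - 1 and D_k is the displacement of particle 0 in the system
   of particles 0, ..., k started from the packed configuration, with k free to move;
   this is the min-plus linearity of the dynamics. Given the rates, D_k is controlled by Burke's
   property: behind a leader of rate l, with independent geometric gaps of ratios
   l / p_i, particle 0 performs a walk of rate l. So D_k is about
   l t - sum_{i < k} l / (p_i - l), hence about p_k t - k u* when p_k is close to c
   and smallest, and sigma_0(t) - c t is about the minimum over k of
   k (u - u* ) + (p_k - c) t. Put tau = t^{-alpha} and Lam = t tau = t^{1 - alpha}. If
   x > z and y (u - u* ) > z, and if no rate below c + x tau occurs among the first
   y Lam particles, then sigma_0(t) > c t + z Lam; if x + y (u - u* ) < z, such a rate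
   prevents this. The probability (1 - F(c + x tau))^{y Lam} of no such rate tends to
   exp(- kappa y x^{nu + 1}), and the best x and y give the two bounds. The errors
   coming from the clocks are O(t exp(- const t^{1 - 2 alpha})), so that a union bound
   over k suffices, without using the independence of initial gaps and clocks. *)

(** Time is cut into m steps of length h = t / m. Up to an error that vanishes as m grows at fixed
    t, a step sees at most one ring among finitely many clocks, so a clock path becomes a word over
    [option 'I_n] and every estimate for given rates a finite weighted sum, with no continuous-time
    semigroup. Burke's property concerns geometric gaps, whereas D_k starts packed. Bounding D_k
    from below costs the sum of the geometric gaps. Bounding it from above leaves, by min-plus
    linearity, the second alternative D_{k-1}, which is harmless once the rates behind the slow
    leader are raised to some b > c: leader k - 1 then runs at a macroscopically larger speed. The
    exponent alpha is fixed by Lam tau^{nu + 1} = 1, so that the expected number of rates below c +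
    x tau among y Lam particles stays bounded. A tilt s gains s e Lam in the exponent and loses a
    multiple of s^2 t; s proportional to tau balances the two and leaves tau Lam = t^{1 - 2 alpha},
    a positive power of t because nu > 0. *)

(** * Finite systems behind a free leader *)

(* The clock of particle i rings in the system of particles 0, ..., k whose
   leader k is free; particles beyond k are carried along with the leader. *)
Definition ring_clock (k i : nat) (x : nat -> int) : nat -> int := fun j =>
  if (i < k)%N then
    (if j == i then Num.min (x i + 1) (x i.+1 - 1) else x j)
  else if i == k then x j + (k <= j)%N%:Z
  else x j.

Definition step n (k : nat) (x : nat -> int) (a : option 'I_n) : nat -> int :=
  if a is Some i then ring_clock k i x else x.

Definition run n (k : nat) (x : nat -> int) (o : seq (option 'I_n)) :=
  foldl (step k) x o.

Definition packed : nat -> int := Posz.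

Definition displacement n (k : nat) (o : seq (option 'I_n)) : int :=
  run k packed o 0%N.

Section Dynamics.
Variable n : nat.
Implicit Types (k i j : nat) (x y : nat -> int) (a : option 'I_n)
  (o : seq (option 'I_n)).

Lemma ring_clock_mono k i x y :
  (forall j, x j <= y j) -> forall j, ring_clock k i x j <= ring_clock k i y j.
Proof.
move=> xy j; rewrite /ring_clock.
have := xy j; have := xy i; have := xy i.+1.
by case: ifP => _; [case: ifP => _|case: ifP => _]; lia.
Qed.

Lemma ring_clock_shift k i x b :
  ring_clock k i (fun j => x j + b) = (fun j => ring_clock k i x j + b).
Proof.
apply/funext => j; rewrite /ring_clock.
by case: ifP => _; [case: ifP => _|case: ifP => _]; lia.
Qed.

Lemma ring_clock_ge k i x : (forall j, packed j <= x j) ->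
  forall j, packed j <= ring_clock k i x j.
Proof.
move=> px j; rewrite /ring_clock; have := px j; have := px i.+1; rewrite /packed.
by case: ifP => _; [case: ifP => [/eqP -> //|_]|case: ifP => _]; have := px i; rewrite /packed; lia.
Qed.

Lemma ring_clock_le k i x j : ring_clock k i x j <= x j + 1.
Proof.
rewrite /ring_clock.
by case: ifP => _; [case: ifP => [/eqP ->|_]|case: ifP => _]; lia.
Qed.

Lemma step_mono k x y a :
  (forall j, x j <= y j) -> forall j, step k x a j <= step k y a j.
Proof. by case: a => [i|//]; exact: ring_clock_mono. Qed.

Lemma step_shift k x a b :
  step k (fun j => x j + b) a = (fun j => step k x a j + b).
Proof. by case: a => [i|//]; exact: ring_clock_shift. Qed.

Lemma step_ge k x a : (forall j, packed j <= x j) ->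
  forall j, packed j <= step k x a j.
Proof. by case: a => [i|//]; exact: ring_clock_ge. Qed.

Lemma step_le k x a j : step k x a j <= x j + 1.
Proof. by case: a => [i|] /=; [exact: ring_clock_le|lia]. Qed.

Definition spread x := forall j, x j + 1 <= x j.+1.

Lemma spread_packed : spread packed.
Proof. by move=> j; rewrite /packed; lia. Qed.

Lemma spread_ring_clock k i x : spread x -> spread (ring_clock k i x).
Proof.
move=> sx j; have := sx j; have := sx i; have := sx i.+1; have := sx j.+1.
rewrite /ring_clock; case: ifP => ik; last by clear ik; case: ifP => _; lia.
move=> s1 s2 s3 s4; have [ji|ji] := eqVneq j i.
  by subst j; rewrite -[X in (_ == X)]addn0 -addn1 eqn_add2l /=; lia.
by case: eqP => [E|_]; [rewrite -E; subst i|]; lia.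
Qed.

Lemma spread_step k x a : spread x -> spread (step k x a).
Proof. by case: a => [i|//]; exact: spread_ring_clock. Qed.

Lemma ring_clock_incr k i x j : spread x -> x j <= ring_clock k i x j.
Proof.
move=> sx; have := sx j; have := sx i; rewrite /ring_clock.
by case: ifP => _; [case: eqP => [->|_]|case: ifP => _]; lia.
Qed.

(* Min-plus linearity: a configuration that dominates the minimum of a
   configuration with leader [k.+1] and of one with leader [k] keeps doing so. *)
Lemma run_min k x y z o :
  (forall i, (i <= k)%N -> y i <= x i \/ z i <= x i) -> y k.+1 <= x k.+1 ->
  run k.+1 y o 0%N <= run k.+1 x o 0%N \/ run k z o 0%N <= run k.+1 x o 0%N.
Proof.
elim: o x y z => [|a o IH] x y z yzx yx; first exact: yzx.
case: a => [i|]; last exact: IH.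
apply: IH => [j jk|] /=; rewrite /ring_clock; last first.
  case: ifP => ik; last by case: ifP => _; lia.
  by case: (eqVneq k.+1 i) => E //; rewrite -E ltnn in ik.
have := yzx j jk; case: (ltnP i k.+1) => [ik|ik]; last first.
  have -> : (i < k)%N = false by lia.
  have -> : (i == k :> nat) = false by lia.
  by case: eqP => _ //; rewrite ltnNge jk /=; lia.
case: (eqVneq j i) => [E|ji]; last first.
  case: ifP => _ //; case: ifP => [/eqP ik'|//].
  have -> : (k <= j)%N = false by lia.
  lia.
rewrite -E; case: (ltnP j k) => jk'; first by have := yzx j.+1 jk'; lia.
have jE : j = k by lia.
by rewrite jE eqxx /=; lia.
Qed.

(* The evolution of N ordered particles, of which the last one is only known
   not to move backwards. *)
Definition follows (N : nat) (X : nat -> nat -> int) o :=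
  forall l, (l < size o)%N -> forall i, (i <= N)%N ->
  match nth None o l with
  | None => X l.+1 i = X l i
  | Some j => if i != j then X l.+1 i = X l i
              else if (i < N)%N then X l.+1 i = Num.min (X l i + 1) (X l i.+1 - 1)
              else X l i <= X l.+1 i
  end.

Lemma follows_cons N X a o : follows N X (a :: o) ->
  follows N (fun l => X l.+1) o.
Proof. by move=> fX l lo i iN; exact: (fX l.+1). Qed.

(** Freeing particle k from particle k + 1 can only speed it up, so the true system stays below the
    finite one. Since [k < N], particle k itself obeys the exact rule, not the unknown motion of
    particle N. *)
Lemma follows_le N X k x b o : (k < N)%N -> follows N X o ->
  (forall i, (i <= k)%N -> X 0%N i <= x i + b) ->
  X (size o) 0%N <= run k x o 0%N + b.
Proof.
move=> kN; elim: o X x => [|a o IH] X x fX Xx /=; first exact: Xx.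
apply: (IH (fun l => X l.+1)); first exact: follows_cons fX.
move=> i ik; have := Xx i ik; have iN : (i <= N)%N by lia.
have := fX 0%N (ltn0Sn _) i iN; case: a {fX} => [j|] /=; last by lia.
rewrite /ring_clock; case: eqVneq => [E|ne] /=; last first.
  by case: ifP => _; [|case: ifP => _]; lia.
rewrite -E; have -> : (i < N)%N by lia.
case: (ltnP i k) => ik'; first by have := Xx i.+1 ik'; lia.
have -> : i = k by lia.
by rewrite eqxx; lia.
Qed.

(** Invariant: each particle i lies above particle i of some finite system with leader [k >= i], or
    above the level [i + B] secured by particle N, which never retreats. A blocked particle takes
    over the witness of the particle that blocks it. *)
Lemma follows_ge N X (x : nat -> nat -> int) (b : nat -> int) B o :
  follows N X o ->
  (forall i, (i <= N)%N ->
    (exists2 k, (i <= k < N)%N & x k i + b k <= X 0%N i) \/ i%:Z + B <= X 0%N i) ->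
  (exists2 k, (k < N)%N & run k (x k) o 0%N + b k <= X (size o) 0%N)
  \/ B <= X (size o) 0%N.
Proof.
elim: o X x => [|a o IH] X x fX xX.
  case: (xX 0%N (leq0n _)) => [[k kN H]|H]; [by left; exists k|right => /=; lia].
apply: (IH (fun l => X l.+1) (fun k => step k (x k) a)).
  exact: follows_cons fX.
move=> i iN; have := xX i iN; have := fX 0%N (ltn0Sn _) i iN.
case: a {fX} => [j|] /=; last by move=> ->.
case: eqVneq => [E|ne] /=.
  rewrite -E; case: (ltnP i N) => iN' XE; last first.
    by case=> [[k]|]; [lia|right; lia].
  move=> Hi; have Hi1 := xX i.+1 iN'.
  have [X1|X1] := leP (X 0%N i + 1) (X 0%N i.+1 - 1).
    case: Hi => [[k ik H]|]; [left; exists k => // | right; lia].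
    have := ring_clock_le k i (x k) i; lia.
  case: Hi1 => [[k ik H]|]; [left; exists k; first by lia|right; lia].
  rewrite XE /step -?E /ring_clock; have -> : (i < k)%N by lia.
  rewrite eqxx; lia.
move=> ->; case=> [[k ik H]|]; [left; exists k => //|by right].
rewrite /ring_clock; rewrite (negbTE ne).
case: ifP => // _; case: eqP => // jk.
have -> : (k <= i)%N = false by lia.
by rewrite addr0.
Qed.

End Dynamics.

Section Expectation.
Variables (R : realType) (n : nat).
Implicit Types (w : option 'I_n -> R) (k m : nat) (x : nat -> int)
  (f : (nat -> int) -> R).

(** The weights need not sum to 1: for [rated_weights] the steps with two rings or more are missing.
    The recursion conditions on the first letter, as in a backward equation. *)
Fixpoint expect w k m f x : R :=
  if m is m'.+1 then \sum_(a : option 'I_n) w a * expect w k m' f (step k x a)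
  else f x.

Lemma sum_tuple_cons m (I : finType) (G : m.+1.-tuple I -> R) :
  \sum_(o : m.+1.-tuple I) G o
  = \sum_(a : I) \sum_(o : m.-tuple I) G [tuple of a :: o].
Proof.
rewrite pair_big /= (reindex (fun p : I * m.-tuple I => [tuple of p.1 :: p.2])) //=.
exists (fun o => (thead o, [tuple of behead o])) => [[a o] _|o _] /=.
  by congr pair; apply/val_inj.
by case/tupleP: o => a o; apply/val_inj.
Qed.

Lemma expectE w k m f x :
  \sum_(o : m.-tuple (option 'I_n)) (\prod_(a <- o) w a) * f (run k x o)
  = expect w k m f x.
Proof.
elim: m x => [|m IH] x /=.
  rewrite (big_pred1 [tuple]) /=; last by move=> o; apply/esym/eqP/tuple0.
  by rewrite big_nil mul1r.
rewrite sum_tuple_cons; apply: eq_bigr => a _.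
rewrite -IH mulr_sumr; apply: eq_bigr => o _.
by rewrite /= big_cons mulrA.
Qed.

Lemma expect_ge0 w k m f x : (forall a, 0 <= w a) ->
  (forall x, 0 <= f x) -> 0 <= expect w k m f x.
Proof.
move=> w0 f0; elim: m x => [|m IH] x //=.
by apply: sumr_ge0 => a _; apply: mulr_ge0.
Qed.

Lemma expectN w k m f x : expect w k m (fun x => - f x) x = - expect w k m f x.
Proof.
elim: m x => [|m IH] x //=.
by rewrite -sumrN; apply: eq_bigr => a _; rewrite IH mulrN.
Qed.

Lemma expect_mono w k m f x y : (forall a, 0 <= w a) ->
  (forall x y, (forall j, x j <= y j) -> f x <= f y) ->
  (forall j, x j <= y j) -> expect w k m f x <= expect w k m f y.
Proof.
move=> w0 fm; elim: m x y => [|m IH] x y xy /=; first exact: fm.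
by apply: ler_sum => a _; apply: ler_wpM2l => //; apply: IH; exact: step_mono.
Qed.

Lemma sum_option (G : option 'I_n -> R) :
  \sum_(a : option 'I_n) G a = G None + \sum_(i < n) G (Some i).
Proof.
rewrite (bigD1 None) //=; congr (_ + _).
rewrite (reindex_omap Some id) /=; first by apply: eq_bigl => i; rewrite eqxx.
by case.
Qed.

(** One step in generator form: the total weight times the identity, plus the effect of each ring.
    Rings beyond the leader leave the configuration unchanged. *)
Lemma sum_ring_id w k (F : (nat -> int) -> R) x :
  \sum_a w a * F (step k x a)
  = (\sum_a w a) * F x
    + \sum_(i < n | (i <= k)%N) w (Some i) * (F (ring_clock k i x) - F x).
Proof.
rewrite !sum_option mulrDl mulr_suml -addrA; congr (_ + _) => //=.
rewrite [X in _ = _ + X]big_mkcond -big_split /=; apply: eq_bigr => i _.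
case: leqP => ik; first by rewrite mulrBr; lra.
rewrite addr0; congr (_ * F _); apply/funext => j; rewrite /ring_clock.
have -> : (i < k)%N = false by lia.
by have -> : (i == k :> nat) = false by lia.
Qed.

(** Comparison of generators: the expectation is increasing in the configuration, and on a [spread]
    configuration no ring moves a particle backwards, so more weight on the rings of particles 0,
    ..., k can only increase it. Equal totals cancel the identity part. *)
Lemma expect_rate_mono w w' k m f x : (forall a, 0 <= w a) ->
  (forall a, 0 <= w' a) ->
  (forall i : 'I_n, (i <= k)%N -> w (Some i) <= w' (Some i)) ->
  \sum_a w a = \sum_a w' a ->
  (forall x y, (forall j, x j <= y j) -> f x <= f y) ->
  spread x -> expect w k m f x <= expect w' k m f x.
Proof.
move=> w0 w0' ww' sw fm; elim: m x => [|m IH] x sx //=.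
apply: (@le_trans _ _ (\sum_a w a * expect w' k m f (step k x a))).
  apply: ler_sum => a _; apply: ler_wpM2l => //; apply: IH; exact: spread_step.
rewrite !sum_ring_id sw lerD2l; apply: ler_sum => i ik.
apply: ler_wpM2r; last exact: ww'.
rewrite subr_ge0; apply: expect_mono => // j; exact: ring_clock_incr.
Qed.

End Expectation.

(** * Geometric gaps and the intertwining relation *)

Definition upd (g : nat -> nat) (i j : nat) : nat -> nat :=
  fun l => if l == i then j else g l.

Lemma updC g i j i' j' : i != i' ->
  upd (upd g i j) i' j' = upd (upd g i' j') i j.
Proof.
move=> ii'; apply/funext => l; rewrite /upd.
by case: (l =P i') => [->|//]; rewrite eq_sym (negbTE ii').
Qed.

Lemma upd_upd g i j j' : upd (upd g i j) i j' = upd g i j'.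
Proof. by apply/funext => l; rewrite /upd; case: (l == i). Qed.

Section Geometric.
Context {R : realType}.
Implicit Types (r : nat -> R) (F G : (nat -> nat) -> R) (g : nat -> nat)
  (i j k : nat).

(* Unnormalized expectation over independent geometric coordinates
   g 0, ..., g (k - 1) with ratios r 0, ..., r (k - 1). *)
Fixpoint geo r k F g : \bar R :=
  if k is k'.+1 then
    (\sum_(0 <= j <oo) (r k' ^+ j)%:E * geo r k' F (upd g k' j))%E
  else (F g)%:E.

Variable r : nat -> R.
Hypothesis r_ge0 : forall i, 0 <= r i.

Lemma geo_ge0 k F g : (forall g, 0 <= F g) -> (0 <= geo r k F g)%E.
Proof.
move=> F0; elim: k g => [|k IH] g /=; first by rewrite lee_fin.
by apply: nneseries_ge0 => j _ _; rewrite mule_ge0 ?lee_fin ?exprn_ge0.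
Qed.

Let term_ge0 k F g j : (forall g, 0 <= F g) ->
  (0 <= (r k ^+ j)%:E * geo r k F (upd g k j))%E.
Proof. by move=> F0; rewrite mule_ge0 ?lee_fin ?exprn_ge0 ?geo_ge0. Qed.

Lemma le_geo k F G g : (forall g, 0 <= F g) -> (forall g, F g <= G g) ->
  (geo r k F g <= geo r k G g)%E.
Proof.
move=> F0 FG; elim: k g => [|k IH] g /=; first by rewrite lee_fin.
apply: lee_nneseries => j _; first by move=> _; apply: term_ge0.
by rewrite lee_wpmul2l ?lee_fin ?exprn_ge0.
Qed.

Lemma geoD k F G g : (forall g, 0 <= F g) -> (forall g, 0 <= G g) ->
  geo r k (fun g => F g + G g) g = (geo r k F g + geo r k G g)%E.
Proof.
move=> F0 G0; elim: k g => [|k IH] g //=.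
rewrite -nneseriesD //; [|by move=> *; exact: term_ge0..].
apply: eq_eseriesr => j _.
by rewrite IH ge0_muleDr ?geo_ge0.
Qed.

Lemma geoZ k c F g : 0 <= c -> (forall g, 0 <= F g) ->
  geo r k (fun g => c * F g) g = (c%:E * geo r k F g)%E.
Proof.
move=> c0 F0; elim: k g => [|k IH] g //=.
rewrite -nneseriesZl; last by move=> *; exact: term_ge0.
by apply: eq_eseriesr => j _; rewrite IH muleCA.
Qed.

Lemma eq_geo k F G g :
  (forall g', (forall i, (k <= i)%N -> g' i = g i) -> F g' = G g') ->
  geo r k F g = geo r k G g.
Proof.
elim: k g => [|k IH] g FG /=; first by rewrite FG.
apply: eq_eseriesr => j _; rewrite (IH (upd g k j)) // => g' g'E; apply: FG => i ki.
by rewrite g'E 1?ltnW // /upd gtn_eqF.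
Qed.

Lemma geo_upd k i j F g : (k <= i)%N ->
  geo r k (fun g => F (upd g i j)) g = geo r k F (upd g i j).
Proof.
elim: k g => [|k IH] g ki //=.
apply: eq_eseriesr => l _; rewrite IH 1?ltnW //.
by rewrite updC //; rewrite neq_ltn ki.
Qed.

(** Memorylessness: shifting the index of the geometric series in coordinate i costs one factor
    [r i]. *)
Lemma geo_shift k i F g : (forall g, 0 <= F g) -> (i < k)%N ->
  geo r k (fun g => if g i == 0%N then 0 else F (upd g i (g i).-1)) g
  = ((r i)%:E * geo r k F g)%E.
Proof.
set F' := (X in geo r k X); have F'0 : (forall g, 0 <= F g) -> forall g, 0 <= F' g.
  by move=> F0 h; rewrite /F'; case: ifP.
move=> F0; elim: k g => [//|k IH] g; rewrite ltnS leq_eqVlt => /predU1P[E|ik] /=.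
  rewrite nneseries_recl //; last by move=> *; apply: term_ge0; exact: F'0.
  rewrite (_ : geo r k F' (upd g k 0) = 0)%E; last first.
    rewrite (@eq_geo _ _ (fun=> 0 * 0)); first by rewrite geoZ // mul0e.
    by move=> g' g'E; rewrite /F' E g'E // /upd eqxx mul0r.
  rewrite mule0 add0e -nneseries_addn; last by move=> j; apply: term_ge0; exact: F'0.
  rewrite -nneseriesZl; last by move=> *; exact: term_ge0.
  apply: eq_eseriesr => j _.
  rewrite addn1 exprSr E EFinM muleA [((r k)%:E * _)%E]muleC -!muleA; congr (_ * (_ * _))%E.
  rewrite -[in RHS](upd_upd g k j.+1) -(@geo_upd k k j F (upd g k j.+1) (leqnn k)).
  apply: eq_geo => g' g'E.
  by rewrite /F' E g'E // /upd eqxx.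
rewrite -nneseriesZl; last by move=> *; exact: term_ge0.
by apply: eq_eseriesr => j _; rewrite IH // muleCA.
Qed.

Lemma geometric_sum (x : R) : 0 <= x < 1 ->
  (\sum_(0 <= j <oo) (x ^+ j)%:E)%E = ((1 - x)^-1)%:E.
Proof.
move=> /andP[x0 x1]; apply/cvg_lim => //.
have := @cvg_geometric_series R 1 x; rewrite ger0_norm // mul1r => /(_ x1) H.
rewrite (_ : (fun _ => _) = EFin \o series (geometric 1 x)); last first.
  by apply/funext => m /=; rewrite /series /= sumEFin; congr EFin; apply: eq_bigr => j _; rewrite mul1r.
by apply: cvg_comp H _.
Qed.

Lemma geo_prod k s g : 0 <= s -> (forall i, (i < k)%N -> s * r i < 1) ->
  geo r k (fun g => \prod_(i < k) s ^+ g i) g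
  = (\prod_(i < k) (1 - s * r i)^-1)%:E.
Proof.
move=> s0; elim: k g => [|k IH] g sr /=; first by rewrite !big_ord0.
rewrite big_ord_recr /= EFinM.
rewrite -geometric_sum; last by rewrite mulr_ge0 ?sr.
have P0 (h : nat -> nat) : 0 <= \prod_(i < k) s ^+ h i.
  by apply: prodr_ge0 => i _; rewrite exprn_ge0.
rewrite -nneseriesZl; last by move=> j _; rewrite lee_fin exprn_ge0 // mulr_ge0.
apply: eq_eseriesr => j _.
rewrite (@eq_geo _ _ (fun g => s ^+ j * \prod_(i < k) s ^+ g i)); last first.
  by move=> g' g'E; rewrite big_ord_recr /= g'E // /upd eqxx mulrC.
rewrite geoZ ?exprn_ge0 // IH => [|i ik]; last by apply: sr; rewrite ltnS ltnW.
by rewrite -!EFinM; congr EFin; rewrite exprMn; ring.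
Qed.

Hypothesis r_lt1 : forall i, r i < 1.

Definition bounded_nneg F := exists C, forall g, 0 <= F g <= C.

Lemma geo_fin_num k F g : bounded_nneg F -> geo r k F g \is a fin_num.
Proof.
move=> [C FC]; have F0 h : 0 <= F h by case/andP: (FC h).
rewrite ge0_fin_numE; last exact: geo_ge0.
have C0 : 0 <= C by have /andP[] := FC g; exact: le_trans.
apply: (@le_lt_trans _ _ (geo r k (fun g => C * \prod_(i < k) 1 ^+ g i) g)).
  apply: le_geo => // h; rewrite big1 ?mulr1; last by move=> *; rewrite expr1n.
  by case/andP: (FC h).
rewrite geoZ // ; last by move=> h; apply: prodr_ge0 => i _; rewrite exprn_ge0.
by rewrite geo_prod // => [|i _]; rewrite ?mul1r // -EFinM ltry.
Qed.

(** On [bounded_nneg] functions [fine] loses nothing, since ratios below 1 make the expectation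
    finite. *)
Definition qgeo k F : R := fine (geo r k F (fun=> 0%N)).

Lemma qgeoE k F : bounded_nneg F -> geo r k F (fun=> 0%N) = (qgeo k F)%:E.
Proof. by move=> bF; rewrite /qgeo fineK // geo_fin_num. Qed.

Lemma bounded_nnegD F G : bounded_nneg F -> bounded_nneg G ->
  bounded_nneg (fun g => F g + G g).
Proof.
move=> [C FC] [C' GC]; exists (C + C') => g.
by have := FC g; have := GC g; lra.
Qed.

Lemma bounded_nnegZ c F : 0 <= c -> bounded_nneg F ->
  bounded_nneg (fun g => c * F g).
Proof.
move=> c0 [C FC]; exists (c * C) => g.
by have /andP[F0 FgC] := FC g; rewrite mulr_ge0 //= ler_wpM2l.
Qed.

Lemma bounded_nneg0 : bounded_nneg (fun=> 0).
Proof. by exists 0 => g; rewrite lexx. Qed.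

Lemma bounded_nneg_sum (I : Type) (s : seq I) (P : pred I) (F : I -> (nat -> nat) -> R) :
  (forall a, P a -> bounded_nneg (F a)) ->
  bounded_nneg (fun g => \sum_(a <- s | P a) F a g).
Proof.
move=> bF; elim: s => [|i s IH].
  by under eq_fun do rewrite big_nil; exact: bounded_nneg0.
under eq_fun do rewrite big_cons.
by case Pi: (P i) => //; apply: bounded_nnegD => //; exact: bF.
Qed.

Lemma qgeoD k F G : bounded_nneg F -> bounded_nneg G ->
  qgeo k (fun g => F g + G g) = qgeo k F + qgeo k G.
Proof.
move=> bF bG; apply: EFin_inj; rewrite EFinD -!qgeoE //; last exact: bounded_nnegD.
by apply: geoD => g; [case: bF | case: bG] => C /(_ g)/andP[].
Qed.

Lemma qgeoZ k c F : 0 <= c -> bounded_nneg F ->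
  qgeo k (fun g => c * F g) = c * qgeo k F.
Proof.
move=> c0 bF; apply: EFin_inj; rewrite EFinM -!qgeoE //; last exact: bounded_nnegZ.
by apply: geoZ => // g; case: bF => C /(_ g)/andP[].
Qed.

Lemma qgeo0 k : qgeo k (fun=> 0) = 0.
Proof.
have := @qgeoZ k 0 (fun=> 0) (lexx _) bounded_nneg0.
by under eq_fun do rewrite mulr0; rewrite mul0r.
Qed.

Lemma qgeo_sum k (I : Type) (s : seq I) (P : pred I) (F : I -> (nat -> nat) -> R) :
  (forall a, P a -> bounded_nneg (F a)) ->
  qgeo k (fun g => \sum_(a <- s | P a) F a g)
  = \sum_(a <- s | P a) qgeo k (F a).
Proof.
move=> bF; elim: s => [|i s IH].
  by under eq_fun do rewrite big_nil; rewrite big_nil qgeo0.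
under eq_fun do rewrite big_cons.
rewrite big_cons; case Pi: (P i); last exact: IH.
by rewrite qgeoD ?IH //; [exact: bF | exact: bounded_nneg_sum].
Qed.

Lemma qgeo_shift k i F : bounded_nneg F -> (i < k)%N ->
  qgeo k (fun g => if g i == 0%N then 0 else F (upd g i (g i).-1)) = r i * qgeo k F.
Proof.
move=> bF ik; apply: EFin_inj; rewrite EFinM -!qgeoE //; last first.
  by case: bF => C FC; exists C => g; case: ifP => // _; have := FC g; lra.
by apply: geo_shift => // g; case: bF => C /(_ g)/andP[].
Qed.

End Geometric.

(** The [minn] leaves no gap beyond particle k: the particles ahead of the leader are packed and
    carried along with it. *)
Definition pos (k : nat) (g : nat -> nat) : nat -> int :=
  fun j => (j + \sum_(l < minn j k) g l)%N%:Z.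

Lemma sum_upd n g i c :
  (\sum_(l < n) upd g i c l + (i < n) * g i = \sum_(l < n) g l + (i < n) * c)%N.
Proof.
elim: n => [|n IH]; first by rewrite !big_ord0.
rewrite !big_ord_recr /= {2}/upd; case: (ltngtP i n) => ni.
- have -> : (i < n.+1)%N by lia.
  by move: IH; rewrite ni /= !mul1n; lia.
- have -> : (i < n.+1)%N = false by lia.
  move: IH; have -> : (i < n)%N = false by lia.
  by rewrite /= !mul0n; lia.
- by move: IH; rewrite ni ltnn ltnSn /= !mul1n !mul0n; lia.
Qed.

Lemma pos_ge k g j : packed j <= pos k g j.
Proof. by rewrite /pos /packed; lia. Qed.

Lemma pos0 k g : pos k g 0%N = 0.
Proof. by rewrite /pos min0n big_ord0. Qed.

Lemma pos_le k g j : pos k g j <= packed j + (\sum_(l < k) g l)%N%:Z.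
Proof.
rewrite /pos /packed -PoszD lez_nat leq_add2l.
rewrite (big_ord_widen k) ?geq_minr //.
by rewrite [leqRHS](bigID (fun l : 'I_k => (l < minn j k)%N)) /= leq_addr.
Qed.

Lemma pos_leader k g : pos k g k = packed k + (\sum_(l < k) g l)%N%:Z.
Proof. by rewrite /pos minnn. Qed.

Lemma ler_iXz2l (R : realFieldType) (x : R) (a b : int) : 0 < x <= 1 -> a <= b ->
  x ^ b <= x ^ a.
Proof.
move=> /andP[x0 x1] ab; rewrite -(opprK b) -(opprK a) -(exprz_inv x (- b)) -(exprz_inv x (- a)).
by apply: ler_weXz2l; rewrite ?lerN2 // invf_ge1.
Qed.

Section Intertwining.
Variables (R : realType) (n k : nat) (a : R) (v : nat -> R) (theta : R).
Hypotheses (a_ge0 : 0 <= a) (v_ge0 : forall i, 0 <= v i) (kn : (k < n)%N)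
  (theta_gt0 : 0 < theta).

Definition weights (o : option 'I_n) : R := if o is Some i then v i else a.

Lemma weights_ge0 o : 0 <= weights o.
Proof. by case: o => [i|] /=; [exact: v_ge0|exact: a_ge0]. Qed.

Let s := a + \sum_(i < n) v i.

Lemma sum_weights : \sum_o weights o = s.
Proof. by rewrite sum_option. Qed.

Let F m g := expect weights k m (fun x => theta ^ x 0%N) (pos k g).

Lemma expect_shift m x :
  expect weights k m (fun x => theta ^ x 0%N) (fun j => x j + 1)
  = theta * expect weights k m (fun x => theta ^ x 0%N) x.
Proof.
elim: m x => [|m IH] x /=.
  by rewrite expfzDr ?gt_eqF // mulrC expr1z.
rewrite mulr_sumr; apply: eq_bigr => o _.
by rewrite step_shift IH mulrCA.
Qed.

(** A jump of particle i + 1 widens gap i behind it; a jump of particle 0 feeds no gap and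
    contributes a factor [theta] to the moment. *)
Definition feed i (G : (nat -> nat) -> R) g :=
  if i is i'.+1 then G (upd g i' (g i').+1) else theta * G g.

(** Gap coordinates turn the dynamics into queues in series: a ring of particle i moves one unit
    from gap i to gap i - 1, or does nothing if gap i is empty, while the leader draws on an
    unlimited supply. *)
Lemma expect_ring_clock m i g : (i <= k)%N ->
  expect weights k m (fun x => theta ^ x 0%N) (ring_clock k i (pos k g))
  = if (i < k)%N then
      if g i == 0%N then F m g else feed i (F m) (upd g i (g i).-1)
    else feed i (F m) g.
Proof.
have posD h j b : pos k h j + b%:Z = (j + \sum_(l < minn j k) h l + b)%N%:Z.
  by rewrite /pos -PoszD.
move=> ik; rewrite /ring_clock; case: (ltnP i k) => ik'.
  case: (posnP (g i)) => [gi|gi].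
    congr expect; apply/funext => j; case: eqP => [->|//].
    rewrite /pos (minn_idPl (ltnW ik')) (minn_idPl ik') big_ord_recr /= gi.
    by lia.
  have -> : (fun j => if j == i then Num.min (pos k g i + 1) (pos k g i.+1 - 1)
             else pos k g j) = fun j => pos k g j + (j == i)%N%:Z.
    apply/funext => j; case: eqP => [->|_]; last by rewrite addr0.
    rewrite /pos (minn_idPl (ltnW ik')) (minn_idPl ik') big_ord_recr /=.
    by lia.
  case: i ik ik' gi => [|i] ik ik' gi /=.
    rewrite /F -expect_shift; congr expect; apply/funext => j.
    have := @sum_upd (minn j k) g 0 (g 0%N).-1.
    rewrite /pos leq_min ik' andbT; case: j => [|j] /=; first by rewrite min0n !big_ord0.
    by lia.
  rewrite /F; congr expect; apply/funext => j.
  have := @sum_upd (minn j k) g i.+1 (g i.+1).-1.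
  set g' := upd g i.+1 _; have g'i : g' i = g i by rewrite /g' /upd ltn_eqF.
  have := @sum_upd (minn j k) g' i (g' i).+1.
  rewrite /pos !leq_min ik' (ltnW ik') !andbT g'i.
  by case: (ltngtP i.+1 j) => ij /=; [| |rewrite -ij]; case: (ltnP i j) => ij' /=;
    rewrite ?mul1n ?mul0n; lia.
have ikE : i = k by lia.
have -> : (i == k) = true by rewrite ikE eqxx.
clear ik ik'; case: i ikE => [|i] ikE /=.
  rewrite /F -expect_shift; congr expect; apply/funext => j.
  by rewrite -ikE.
rewrite /F; congr expect; apply/funext => j.
have := @sum_upd (minn j k) g i (g i).+1.
have -> : (k <= j)%N = (i < minn j k)%N by lia.
rewrite /pos; case: (i < _)%N; rewrite ?mul1n ?mul0n; lia.
Qed.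

Hypotheses (vk_gt0 : 0 < v k) (vk_lt : forall i, (i < k)%N -> v k < v i).

(** The stationary ratio of a queue with arrival rate [v k], that of the leader, and service rate
    [v i]. *)
Definition gap_ratio i : R := if (i < k)%N then v k / v i else 0.

Lemma gap_ratio_ge0 i : 0 <= gap_ratio i.
Proof. by rewrite /gap_ratio; case: ifP => // _; rewrite divr_ge0. Qed.

Lemma gap_ratio_lt1 i : gap_ratio i < 1.
Proof.
rewrite /gap_ratio; case: ifP => // ik.
by rewrite ltr_pdivrMr ?mul1r ?vk_lt // (lt_trans vk_gt0) ?vk_lt.
Qed.

(** A crude bound that makes the geometric expectations below finite, so that they can be handled as
    reals. *)
Lemma expect_pow_bound m x : (forall j, packed j <= x j) ->
  0 <= expect weights k m (fun x => theta ^ x 0%N) x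
  <= (s * Num.max theta 1) ^+ m * Num.max theta 1 ^ x 0%N.
Proof.
set c := Num.max theta 1; have c1 : 1 <= c by rewrite le_max lexx orbT.
have s0 : 0 <= s by rewrite addr_ge0 ?sumr_ge0.
move=> px; rewrite expect_ge0 /=; last 2 first.
- exact: weights_ge0.
- by move=> y; rewrite ltW // exprz_gt0.
elim: m x px => [|m IH] x px /=.
  rewrite expr0 mul1r; have := px 0%N; rewrite /packed.
  case: (x 0%N) => // z _; rewrite -!exprnP lerXn2r ?nnegrE ?(ltW theta_gt0) //.
    exact: le_trans c1.
  by rewrite le_max lexx.
apply: (@le_trans _ _ (\sum_o weights o * ((s * c) ^+ m * c ^ (x 0%N + 1)))).
  apply: ler_sum => o _; apply: ler_wpM2l; first exact: weights_ge0.
  apply: le_trans (IH _ _) _; first exact: step_ge.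
  apply: ler_wpM2l; first by rewrite exprn_ge0 ?mulr_ge0 // (le_trans _ c1).
  by apply: ler_weXz2l => //; exact: step_le.
rewrite -mulr_suml sum_weights expfzDr; last by rewrite gt_eqF // (lt_le_trans _ c1).
by rewrite expr1z exprS le_eqVlt; apply/orP; left; apply/eqP; ring.
Qed.

Lemma bounded_F m : bounded_nneg (F m).
Proof.
exists ((s * Num.max theta 1) ^+ m) => g.
have := @expect_pow_bound m (pos k g) (pos_ge k g).
by rewrite pos0 expr0z mulr1.
Qed.

Lemma bounded_feed i m : bounded_nneg (feed i (F m)).
Proof.
case: i => [|i] /=; first by apply: bounded_nnegZ (ltW theta_gt0) (bounded_F m).
by have [C FC] := bounded_F m; exists C => g; exact: FC.
Qed.

Let q := qgeo gap_ratio k.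

(** Local balance. After a split according to whether gap i is empty, the shift costs the ratio
    [v k / v i] in both decompositions [E1] and [E2], and this turns the rate [v i] into the rate
    [v k] of the leader for every i. *)
Let qring i m : (i < k)%N ->
  v i * q (fun g => if g i == 0%N then F m g else feed i (F m) (upd g i (g i).-1))
  = v i * q (F m) + v k * (q (feed i (F m)) - q (feed i.+1 (F m))).
Proof.
move=> ik; pose Z g := if g i == 0%N then F m g else 0.
pose sh (G : (nat -> nat) -> R) g := if g i == 0%N then 0 else G (upd g i (g i).-1).
have bZ : bounded_nneg Z.
  by have [C FC] := bounded_F m; exists C => g; rewrite /Z; have := FC g; case: ifP; lra.
have bsh G : bounded_nneg G -> bounded_nneg (sh G).
  move=> [C GC]; exists C => g; rewrite /sh; case: ifP => _ //.
  by have := GC g; lra.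
have E1 : (fun g => if g i == 0%N then F m g else feed i (F m) (upd g i (g i).-1))
    = fun g => Z g + sh (feed i (F m)) g.
  by apply/funext => g; rewrite /Z /sh; case: ifP => _; rewrite ?addr0 ?add0r.
have E2 : F m = fun g => Z g + sh (feed i.+1 (F m)) g.
  apply/funext => g; rewrite /Z /sh; case: (posnP (g i)) => gi; rewrite ?addr0 // add0r /=.
  congr (F m _); apply/funext => l; rewrite /upd eqxx.
  by case: eqP => [->|//]; rewrite prednK.
have qsh j : q (fun g => Z g + sh (feed j (F m)) g)
    = q Z + v k / v i * q (feed j (F m)).
  rewrite /q qgeoD //; [|exact: gap_ratio_ge0|exact: gap_ratio_lt1|by apply: bsh; exact: bounded_feed].
  rewrite /sh qgeo_shift //; [|exact: gap_ratio_ge0|exact: gap_ratio_lt1|exact: bounded_feed].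
  by rewrite /gap_ratio ik.
have -> : q (F m) = q Z + v k / v i * q (feed i.+1 (F m)) by rewrite {1}E2 qsh.
rewrite E1 qsh; field.
by rewrite gt_eqF // (lt_trans vk_gt0) ?vk_lt.
Qed.

(* Burke's property in the form of an intertwining relation: with geometric
   gaps, particle 0 sees a free walk with the rate of the leader. *)
Lemma qgeo_expectS m : q (F m.+1) = (s + v k * (theta - 1)) * q (F m).
Proof.
pose C i g := expect weights k m (fun x => theta ^ x 0%N) (ring_clock k i (pos k g)).
(* The convention [t k.+1 = q (F m)] lets the leader, whose jumps empty no gap, fit the same
   difference as the other particles, so that the sum over particles telescopes. *)
pose t i := if (i <= k)%N then q (feed i (F m)) else q (F m).
have bC i : bounded_nneg (C i).
  have [B FB] := bounded_F m.
  case: (leqP i k) => ik; last first.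
    exists B => g; rewrite /C (_ : ring_clock _ _ _ = pos k g); first exact: FB.
    by rewrite /ring_clock ltnNge ltnW //= gtn_eqF.
  have [B' FB'] := bounded_feed i m.
  exists (B + B') => g; rewrite /C expect_ring_clock //.
  have := FB g; have := FB' g; have := FB' (upd g i (g i).-1).
  by case: ifP => _; [case: ifP => _|]; lra.
have qC i : v i * q (C i)
    = v i * q (F m) + (if (i <= k)%N then v k * (t i - t i.+1) else 0).
  case: leqP => ik; last first.
    rewrite addr0 /C; congr (_ * q _); apply/funext => g; rewrite /F; congr expect.
    by rewrite /ring_clock ltnNge ltnW //= gtn_eqF.
  have -> : C i = fun g => if (i < k)%N then
      if g i == 0%N then F m g else feed i (F m) (upd g i (g i).-1)
      else feed i (F m) g.
    by apply/funext => g; rewrite /C expect_ring_clock.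
  rewrite /t ik; case: (ltnP i k) => ik'; first exact: qring.
  have -> : i = k by lia.
  ring.
have -> : F m.+1 = fun g => a * F m g + \sum_(i < n) v i * C i g.
  by apply/funext => g; rewrite /F /= sum_option.
rewrite /q qgeoD; [|exact: gap_ratio_ge0|exact: gap_ratio_lt1| |]; last 2 first.
- by apply: bounded_nnegZ => //; exact: bounded_F.
- by apply: bounded_nneg_sum => i _; exact: bounded_nnegZ.
rewrite qgeoZ //; [|exact: gap_ratio_ge0|exact: gap_ratio_lt1|exact: bounded_F].
rewrite qgeo_sum; [|exact: gap_ratio_ge0|exact: gap_ratio_lt1|]; last first.
  by move=> i _; exact: bounded_nnegZ.
rewrite -!/q (eq_bigr (fun i : 'I_n => v i * q (F m)
    + (if (i <= k)%N then v k * (t i - t i.+1) else 0))); last first.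
  by move=> i _; rewrite -qC /q qgeoZ //; [exact: gap_ratio_ge0|exact: gap_ratio_lt1].
rewrite big_split /= -mulr_suml -big_mkcond /= -mulr_sumr.
(* Only the two ends survive: [theta] from particle 0 and 1 from the leader, whence
   [v k * (theta - 1)]. *)
have -> : \sum_(i < n | (i <= k)%N) (t i - t i.+1) = t 0%N - t k.+1.
  transitivity (\sum_(i < k.+1) (t i - t i.+1)).
    by rewrite (big_ord_widen n (fun i => t i - t i.+1)).
  rewrite -(big_mkord xpredT (fun i => t i - t i.+1)) -[RHS]opprB.
  by rewrite -telescope_sumr // -sumrN; apply: eq_bigr => i _; rewrite opprB.
rewrite /t leq0n ltnn /= /q qgeoZ ?ltW //; [|exact: gap_ratio_ge0|exact: gap_ratio_lt1|exact: bounded_F].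
rewrite -/q /s; ring.
Qed.

Lemma qgeo_expect m : q (F m) = (s + v k * (theta - 1)) ^+ m * \prod_(i < k) (1 - gap_ratio i)^-1.
Proof.
elim: m => [|m IH]; last by rewrite qgeo_expectS IH exprS mulrA.
rewrite expr0 mul1r; apply: EFin_inj.
rewrite -qgeoE; [|exact: gap_ratio_ge0|exact: gap_ratio_lt1|exact: bounded_F].
rewrite (eq_bigr (fun i : 'I_k => (1 - 1 * gap_ratio i)^-1)); last by move=> i _; rewrite mul1r.
rewrite -(geo_prod gap_ratio_ge0 (fun=> 0%N)) //; last by move=> i _; rewrite mul1r gap_ratio_lt1.
apply: eq_geo => g _; rewrite /F /= pos0 expr0z big1 // => i _; exact: expr1n.
Qed.

Lemma prod_pow_gaps (b : R) (g : nat -> nat) : 0 < b ->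
  \prod_(i < k) b ^+ g i = b ^ (\sum_(i < k) g i)%N.
Proof. by move=> b0; rewrite -exprnP expr_sum. Qed.

(** The packed configuration shifted by the sum of the gaps dominates [pos k g], hence has the
    smaller moment when [theta < 1]. The geometric average of [theta] to the power of that sum is
    the product on the left. *)
Lemma lower_exponential_moment_eq m : theta < 1 ->
  expect weights k m (fun x => theta ^ x 0%N) packed
    * \prod_(i < k) (1 - theta * gap_ratio i)^-1
  <= (s + v k * (theta - 1)) ^+ m * \prod_(i < k) (1 - gap_ratio i)^-1.
Proof.
move=> theta1; rewrite -lee_fin -qgeo_expect.
rewrite -qgeoE; [|exact: gap_ratio_ge0|exact: gap_ratio_lt1|exact: bounded_F].
have th0 := ltW theta_gt0.
rewrite EFinM -(geo_prod gap_ratio_ge0 (fun=> 0%N)) //; last first.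
  move=> i _; rewrite (le_lt_trans _ (gap_ratio_lt1 i)) //.
  by rewrite ler_piMl ?gap_ratio_ge0 // ltW.
have f0 (x : nat -> int) : 0 <= theta ^ x 0%N by rewrite ltW // exprz_gt0.
have E0 x : 0 <= expect weights k m (fun x => theta ^ x 0%N) x.
  by apply: expect_ge0 => // o; exact: weights_ge0.
have p0 (g : nat -> nat) : 0 <= \prod_(i < k) theta ^+ g i.
  by apply: prodr_ge0 => i _; exact: exprn_ge0.
rewrite -geoZ //; last exact: gap_ratio_ge0.
apply: le_geo => [|g|g]; [exact: gap_ratio_ge0|by rewrite mulr_ge0|].
rewrite prod_pow_gaps //; set G := (\sum_(i < k) g i)%N.
rewrite mulrC /F; elim: m {E0} (pos k g) packed (pos_le k g) => [|m IH] x y xy /=.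
  rewrite -expfzDr ?gt_eqF //; have := xy 0%N; rewrite addrC => {}xy.
  by apply: ler_iXz2l => //; rewrite theta_gt0 ltW.
rewrite mulr_sumr; apply: ler_sum => o _; rewrite mulrCA.
apply: ler_wpM2l; first exact: weights_ge0.
by apply: IH => j; have := step_mono k o xy j; rewrite step_shift.
Qed.

(** By [run_min], particle 0 started from [pos k g] lies above the packed displacement with leader k
    plus the sum of the gaps, or above the packed displacement with leader [k']. The second case
    matters only when the latter is small, which its moment of base [phi < 1] detects. *)
Lemma upper_exponential_moment m k' (y : int) (phi : R) : k = k'.+1 -> 1 < theta ->
  0 < phi < 1 ->
  (forall i, (i < k)%N -> theta / phi * gap_ratio i < 1) ->
  expect weights k m (fun x => (y <= x 0%N)%R%:R) packed * theta ^ y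
    * \prod_(i < k) (1 - theta * gap_ratio i)^-1
  <= (s + v k * (theta - 1)) ^+ m * \prod_(i < k) (1 - gap_ratio i)^-1
     + (theta / phi) ^ y * expect weights k' m (fun x => phi ^ x 0%N) packed
       * \prod_(i < k) (1 - theta / phi * gap_ratio i)^-1.
Proof.
move=> kE theta1 /andP[phi0 phi1] tr; rewrite -lee_fin EFinD.
have th0 := ltW theta_gt0; have tp0 : 0 < theta / phi by rewrite divr_gt0.
rewrite -qgeo_expect -qgeoE; [|exact: gap_ratio_ge0|exact: gap_ratio_lt1|exact: bounded_F].
have prod_ge0 b (g : nat -> nat) : 0 < b -> 0 <= \prod_(i < k) b ^+ g i.
  by move=> b0; apply: prodr_ge0 => i _; rewrite exprn_ge0 // ltW.
have y0 b : 0 < b -> 0 <= b ^ y by move=> b0; rewrite ltW // exprz_gt0.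
have E0 k1 (b : R) z : 0 < b -> 0 <= expect weights k1 m (fun x => b ^ x 0%N) z.
  move=> b0; apply: expect_ge0 => [c|z']; first exact: weights_ge0.
  by rewrite ltW // exprz_gt0.
rewrite [X in (X <= _)%E]EFinM -(geo_prod gap_ratio_ge0 (fun=> 0%N)) //; last first.
  move=> i ik; apply: le_lt_trans (tr i ik).
  by rewrite ler_wpM2r ?gap_ratio_ge0 // ler_pdivlMr // ler_piMr // ltW.
rewrite [X in (_ <= _ + X)%E]EFinM -(geo_prod gap_ratio_ge0 (fun=> 0%N)) //;
  last exact: ltW.
have P0 : 0 <= expect weights k m (fun x => (y <= x 0%N)%R%:R) packed.
  by apply: expect_ge0 => [c|x]; [exact: weights_ge0|rewrite ler0n].
rewrite -!geoZ ?mulr_ge0 ?y0 ?E0 //; [|exact: gap_ratio_ge0|by move=> g; apply: prod_ge0|exact: gap_ratio_ge0|by move=> g; apply: prod_ge0].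
rewrite -geoD; [|exact: gap_ratio_ge0|by move=> g; exact: E0|]; last first.
  by move=> g; rewrite !mulr_ge0 ?y0 ?E0 ?prod_ge0.
apply: le_geo => [|g|g]; [exact: gap_ratio_ge0|by rewrite !mulr_ge0 ?y0 ?prod_ge0|].
rewrite !prod_pow_gaps //; set G := (\sum_(i < k) g i)%N.
rewrite /F -!expectE -mulrA mulr_suml mulr_sumr mulr_suml -big_split /=.
apply: ler_sum => o _; set W := \prod_(c <- o) weights c.
rewrite [leRHS](_ : _ = W * (theta ^ run k (pos k g) o 0%N
  + phi ^ run k' packed o 0%N * ((theta / phi) ^ y * (theta / phi) ^ G))); last by ring.
rewrite -mulrA; apply: ler_wpM2l.
  by apply: prodr_ge0 => c _; exact: weights_ge0.
rewrite -!expfzDr ?gt_eqF //.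
case: (leP y (run k packed o 0%N)) => [yD|_]; last first.
  by rewrite /= mul0r addr_ge0 ?mulr_ge0 ?ltW // ?exprz_gt0.
rewrite /= mul1r.
have := @run_min n k' (pos k g) (fun j => packed j + G%:Z) packed o.
rewrite -kE => /(_ _ _)[||Hx|Hx].
- by move=> i _; right; exact: pos_ge.
- by rewrite /G pos_leader.
- apply: (@le_trans _ _ (theta ^ run k (pos k g) o 0%N)); last first.
    by rewrite lerDl mulr_ge0 // ltW // exprz_gt0.
  rewrite ler_eXz2l //; apply: le_trans Hx.
  rewrite (_ : run k _ o = fun j => run k packed o j + G%:Z) ?lerD2r //.
  by elim: (tval o) (packed) => [//|c o' IH] x /=; rewrite step_shift IH.
(* If particle 0 is below [y + G], so is the displacement with leader [k'], and [phi] to the power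
   of their negative difference is at least 1. *)
- have [yx|xy] := leP (y + G%:Z) (run k (pos k g) o 0%N).
    rewrite (@le_trans _ _ (theta ^ run k (pos k g) o 0%N)) // ?ler_eXz2l //.
    by rewrite lerDl mulr_ge0 // ltW // exprz_gt0.
  rewrite (@le_trans _ _ (phi ^ run k' packed o 0%N * (theta / phi) ^ (y + G%:Z))) //; last first.
    by rewrite lerDr ltW // exprz_gt0.
  rewrite expfzMl exprz_inv mulrCA ler_peMr //; first by rewrite ltW // exprz_gt0.
  rewrite -expfzDr ?gt_eqF // -(expr0z phi); apply: ler_iXz2l; first by rewrite phi0 ltW.
  lia.
Qed.

End Intertwining.

(** * Tails of the displacement for given rates *)

Section QuenchedTails.
Variables (R : realType) (n : nat) (h : R).
Hypothesis h_gt0 : 0 < h.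

(* [S] normalizes the total weight to [expR (- (h * S)) * (1 + h * S)]; the
   clocks themselves have [S = \sum_(i < n) p i]. *)
Definition rated_weights (S : R) (p : nat -> R) : option 'I_n -> R :=
  weights (expR (- (h * S)) * (1 + h * S - h * \sum_(i < n) p i))
    (fun i => h * p i * expR (- (h * S))).

Section FixedRates.
Variables (S : R) (p : nat -> R).
Hypotheses (p_ge0 : forall i, 0 <= p i)
  (pS : h * \sum_(i < n) p i <= 1 + h * S).

Lemma rated_weights_ge0 a : 0 <= rated_weights S p a.
Proof.
case: a => [i|] /=; first by rewrite !mulr_ge0 ?expR_ge0 // ltW.
by rewrite mulr_ge0 ?expR_ge0 // subr_ge0.
Qed.

Lemma sum_rated_weights :
  \sum_a rated_weights S p a = expR (- (h * S)) * (1 + h * S).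
Proof.
rewrite sum_option /= -mulr_suml -mulr_sumr; ring.
Qed.

Let base_le (x : R) : 
  expR (- (h * S)) * (1 + h * S) + h * x * expR (- (h * S)) <= expR (h * x).
Proof.
rewrite [leLHS](_ : _ = expR (- (h * S)) * (1 + (h * S + h * x))); last by ring.
rewrite [leRHS](_ : _ = expR (- (h * S)) * expR (h * S + h * x)).
  by rewrite ler_wpM2l ?expR_ge0 // expR_ge1Dx.
by rewrite -expRD; congr expR; ring.
Qed.

Lemma rated_power_le (x : R) m :
  0 <= expR (- (h * S)) * (1 + h * S) + h * x * expR (- (h * S)) ->
  (expR (- (h * S)) * (1 + h * S) + h * x * expR (- (h * S))) ^+ m
  <= expR (m%:R * h * x).
Proof.
move=> b0; rewrite -(mulrA m%:R) expRM_natl.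
by rewrite lerXn2r ?nnegrE ?expR_ge0.
Qed.

End FixedRates.

(** Slowing the leader down to a rate [l] below all the rates behind it only lowers the displacement
    and makes Burke's property available. The quotient of the two geometric products is the product
    of the [1 + s * (l / (p i - l))], whence the equilibrium gaps in the exponent. *)
Lemma quenched_lower_tail (S : R) (p : nat -> R) (k : nat) (l s : R) (m : nat) : (forall i, 0 <= p i) ->
  h * \sum_(i < n) p i <= 1 + h * S -> (k < n)%N ->
  0 < l <= p k -> (forall i, (i < k)%N -> l < p i) -> 0 < s < 1 ->
  expect (rated_weights S p) k m (fun x => (1 - s) ^ x 0%N) packed
  <= expR (s * (\sum_(i < k) l / (p i - l) - m%:R * h * l)).
Proof.
move=> p0 pS kn /andP[l0 lpk] lp /andP[s0 s1].
have th0 : 0 < 1 - s by rewrite subr_gt0.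
have h0 := ltW h_gt0.
pose p' i := if i == k then l else p i.
have p'0 i : 0 <= p' i by rewrite /p'; case: ifP => // _; exact: ltW.
have p'k i : (i < k)%N -> p' i = p i by move=> ik; rewrite /p' ltn_eqF.
have p'_le i : p' i <= p i by rewrite /p'; case: eqP => [->|].
have p'S : h * \sum_(i < n) p' i <= 1 + h * S.
  by apply: le_trans pS; rewrite ler_wpM2l // ler_sum.
apply: (@le_trans _ _ (expect (rated_weights S p') k m (fun x => (1 - s) ^ x 0%N) packed)).
  rewrite -lerN2 -!expectN; apply: expect_rate_mono.
  - exact: rated_weights_ge0.
  - exact: rated_weights_ge0.
  - by move=> i _ /=; rewrite ler_wpM2r ?expR_ge0 // ler_wpM2l.
  - by rewrite !sum_rated_weights.
  - move=> x y xy; rewrite lerN2; apply: ler_iXz2l => //.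
    by rewrite th0 /= gerBl ltW.
  - exact: spread_packed.
set e := expR (- (h * S)).
pose v i := h * p' i * e.
have e0 : 0 < e by rewrite expR_gt0.
have v0 i : 0 <= v i by rewrite !mulr_ge0 // ltW.
have a0 : 0 <= e * (1 + h * S - h * \sum_(i < n) p' i).
  by rewrite mulr_ge0 ?(ltW e0) // subr_ge0.
have vk0 : 0 < v k by rewrite !mulr_gt0 // /p' eqxx.
have vk_lt i : (i < k)%N -> v k < v i.
  move=> ik; rewrite /v ltr_pM2r // ltr_pM2l //.
  by rewrite (p'k i ik) /p' eqxx lp.
have := lower_exponential_moment_eq a0 v0 kn th0 vk0 vk_lt m.
rewrite gtrBl s0 => /(_ isT).
rewrite -(@sum_weights _ n) -/(rated_weights S p') sum_rated_weights -/e.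
have r0 i : 0 <= gap_ratio k v i by move: i; exact: gap_ratio_ge0.
have r1 i := gap_ratio_lt1 vk0 vk_lt i.
have tr1 i : (1 - s) * gap_ratio k v i < 1.
  by rewrite (le_lt_trans _ (r1 i)) // ler_piMl // gerBl ltW.
rewrite -ler_pdivlMr; last by rewrite prodr_gt0 // => i _; rewrite invr_gt0 subr_gt0.
move=> H; apply: le_trans H _.
have -> : v k * (1 - s - 1) = h * (- l * s) * e by rewrite /v /p' eqxx; ring.
have base0 : 0 <= e * (1 + h * S) + h * (- l * s) * e.
  rewrite [leRHS](_ : _ = e * (1 + h * S - h * l * s)); last by ring.
  rewrite mulr_ge0 ?(ltW e0) // (le_trans _ (_ : 1 + h * S - h * \sum_(i < n) p' i <= _)) ?subr_ge0 //.
  rewrite lerD2l lerN2 -mulrA ler_wpM2l // (@le_trans _ _ l) //.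
    by rewrite ler_piMr ?ltW.
  rewrite (bigD1 (Ordinal kn)) //= {1}/p' eqxx lerDl; exact: sumr_ge0.
rewrite -(mulrA (_ ^+ m)) -prodf_div mulrBr expRD mulrC; apply: ler_pM.
- apply: prodr_ge0 => i _.
  by rewrite invrK mulr_ge0 ?invr_ge0 ?subr_ge0 ?(ltW (r1 _)) ?(ltW (tr1 _)).
- by rewrite exprn_ge0.
- rewrite mulr_sumr expR_sum; apply: ler_prod => i _.
  rewrite invrK mulr_ge0 ?invr_ge0 ?subr_ge0 ?(ltW (r1 _)) ?(ltW (tr1 _)) //=.
  have rE : gap_ratio k v i = l / p i.
    rewrite /gap_ratio ltn_ord /v (p'k i) // /p' eqxx; field.
    by rewrite (gt_eqF e0) !gt_eqF // (lt_trans l0) ?lp.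
  rewrite rE.
  have pi0 : 0 < p i by rewrite (lt_trans l0) ?lp.
  rewrite [leLHS](_ : _ = 1 + s * (l / (p i - l))); first exact: expR_ge1Dx.
  by field; rewrite subr_eq0 !gt_eqF ?lp.
- have -> : - (s * (m%:R * h * l)) = m%:R * h * (- l * s) by ring.
  exact: rated_power_le.
Qed.

(** Raising the rates behind the leader to at least [b] and the leader to [l] only increases the
    displacement, and it keeps the gap ratios at most [l / b], so that moments of base larger than 1
    are finite. The second summand is the alternative of leader k, now of rate at least [b > l2]. *)
Lemma quenched_upper_tail (S : R) (p : nat -> R) (k : nat) (b l l2 s s2 rho : R)
    (m : nat) (y : int) : (forall i, 0 <= p i) ->
  h * \sum_(i < n) p i <= 1 + h * S -> h * (b *+ n) <= 1 -> S = \sum_(i < n) p i ->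
  (k.+1 < n)%N -> 0 < l -> l < b -> 0 < l2 -> l2 < b -> p k.+1 <= l ->
  0 < s -> 0 < s2 < 1 -> rho < 1 -> (1 + s) / (1 - s2) * (l / b) <= rho ->
  expect (rated_weights S p) k.+1 m (fun x => (y <= x 0%N)%R%:R) packed
  <= expR (s * (m%:R * h * l - \sum_(i < k.+1) l / (Num.max (p i) b - l)))
     * (1 + s) ^ (- y)
   + (1 - s2) ^ (- y)
     * expR (s2 * ((l2 / (b - l2)) *+ k - m%:R * h * l2)) * ((1 - rho)^-1) ^+ k.+1.
Proof.
move=> p0 pS hbn SE kn l0 lb l20 l2b pkl s0 /andP[s20 s21] rho1 tr.
have b0 := lt_trans l0 lb.
have th1 : 1 < 1 + s by rewrite ltrDl.
have th0 : 0 < 1 + s by rewrite (lt_trans _ th1).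
have ph0 : 0 < 1 - s2 by rewrite subr_gt0.
have h0 := ltW h_gt0.
pose q i := if (i <= k)%N then Num.max (p i) b else if i == k.+1 then l else p i.
have q0 i : 0 <= q i.
  rewrite /q; case: ifP => _; first by rewrite le_max p0.
  by case: ifP => // _; exact: ltW.
have pq i : (i <= k.+1)%N -> p i <= q i.
  rewrite /q leq_eqVlt => /predU1P[->|ik]; first by rewrite ltnn eqxx.
  by rewrite -ltnS ik le_max lexx.
have qb i : (i <= k)%N -> b <= q i by move=> ik; rewrite /q ik le_max lexx orbT.
have qk : q k.+1 = l by rewrite /q ltnn eqxx.
(* The raised rates may sum to more than [S]; [h * (b *+ n) <= 1] keeps the weight of the empty step
   nonnegative. *)
have qS : h * \sum_(i < n) q i <= 1 + h * S.
  apply: (@le_trans _ _ (h * (b *+ n) + h * S)); last by rewrite lerD2r.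
  rewrite -mulrDr ler_wpM2l // SE -[n in b *+ n]card_ord -sumr_const -big_split /=.
  apply: ler_sum => i _; have := p0 i; rewrite /q.
  case: ifP => _ pi0; first by rewrite ge_max; apply/andP; lra.
  by case: ifP => _; lra.
apply: (@le_trans _ _ (expect (rated_weights S q) k.+1 m (fun x => (y <= x 0%N)%R%:R) packed)).
  apply: expect_rate_mono.
  - exact: rated_weights_ge0.
  - exact: rated_weights_ge0.
  - move=> i ik /=; rewrite ler_wpM2r ?expR_ge0 // ler_wpM2l //; exact: pq.
  - by rewrite !sum_rated_weights.
  - move=> x x' xx'; rewrite ler_nat; case: leP => // yx.
    by rewrite (le_trans yx).
  - exact: spread_packed.
set e := expR (- (h * S)).
pose v i := h * q i * e.
have e0 : 0 < e by rewrite expR_gt0.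
have v0 i : 0 <= v i by rewrite !mulr_ge0 // ltW.
have a0 : 0 <= e * (1 + h * S - h * \sum_(i < n) q i).
  by rewrite mulr_ge0 ?(ltW e0) // subr_ge0.
have vk0 : 0 < v k.+1 by rewrite !mulr_gt0 // qk.
have vk_lt i : (i < k.+1)%N -> v k.+1 < v i.
  by move=> ik; rewrite /v ltr_pM2r // ltr_pM2l // qk (lt_le_trans lb) ?qb.
have rE i : (i < k.+1)%N -> gap_ratio k.+1 v i = l / q i.
  move=> ik; rewrite /gap_ratio ik /v qk; field.
  by rewrite (gt_eqF e0) !gt_eqF // (lt_le_trans b0) ?qb.
have r_le i : (i < k.+1)%N -> (1 + s) / (1 - s2) * gap_ratio k.+1 v i <= rho.
  move=> ik; apply: le_trans tr; rewrite rE //; apply: ler_wpM2l.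
    by rewrite divr_ge0 ?(ltW th0) ?(ltW ph0).
  by rewrite ler_wpM2l ?(ltW l0) // lef_pV2 ?posrE ?qb // (lt_le_trans b0) ?qb.
have phi01 : 0 < 1 - s2 < 1 by rewrite ph0 gtrBl.
have := @upper_exponential_moment _ _ _ _ _ _ a0 v0 kn th0 vk0 vk_lt m k y _ erefl th1 phi01.
move/(_ (fun i ik => le_lt_trans (r_le i ik) rho1)).
rewrite -(@sum_weights _ n) -/(rated_weights S q) sum_rated_weights -/e.
have r0 i : 0 <= gap_ratio k.+1 v i by exact: gap_ratio_ge0.
have r1 i := gap_ratio_lt1 vk0 vk_lt i.
have tr1 i : (i < k.+1)%N -> (1 + s) * gap_ratio k.+1 v i < 1.
  move=> ik; apply: le_lt_trans (le_lt_trans (r_le i ik) rho1).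
  rewrite ler_wpM2r // ler_pdivlMr // ler_piMr ?(ltW th0) //.
  by rewrite gerBl ltW.
have T0 : 0 < \prod_(i < k.+1) (1 - (1 + s) * gap_ratio k.+1 v i)^-1.
  by rewrite prodr_gt0 // => i _; rewrite invr_gt0 subr_gt0 tr1.
have y0 : 0 < (1 + s) ^ y by rewrite exprz_gt0.
rewrite -ler_pdivlMr // -ler_pdivlMr //; move=> H; apply: le_trans H _.
rewrite mulrDl mulrDl; apply: lerD.
- rewrite invr_expz; apply: ler_wpM2r; first by rewrite ltW // exprz_gt0.
  have -> : v k.+1 * (1 + s - 1) = h * (l * s) * e by rewrite /v qk; ring.
  have S0 : 0 <= S by rewrite SE sumr_ge0.
  have base0 : 0 <= e * (1 + h * S) + h * (l * s) * e.
    by rewrite addr_ge0 // ?mulr_ge0 ?(ltW e0) ?(ltW l0) ?(ltW s0) // addr_ge0 // mulr_ge0.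
  rewrite -(mulrA (_ ^+ m)) -prodf_div mulrBr expRD; apply: ler_pM.
  + exact: exprn_ge0.
  + apply: prodr_ge0 => i _; rewrite invrK mulr_ge0 ?invr_ge0 ?subr_ge0 ?ltW //.
    exact: tr1.
  + have -> : s * (m%:R * h * l) = m%:R * h * (l * s) by ring.
    exact: rated_power_le.
  + rewrite mulr_sumr -sumrN expR_sum; apply: ler_prod => i _.
    have ik : (i < k.+1)%N by [].
    rewrite invrK mulr_ge0 ?invr_ge0 ?subr_ge0 ?(ltW (r1 _)) ?(ltW (tr1 _ _)) //=.
    have qi : q i = Num.max (p i) b by rewrite /q -ltnS ik.
    have qi0 : 0 < q i by rewrite (lt_le_trans b0) ?qb.
    have lqi : l < q i by rewrite (lt_le_trans lb) ?qb.
    rewrite -qi rE // [leLHS](_ : _ = 1 + - (s * (l / (q i - l)))); first exact: expR_ge1Dx.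
    by field; rewrite subr_eq0 !gt_eqF.
- have E2 := @quenched_lower_tail S q k l2 s2 m q0 qS (ltnW kn).
  have l2q i : (i <= k)%N -> l2 < q i by move=> ik; rewrite (lt_le_trans l2b) ?qb.
  have := E2; rewrite l20 (ltW (l2q k (leqnn k))) s20 s21 => /(_ isT).
  move=> /(_ (fun i ik => l2q i (ltnW ik)) isT) {}E2.
  rewrite expfzMl exprz_inv.
  set E := expect _ _ _ _ _ in E2 *; set Z := \prod_(i < k.+1) _; set T := \prod_(i < k.+1) _ in T0 *.
  have -> : (1 + s) ^ y * (1 - s2) ^ (- y) * E * Z / T / (1 + s) ^ y
      = (1 - s2) ^ (- y) * E * (Z / T) by field; rewrite !gt_eqF.
  have E0 : 0 <= E.
    apply: expect_ge0 => [c|x]; first exact: rated_weights_ge0.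
    by rewrite ltW // exprz_gt0.
  apply: ler_pM.
  + by rewrite mulr_ge0 // ltW // exprz_gt0.
  + rewrite divr_ge0 ?(ltW T0) // prodr_ge0 // => i _.
    by rewrite invr_ge0 subr_ge0 (le_trans (r_le _ _)) // ltW.
  + apply: ler_wpM2l; first by rewrite ltW // exprz_gt0.
    apply: le_trans E2 _; rewrite ler_expR ler_wpM2l ?(ltW s20) // lerD2r.
    rewrite -[k in _ *+ k]card_ord -sumr_const; apply: ler_sum => i _.
    rewrite ler_wpM2l ?(ltW l20) // lef_pV2 ?posrE ?subr_gt0 ?l2q ?(ltnW (ltn_ord i)) //.
    by rewrite lerD2r qb // ltnW.
  + rewrite -prodf_div -[k.+1 in X in _ <= X]card_ord -prodr_const.
    apply: ler_prod => i _; have ik : (i < k.+1)%N by [].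
    rewrite invrK mulr_ge0 ?invr_ge0 ?subr_ge0 ?(ltW (tr1 _ _)) //=; last first.
      by rewrite (le_trans (r_le _ _)) // ltW.
    rewrite (@le_trans _ _ ((1 - (1 + s) / (1 - s2) * gap_ratio k.+1 v i)^-1)) //.
      rewrite ler_piMr // ?invr_ge0 ?subr_ge0 ?(le_trans (r_le _ _)) // ?(ltW rho1) //.
      by rewrite gerBl mulr_ge0 // ltW.
    rewrite lef_pV2 ?posrE ?subr_gt0 ?(le_lt_trans (r_le _ _)) //.
    by rewrite lerD2l lerN2 r_le.
Qed.

End QuenchedTails.

(** * From clock paths to ringing patterns *)

Section Paths.
Variable R : realType.

Lemma near_right_ex (t : R) (Q : R -> Prop) :
  (\forall s \near t^'+, Q s) -> exists2 e, 0 < e & forall s, t < s -> s < t + e -> Q s.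
Proof.
rewrite near_withinE /= => /nbhs_ballP[e /= e0 H]; exists e => // s ts ste.
by apply: H => //; rewrite /ball /= ltr_distlC; lra.
Qed.

(** The infimum of the failure times is itself a failure, since right continuity would otherwise
    carry [Q] past it. This avoids enumerating the jump times of a path. *)
Lemma first_failure (a b : R) (Q : R -> Prop) :
  (forall s, a <= s -> Q s -> \forall r \near s^'+, Q r) ->
  a <= b -> Q a -> ~ Q b ->
  exists2 s, a < s <= b & ~ Q s /\ forall r, a <= r < s -> Q r.
Proof.
move=> rc ab Qa nQb.
pose B := [set s | a <= s <= b /\ ~ Q s].
have Bb : B b by split; rewrite ?ab ?lexx.
have lbB : lbound B a by move=> s [/andP[]].
have hB : has_inf B by split; [exists b|exists a].
have infa : a <= inf B by apply: lb_le_inf => //; exists b.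
have infb : inf B <= b by apply: ge_inf => //; exists a.
have Qlt r : a <= r < inf B -> Q r.
  move=> /andP[ar rB]; apply: contrapT => nQr.
  have : inf B <= r.
    by apply: ge_inf; [exists a|split=> //; rewrite ar (le_trans (ltW rB))].
  by rewrite leNgt rB.
have nQ : ~ Q (inf B).
  move=> QB; have [e e0 He] := near_right_ex (rc _ infa QB).
  have [s [/andP[sa sb] nQs] sBe] := inf_adherent e0 hB.
  have : inf B <= s by apply: ge_inf; [exists a|split=> //; rewrite sa].
  rewrite le_eqVlt => /predU1P[sE|Bs]; first by apply: nQs; rewrite -sE.
  by apply: nQs; exact: He.
exists (inf B) => //; rewrite infb andbT lt_neqAle infa andbT.
by apply/eqP => aE; apply: nQ; rewrite -aE.
Qed.

Lemma near_left_ex (a t : R) (Q : R -> Prop) : a < t ->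
  (\forall s \near t^'-, Q s) -> exists2 s, a < s < t & Q s.
Proof.
move=> at_ H.
have : \forall s \near t^'-, (a < s < t) /\ Q s.
  near=> s; split; last by near: s.
  by apply/andP; split; near: s; [exact: nbhs_left_gt|exact: nbhs_left_lt].
by move=> /filter_ex[s [? ?]]; exists s.
Unshelve. all: by end_near. Qed.

Variables (clock : int -> R -> nat) (x : int -> R -> int).
Hypotheses (clockP : forall i, counting_path (clock i)) (xP : exclusion_path clock x).

(** At the first time when the position differs from its initial value, [exclusion_jump] requires a
    ring of clock i, and there is none between a and b. *)
Lemma silent_constant i (a b s : R) : 0 <= a -> clock i a = clock i b ->
  a <= s <= b -> x i s = x i a.
Proof.
move=> a0 nab /andP[as_ sb]; apply: contrapT => ns.
have [_ mono _] := clockP i.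
have [|r /andP[ar rs] [xr xlt]] := @first_failure a s (fun r => x i r = x i a) _ as_ erefl ns.
  move=> r ar xra; have := exclusion_right_continuous xP i (le_trans a0 ar).
  by apply: filterS => r' ->.
apply: xr; have r0 : 0 < r by rewrite (le_lt_trans a0).
have [y [y' [k [H ->]]]] := exclusion_jump xP i r0.
have [s' /andP[as' s'r] [ys' _ ks']] := near_left_ex ar H.
have xs' : x i s' = x i a by apply: xlt; rewrite (ltW as').
have n1 := mono _ _ a0 (ltW as').
have n2 := mono _ _ (le_trans a0 (ltW as')) (ltW s'r).
have n3 := mono _ _ (ltW r0) (le_trans rs sb).
have -> : k = clock i r by lia.
by rewrite eqxx -ys' xs'.
Qed.

(** The ring occurs at the first time the clock changes, and the position is constant before and
    after it. Without control of particle i + 1 only monotonicity is known, which is all that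
    [follows] asks of the last particle. *)
Lemma single_ring i (a b : R) : 0 <= a -> a <= b -> clock i b = (clock i a).+1 ->
  x i a <= x i b /\
  ((forall s, a <= s <= b -> x (i + 1) s = x (i + 1) a) ->
   x i b = Num.min (x i a + 1) (x (i + 1) a - 1)).
Proof.
move=> a0 ab nb; have [_ mono rc] := clockP i.
have [||r /andP[ar rb] [nr nlt]] :=
    @first_failure a b (fun r => clock i r = clock i a) _ ab erefl.
- move=> s as_ sE; have := rc s (le_trans a0 as_).
  by apply: filterS => r' ->.
- by rewrite nb => /eqP; rewrite -[X in _ == X]addn0 -addn1 eqn_add2l.
have r0 : 0 < r by rewrite (le_lt_trans a0).
have n1 := mono _ _ a0 (ltW ar).
have n2 := mono _ _ (ltW r0) rb.
have nrb : clock i r = clock i b by lia.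
have -> : x i b = x i r by apply: (silent_constant (ltW r0) nrb); rewrite rb lexx.
have [y [y' [k [H ->]]]] := exclusion_jump xP i r0.
have [s /andP[as_ sr] [ys ys' ks]] := near_left_ex ar H.
have nsa : clock i s = clock i a by apply: nlt; rewrite (ltW as_).
have xs : x i s = x i a.
  by apply: (silent_constant a0 (esym nsa)); rewrite (ltW as_) lexx.
have -> : k != clock i r by apply/eqP; lia.
rewrite -ys xs; split; first by case: ifP => _; lia.
move=> x1; have := exclusion_order xP i a0.
rewrite -ys' x1 ?(ltW as_) ?(le_trans (ltW sr)) //.
by case: eqP => /=; lia.
Qed.

Lemma follows_of_paths N (h : R) (o : seq (option 'I_N.+1)) : 0 < h ->
  (forall i : 'I_N.+1, forall l, (l < size o)%N ->
     clock i%:Z (h * l.+1%:R) = (clock i%:Z (h * l%:R) + (nth None o l == Some i))%N) ->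
  follows N (fun l i => x i%:Z (h * l%:R)) o.
Proof.
move=> h0 H l lo i iN.
have hl0 : 0 <= h * l%:R by rewrite mulr_ge0 // ltW.
have hl : h * l%:R <= h * l.+1%:R by rewrite ler_pM2l // ler_nat.
have still (i' : nat) s : (i' <= N)%N -> nth None o l != Some (inord i' : 'I_N.+1) ->
    h * l%:R <= s <= h * l.+1%:R -> x i' s = x i' (h * l%:R).
  move=> i'N ne; apply: silent_constant => //.
  by have := H (inord i') l lo; rewrite inordK // (negbTE ne) addn0.
have lastE : h * l%:R <= h * l.+1%:R <= h * l.+1%:R by rewrite hl lexx.
case Eo : (nth None o l) => [j|]; last first.
  by apply: still; rewrite ?Eo.
case: eqVneq => [E|ne] /=; last first.
  apply: still; rewrite // Eo; apply: contra_neq ne => -[->].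
  by rewrite inordK.
have nj := H j l lo; rewrite Eo eqxx addn1 in nj.
have [mono ring] := single_ring hl0 hl nj; rewrite -E in mono ring.
(* The step contains a single ring in all, that of particle i, so particle i + 1 stays still. *)
case: ltnP => // iN'; have i1 : i.+1 = i%:Z + 1 :> int by lia.
rewrite i1 ring // -i1 => s; apply: still => //.
rewrite Eo; apply/eqP => -[/(congr1 val)] /=; rewrite inordK //; lia.
Qed.

End Paths.

(** * The law of the ringing patterns *)

Section ProbabilityBounds.
Context {d : measure_display} {T : measurableType d} {R : realType}.
Variable P : probability T R.

Lemma le_prob_ae (A B : set T) : measurable A -> measurable B ->
  {ae P, forall w, A w -> B w} -> (P A <= P B)%E.
Proof.
move=> mA mB [N [mN N0 NP]].
apply: (@le_trans _ _ (P (B `|` N))).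
  apply: le_measure; rewrite ?inE //; first exact: measurableU.
  move=> w Aw; have [?|nB] := pselect (B w); [by left|right].
  by apply: NP => /(_ Aw).
by rewrite -[leRHS]adde0 -N0; exact: measureU2.
Qed.

Lemma prob_bigsetU_le (I : Type) (s : seq I) (Q : pred I) (F : I -> set T) :
  (forall i, measurable (F i)) ->
  (P (\big[setU/set0]_(i <- s | Q i) F i) <= \sum_(i <- s | Q i) P (F i))%E.
Proof.
move=> mF; elim: s => [|i s IH]; first by rewrite !big_nil measure0.
rewrite !big_cons; case: ifP => // _.
apply: le_trans (measureU2 _ _ _) _ => //; last exact: leeD2l.
by apply: bigsetU_measurable.
Qed.

Lemma prob_bigsetU_disjoint (I : finType) (F : I -> set T) :
  (forall i, measurable (F i)) -> (forall i j w, F i w -> F j w -> i = j) ->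
  P (\big[setU/set0]_(i : I) F i) = (\sum_(i : I) P (F i))%E.
Proof.
move=> mF tF; have -> : \sum_(i : I) P (F i) = \sum_(i <- enum I) P (F i) :> \bar R.
  by rewrite big_enum.
rewrite -[X in P X]big_enum /= -bigcup_seq measure_fin_bigcup //.
- by rewrite -fsbig_seq // enum_uniq.
- by apply/trivIsetP => i j _ _ ij; apply/seteqP; split => // w [/tF H /H /eqP]; rewrite (negbTE ij).
Qed.

End ProbabilityBounds.

Section Clocks.
Context {d : measure_display} {T : measurableType d} {R : realType}.
Variables (P : probability T R) (rate : int -> {RV P >-> R})
  (N : int -> R -> T -> nat).
Hypotheses (mN : forall i t, 0 <= t -> measurable_fun setT (N i t))
  (poissonN : poisson_given_rates P rate N).
Variable n : nat.

Let s := [seq Posz i | i <- iota 0 n].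

Definition increment (o : seq (option 'I_n)) (i : int) (l : nat) : nat :=
  if nth None o l is Some j then Posz j == i else false.

Definition rings_as (h : R) (o : seq (option 'I_n)) : set T :=
  \bigcap_(i in [set` s]) \bigcap_(l in [set l | (l < size o)%N])
    [set w | N i (h * l.+1%:R) w = (N i (h * l%:R) w + increment o i l)%N].

Lemma rings_asP h o w : rings_as h o w ->
  forall i : 'I_n, forall l, (l < size o)%N ->
  N i%:Z (h * l.+1%:R) w = (N i%:Z (h * l%:R) w + (nth None o l == Some i))%N.
Proof.
move=> H i l lo; rewrite (H i%:Z _ l lo) /=; last first.
  by apply/mapP; exists (val i) => //; rewrite mem_iota /= add0n.
congr (_ + _)%N; rewrite /increment; case: nth => [j|//].
by rewrite -(inj_eq Some_inj).
Qed.

Lemma rings_as_inj m h (o o' : m.-tuple (option 'I_n)) w :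
  rings_as h o w -> rings_as h o' w -> o = o'.
Proof.
move=> /rings_asP H /rings_asP H'; apply/val_inj; apply: (@eq_from_nth _ None).
  by rewrite !size_tuple.
move=> l lm; have lm' : (l < size o')%N by rewrite !size_tuple in lm *.
have E i : (nth None o l == Some i) = (nth None o' l == Some i).
  have := H i l lm; have := H' i l lm'; case: (_ == _); case: (_ == _) => //; lia.
case: (nth None o l) E => [i|] E; first by have := E i; rewrite eqxx => /esym/eqP.
by case: (nth None o' l) E => [i|//] E; have := E i; rewrite eqxx.
Qed.

Lemma measurable_rings_as h o : 0 <= h -> measurable (rings_as h o).
Proof.
move=> h0; apply: fin_bigcap_measurable => [|i _]; first exact: finite_seq.
apply: bigcap_measurableType => l _.
rewrite [X in measurable X](_ : _ = \bigcup_(j in [set: nat])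
    (N i (h * l%:R) @^-1` [set j] `&` N i (h * l.+1%:R) @^-1` [set (j + increment o i l)%N])); last first.
  apply/seteqP; split => [w /= E|w [j _ [/= -> ->]] //].
  by exists (N i (h * l%:R) w).
apply: bigcupT_measurable => j.
by apply: measurableI; rewrite -[X in measurable X]setTI; apply: mN => //;
  rewrite mulr_ge0.
Qed.

(** All letters share the factor [expR (- (h * S))], the probability of silence; a ring of i brings
    the further factor [h * p i], and with this [S] the sum of the rates cancels in the weight of
    the empty letter. *)
Lemma prod_poisson_pmf (p : nat -> R) (h : R) o : 0 < h -> (forall i, (i < n)%N -> 0 < p i) ->
  \prod_(i <- s) \prod_(l < size o)
     poisson_pmf (p `|i|%N * (h * l.+1%:R - h * l%:R)) (increment o i l)
  = \prod_(a <- o) rated_weights h (\sum_(i < n) p i) p a.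
Proof.
move=> h0 p0; rewrite exchange_big /= (big_nth None) big_mkord; apply: eq_bigr => l _.
rewrite /s big_map.
have -> : forall F : nat -> R, \prod_(i <- iota 0 n) F i = \prod_(i < n) F i.
  by move=> F; rewrite -[n in iota 0 n]subn0 -/(index_iota 0 n) big_mkord.
have hE : h * l.+1%:R - h * l%:R = h by rewrite -mulrBr -natrB // subSnn mulr1.
rewrite hE /increment /= /poisson_pmf.
have pi0 (i : 'I_n) : 0 < p i * h by rewrite mulr_gt0 ?p0.
have base : \prod_(i < n) expR (- (p i * h)) = expR (- (h * \sum_(i < n) p i)).
  by rewrite -expR_sum; congr expR; rewrite mulr_sumr -sumrN; apply: eq_bigr => i _; rewrite mulrC.
case: (nth None o l) => [j|] /=.
  rewrite (bigD1 j) //= pi0 eqxx expr1 factS fact0 muln1 invr1 mulr1 -base [in RHS](bigD1 j) //=.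
  rewrite [h * p j]mulrC !mulrA; congr (_ * _); apply: eq_bigr => i ij.
  rewrite pi0 (_ : (Posz j == Posz i) = false); last first.
    by apply/negbTE; rewrite eq_sym; move: ij; rewrite -val_eqE /=.
  by rewrite /= expr0 fact0 invr1 !mul1r.
rewrite -base [X in _ * X](_ : _ = 1) ?mulr1; last by rewrite addrK.
by apply: eq_bigr => i _; rewrite pi0 expr0 fact0 invr1 !mul1r.
Qed.

Lemma sigma_rates_measurable A : sigma_rates rate A -> measurable A.
Proof.
apply: smallest_sub; first exact: sigma_algebra_measurable.
move=> B [i _ [C mC <-]]; rewrite setTI -[X in measurable X]setTI.
exact: measurable_funP.
Qed.

Let pr (w : T) (i : nat) : R := rate i%:Z w.
Let pattern_weight (h : R) (w : T) (o : seq (option 'I_n)) : R :=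
  \prod_(a <- o) rated_weights h (\sum_(i < n) pr w i) (pr w) a.

Section OnRates.
Variable A : set T.
Hypotheses (sA : sigma_rates rate A)
  (A01 : forall w, A w -> forall i, (i < n)%N -> 0 < pr w i <= 1).

Let poisson_weight (h : R) (o : seq (option 'I_n)) (w : T) : R :=
  \prod_(i <- s) \prod_(l < size o)
     poisson_pmf (rate i w * (h * l.+1%:R - h * l%:R)) (increment o i l).

Let poisson_weightE h o w : 0 < h -> A w -> poisson_weight h o w = pattern_weight h w o.
Proof.
move=> h0 Aw; rewrite /pattern_weight -prod_poisson_pmf // => [|i ik]; last by have /andP[] := A01 Aw ik.
by rewrite /poisson_weight !big_map.
Qed.

Let measurable_poisson_weight h o :
  measurable_fun A (fun w => (poisson_weight h o w)%:E).
Proof.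
apply/measurable_EFinP; apply: measurable_prod => i _; apply: measurable_prod => l _.
apply: (@measurableT_comp _ _ _ _ _ _ (poisson_pmf ^~ (increment o i l)) _
  (fun w => rate i w * (h * l.+1%:R - h * l%:R))); first exact: measurable_poisson_pmf.
by apply: measurable_funM => //; exact: measurable_funTS.
Qed.

Let poisson_weight_ge0 h o w : 0 <= poisson_weight h o w.
Proof. by apply: prodr_ge0 => i _; apply: prodr_ge0 => l _; exact: poisson_pmf_ge0. Qed.

Lemma prob_rings_as h o : 0 < h ->
  P (A `&` rings_as h o) = (\int[P]_(w in A) (poisson_weight h o w)%:E)%E.
Proof.
move=> h0; rewrite (poissonN (size o) (tt := fun l => h * l%:R) (increment o) sA) //.
- by rewrite map_inj_uniq ?iota_uniq //; move=> ? ? [].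
- by rewrite mulr0.
- by move=> l; rewrite ltr_pM2l // ltr_nat.
Qed.

Lemma sum_prob_rings_as m h (Q : pred (m.-tuple (option 'I_n))) : 0 < h ->
  (\sum_(o : m.-tuple (option 'I_n) | Q o) P (A `&` rings_as h o)
   = \int[P]_(w in A) (\sum_(o : m.-tuple (option 'I_n) | Q o) pattern_weight h w o)%:E)%E.
Proof.
move=> h0; transitivity (\int[P]_(w in A)
    (\sum_(o : m.-tuple (option 'I_n) | Q o) (poisson_weight h o w)%:E))%E.
  rewrite -big_filter; under [in RHS]eq_integral do rewrite -big_filter.
  rewrite ge0_integral_sum //.
  - by apply: eq_bigr => o _; exact: prob_rings_as.
  - exact: sigma_rates_measurable.
  - by move=> o w _; rewrite lee_fin.
apply: eq_integral => w /set_mem Aw; rewrite -sumEFin; apply: eq_bigr => o _.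
by rewrite poisson_weightE.
Qed.

(** Given the rates, a step has at most one ring with probability [expR (- (h * S)) * (1 + h * S)],
    which is at least [1 - (h * S) ^+ 2]; Bernoulli's inequality handles the m steps. *)
Lemma prob_not_rings_as m h : 0 < h -> h * n%:R <= 1 ->
  (P (A `\` \big[setU/set0]_(o : m.-tuple (option 'I_n)) rings_as h o)
   <= (m%:R * (h * n%:R) ^+ 2)%:E)%E.
Proof.
move=> h0 hn1; have mA := sigma_rates_measurable sA.
have mG : measurable (\big[setU/set0]_(o : m.-tuple (option 'I_n)) rings_as h o).
  by apply: bigsetU_measurable => o _; apply: measurable_rings_as; exact: ltW.
rewrite measureD // ?ltey_eq ?fin_num_measure //.
rewrite big_distrr /= prob_bigsetU_disjoint; last 2 first.
- by move=> o; apply: measurableI => //; apply: measurable_rings_as; exact: ltW.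
- by move=> o o' w [_ H] [_ H']; exact: rings_as_inj H H'.
rewrite sum_prob_rings_as //.
set y := (h * n%:R) ^+ 2.
have y01 : 0 <= y <= 1 by rewrite sqr_ge0 exprn_ile1 // mulr_ge0 // ltW.
have bern : 1 - m%:R * y <= (1 - y) ^+ m.
  elim: (m) => [|m' IH]; first by rewrite mul0r subr0 expr0.
  rewrite exprS; apply: le_trans (_ : (1 - y) * (1 - m'%:R * y) <= _).
    rewrite -natr1; have : 0 <= m'%:R * y ^+ 2 by rewrite mulr_ge0 ?sqr_ge0.
    by lra.
  by rewrite ler_wpM2l // subr_ge0; case/andP: y01.
have lb : (((1 - y) ^+ m)%:E * P A <= \int[P]_(w in A)
    (\sum_(o : m.-tuple (option 'I_n)) pattern_weight h w o)%:E)%E.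
  rewrite -integral_cst //; apply: ge0_le_integral => //.
  - by move=> w _; rewrite lee_fin exprn_ge0 // subr_ge0; case/andP: y01.
  - apply: (@eq_measurable_fun _ _ _ _ A
        (fun w => \sum_(o : m.-tuple (option 'I_n)) (poisson_weight h o w)%:E)%E).
      by move=> w /set_mem Aw; rewrite -sumEFin; apply: eq_bigr => o _; rewrite poisson_weightE.
    by apply: emeasurable_sum => o _; exact: measurable_poisson_weight.
  - move=> w Aw; rewrite lee_fin.
    have -> : \sum_(o : m.-tuple (option 'I_n)) pattern_weight h w o
        = (\sum_(a : option 'I_n) rated_weights h (\sum_(i < n) pr w i) (pr w) a) ^+ m.
      transitivity (expect (@rated_weights _ n h (\sum_(i < n) pr w i) (pr w)) 0 m (fun=> 1) packed).
        by rewrite -expectE; apply: eq_bigr => o _; rewrite mulr1.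
      elim: (m) packed => [|m' IH] x //=.
      by rewrite exprS mulr_suml; apply: eq_bigr => a _; rewrite IH.
    rewrite sum_rated_weights; set S := \sum_(i < n) _.
    have S0 : 0 <= S by apply: sumr_ge0 => i _; rewrite ltW //; case/andP: (A01 Aw (ltn_ord i)).
    have Sn : S <= n%:R.
      rewrite -[n in leRHS]card_ord -sumr_const; apply: ler_sum => i _.
      by case/andP: (A01 Aw (ltn_ord i)).
    rewrite lerXn2r ?nnegrE ?subr_ge0 //.
    + by case/andP: y01.
    + by rewrite mulr_ge0 ?expR_ge0 // addr_ge0 // mulr_ge0 // ltW.
    rewrite (@le_trans _ _ ((1 - h * S) * (1 + h * S))) //.
      rewrite -subr_sqr expr1n lerD2l lerN2 lerXn2r ?nnegrE ?mulr_ge0 ?(ltW h0) //.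
      by rewrite ler_wpM2l // ltW.
    rewrite ler_wpM2r ?addr_ge0 ?mulr_ge0 ?(ltW h0) //.
    exact: expR_ge1Dx.
have PA : P A = (fine (P A))%:E by rewrite fineK // fin_num_measure.
have pA0 : 0 <= fine (P A) <= 1 by rewrite -!lee_fin -PA measure_ge0 probability_le1.
apply: (@le_trans _ _ (P A - ((1 - y) ^+ m)%:E * P A)%E); first by rewrite leeB.
rewrite PA -EFinM -EFinB lee_fin.
have my0 : 0 <= m%:R * y by rewrite mulr_ge0 //; case/andP: y01.
by nra.
Qed.

(* Split [0, t] into m.+1 steps: the probability that some step sees more than one
   ring is O(1/m), and [bad] only has to be tested on the remaining patterns. *)
Lemma clock_event_bound (E : set T) (bad : pred (seq (option 'I_n))) (t B : R) (m0 : nat) :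
  measurable E -> 0 < t ->
  (forall m, {ae P, forall w, forall o : m.+1.-tuple (option 'I_n),
     rings_as (t / m.+1%:R) o w -> E w -> bad o}) ->
  (forall m w, (m0 <= m)%N -> A w ->
     \sum_(o : m.+1.-tuple (option 'I_n) | bad o) pattern_weight (t / m.+1%:R) w o <= B) ->
  0 <= B -> (P (A `&` E) <= B%:E)%E.
Proof.
move=> mE t0 HE HB B0; have mA := sigma_rates_measurable sA.
apply/lee_addgt0Pr => eps eps0.
(* Besides [m0], the number of steps exceeds [t * n], so that [h * n <= 1], and
   [(t * n) ^+ 2 / eps], so that the error of [prob_not_rings_as] is at most [eps]. *)
pose m := maxn m0 (maxn (Num.truncn (t * n%:R)) (Num.truncn ((t * n%:R) ^+ 2 / eps))).
set h := t / m.+1%:R.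
have m1 : 0 < m.+1%:R :> R by rewrite ltr0n.
have h0 : 0 < h by rewrite divr_gt0.
have trunc_le (x : R) : (Num.truncn x <= m)%N -> x <= m.+1%:R.
  move=> xm; have := truncnS_gt x; move/ltW => H; apply: le_trans H _.
  by rewrite ler_nat ltnS.
have hn1 : h * n%:R <= 1.
  by rewrite /h mulrAC ler_pdivrMr // mul1r; apply: trunc_le; rewrite /m !leq_max leqnn ?orbT.
have small : m.+1%:R * (h * n%:R) ^+ 2 <= eps.
  rewrite [leLHS](_ : _ = (t * n%:R) ^+ 2 / m.+1%:R); last by rewrite /h; field.
  have := trunc_le ((t * n%:R) ^+ 2 / eps); rewrite /m !leq_max leqnn !orbT => /(_ isT).
  by rewrite ler_pdivrMr // => H; rewrite ler_pdivrMr // [leRHS]mulrC.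
pose G := \big[setU/set0]_(o : m.+1.-tuple (option 'I_n)) rings_as h o.
have mr o : measurable (rings_as h o) by apply: measurable_rings_as; exact: ltW.
have mAr o : measurable (A `&` rings_as h o) by exact: measurableI.
have mG : measurable G by apply: bigsetU_measurable.
pose U := \big[setU/set0]_(o : m.+1.-tuple (option 'I_n) | bad o) (A `&` rings_as h o).
have mU : measurable U by apply: bigsetU_measurable.
apply: (@le_trans _ _ (P (U `|` (A `\` G)))).
  apply: le_prob_ae; [exact: measurableI|by apply: measurableU => //; exact: measurableD|].
  apply: filterS (HE m) => w Hw [Aw Ew].
  have [|nG] := pselect (G w); last by right.
  rewrite /G -bigcup_seq => -[c _ ro]; left.
  rewrite /U -bigcup_seq_cond; exists c => //=.
  by rewrite mem_index_enum /=; apply: Hw.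
apply: le_trans (measureU2 _ _ _) _ => //; first exact: measurableD.
apply: leeD; last by apply: le_trans (prob_not_rings_as m.+1 h0 hn1) _; rewrite lee_fin.
apply: le_trans (prob_bigsetU_le _ _ _ _) _ => //.
rewrite sum_prob_rings_as //.
apply: (@le_trans _ _ (\int[P]_(w in A) B%:E)%E); last first.
  rewrite integral_cst // -[leRHS]mule1 lee_wpmul2l ?lee_fin //.
  exact: probability_le1.
apply: ge0_le_integral => //.
- move=> w Aw; rewrite lee_fin; apply: sumr_ge0 => o _.
  by rewrite -poisson_weightE.
- apply: (@eq_measurable_fun _ _ _ _ A
      (fun w => \sum_(o : m.+1.-tuple (option 'I_n) | bad o) (poisson_weight h o w)%:E)%E).
    by move=> w /set_mem Aw; rewrite -sumEFin; apply: eq_bigr => o _; rewrite poisson_weightE.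
  rewrite (_ : (fun w => _) = fun w =>
    \sum_(o <- [seq o <- index_enum _ | bad (o : m.+1.-tuple (option 'I_n))]) (poisson_weight h o w)%:E)%E.
    by apply: emeasurable_sum => o; exact: measurable_poisson_weight.
  by apply/funext => w; rewrite big_filter.
- by move=> w Aw; rewrite lee_fin HB // /m leq_max leqnn.
Qed.

End OnRates.

End Clocks.

(** * Deviations of sums of independent variables *)

Section Factorization.
Context {d : measure_display} {T : measurableType d} {R : realType}.
Context {d' : measure_display} {V : measurableType d'}.
Variable P : probability T R.

Import HBNNSimple.

(** Linearity over the finitely many values of [f]; the independence of [Y] and [Z] is expressed
    through indicators of [Y] only, without a joint law. *)
Lemma integral_factor_nnsfun (Y : T -> V) (Z : T -> R) (C : R)
    (f : {nnsfun V >-> R}) :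
  measurable_fun setT Y -> measurable_fun setT Z -> (forall w, 0 <= Z w) -> 0 <= C ->
  (forall B, measurable B ->
     \int[P]_w (\1_B (Y w) * Z w)%:E = P (Y @^-1` B) * C%:E)%E ->
  (\int[P]_w (f (Y w) * Z w)%:E = (\int[P]_w (f (Y w))%:E) * C%:E)%E.
Proof.
move=> mY mZ Z0 C0 HB.
have mYB (B : set V) : measurable B -> measurable (Y @^-1` B).
  by move=> mB; rewrite -[X in measurable X]setTI; exact: mY.
have mind (B : set V) : measurable B -> measurable_fun setT (fun w => \1_B (Y w) : R).
  move=> mB; rewrite (_ : (fun w => _) = \1_(Y @^-1` B)); first exact: measurable_indic (mYB _ mB).
  by apply/funext => w; rewrite !indicE.
have fE v : f v = \sum_(k \in range f) k * \1_(f @^-1` [set k]) v by rewrite fimfunE.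
have k0 k : range f k -> 0 <= k by move=> [v _ <-].
transitivity (\sum_(k \in range f) \int[P]_w (k * (\1_(f @^-1` [set k]) (Y w) * Z w))%:E)%E.
  rewrite -ge0_integral_fsum //.
  - apply: eq_integral => w _; rewrite fsumEFin // fE.
    rewrite fsbig_finite //= mulr_suml fsbig_finite //=; congr EFin.
    by apply: eq_bigr => k _; rewrite mulrA.
  - move=> k; apply/measurable_EFinP; apply: measurable_funM => //.
    by apply: measurable_funM => //; exact: mind.
  - move=> k w _; rewrite lee_fin.
    have [fk|nfk] := pselect (range f k).
      by rewrite mulr_ge0 ?(k0 k) // mulr_ge0 // indicE ler0n.
    rewrite indicE memNset ?mul0r ?mulr0 // => fYk; apply: nfk.
    by exists (Y w).
transitivity (\sum_(k \in range f) ((k%:E * P (Y @^-1` (f @^-1` [set k]))) * C%:E))%E.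
  apply: eq_fsbigr => k /set_mem fk.
  under eq_integral do rewrite EFinM.
  rewrite ge0_integralZl_EFin ?k0 //.
  - by rewrite HB // muleA.
  - by move=> w _; rewrite lee_fin mulr_ge0 // indicE ler0n.
  - by apply/measurable_EFinP; apply: measurable_funM => //; exact: mind.
rewrite -ge0_mule_fsuml; last first.
  move=> k; have [fk|nfk] := pselect (range f k).
    by rewrite mule_ge0 ?lee_fin ?(k0 k).
  rewrite (_ : Y @^-1` _ = set0) ?measure0 ?mule0 //.
  by apply/seteqP; split => // w /= fYk; apply: nfk; exists (Y w).
congr (_ * _)%E.
transitivity (\sum_(k \in range f) \int[P]_w (k * (\1_(f @^-1` [set k]) (Y w)))%:E)%E.
  apply: eq_fsbigr => k /set_mem fk.
  under eq_integral do rewrite EFinM.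
  rewrite ge0_integralZl_EFin ?k0 //.
  - rewrite (_ : (fun w => _) = EFin \o \1_(Y @^-1` (f @^-1` [set k]))).
      by rewrite integral_indic ?setIT //; exact: mYB.
    by apply/funext => w /=; rewrite !indicE.
  - by apply/measurable_EFinP; exact: mind.
rewrite -ge0_integral_fsum //.
- by apply: eq_integral => w _; rewrite fsumEFin // -fE.
- move=> k; apply/measurable_EFinP; apply: measurable_funM => //.
  exact: mind.
- move=> k w _; rewrite lee_fin.
  have [fk|nfk] := pselect (range f k).
    by rewrite mulr_ge0 ?(k0 k) // indicE ler0n.
  rewrite indicE memNset ?mul0r ?mulr0 // => fYk; apply: nfk.
  by exists (Y w).
Qed.

Lemma integral_factor (Y : T -> V) (Z : T -> R) (C : R) (f : V -> R) :
  measurable_fun setT Y -> measurable_fun setT Z -> (forall w, 0 <= Z w) -> 0 <= C ->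
  measurable_fun setT f -> (forall v, 0 <= f v) ->
  (forall B, measurable B ->
     \int[P]_w (\1_B (Y w) * Z w)%:E = P (Y @^-1` B) * C%:E)%E ->
  (\int[P]_w (f (Y w) * Z w)%:E = (\int[P]_w (f (Y w))%:E) * C%:E)%E.
Proof.
move=> mY mZ Z0 C0 mf f0 HB.
have mf' : measurable_fun setT (EFin \o f) by exact/measurable_EFinP.
pose g := nnsfun_approx measurableT mf'.
have mg n : measurable_fun setT (fun w => g n (Y w)) by exact: measurableT_comp.
have cg w : (fun n => (g n (Y w))%:E) @ \oo --> (f (Y w))%:E.
  have := @cvg_nnsfun_approx _ _ _ _ measurableT _ mf' _ (Y w) I.
  by apply => v _; rewrite lee_fin.
have ndg w : nondecreasing_seq (fun n => (g n (Y w))%:E).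
  by move=> m n mn; rewrite lee_fin; exact/lefP/nd_nnsfun_approx.
have H1 : (fun n => \int[P]_w (g n (Y w) * Z w)%:E)%E @ \oo --> (\int[P]_w (f (Y w) * Z w)%:E)%E.
  rewrite (_ : (\int[P]_w (f (Y w) * Z w)%:E)%E
    = (\int[P]_w limn (fun n => (g n (Y w) * Z w)%:E))%E); last first.
    apply: eq_integral => w _; apply/esym/cvg_lim => //.
    rewrite EFinM; under eq_fun do rewrite EFinM.
    by apply: cvgeZr => //; exact: cg.
  apply: cvg_monotone_convergence => //.
  - by move=> n; apply/measurable_EFinP; exact: measurable_funM.
  - by move=> n w _; rewrite lee_fin mulr_ge0.
  - by move=> w _ m n mn; rewrite lee_fin ler_wpM2r // -lee_fin; exact: ndg.
have H2 : (fun n => \int[P]_w (g n (Y w))%:E)%E @ \oo --> (\int[P]_w (f (Y w))%:E)%E.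
  rewrite (_ : (\int[P]_w (f (Y w))%:E)%E
    = (\int[P]_w limn (fun n => (g n (Y w))%:E))%E); last first.
    by apply: eq_integral => w _; apply/esym/cvg_lim.
  apply: cvg_monotone_convergence => //.
  - by move=> n; apply/measurable_EFinP.
  - by move=> n w _; rewrite lee_fin.
have H3 : (fun n => \int[P]_w (g n (Y w) * Z w)%:E)%E @ \oo --> ((\int[P]_w (f (Y w))%:E) * C%:E)%E.
  under eq_fun do rewrite (integral_factor_nnsfun (g _) mY mZ Z0 C0 HB).
  by apply: cvgeZr.
exact: cvg_unique H1 H3.
Qed.

End Factorization.

Section Independence.
Context {d : measure_display} {T : measurableType d} {R : realType}.
Context {d' : measure_display} {V : measurableType d'}.
Variables (P : probability T R) (I : choiceType) (X : I -> T -> V).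
Hypotheses (mX : forall i, measurable_fun setT (X i))
  (indX : mutually_independent P X).

Lemma integral_prod_independent (f : V -> R) (c : I -> R) (s : seq I) :
  measurable_fun setT f -> (forall v, 0 <= f v) ->
  (forall i, \int[P]_w (f (X i w))%:E = (c i)%:E)%E -> uniq s ->
  (\int[P]_w (\prod_(i <- s) f (X i w))%:E = (\prod_(i <- s) c i)%:E)%E.
Proof.
move=> mf f0 fc us.
have mXB i (B : set V) : measurable B -> measurable (X i @^-1` B).
  by move=> mB; rewrite -[X in measurable X]setTI; exact: mX.
pose p (B : I -> set V) i := fine (P (X i @^-1` B i)).
have pE (B : I -> set V) i : measurable (B i) -> P (X i @^-1` B i) = (p B i)%:E.
  by move=> mB; rewrite /p fineK // fin_num_measure //; exact: mXB.
have mind i (B : set V) : measurable B -> measurable_fun setT (fun w => \1_B (X i w) : R).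
  move=> mB; rewrite (_ : (fun w => _) = \1_(X i @^-1` B)).
    exact: measurable_indic (mXB _ _ mB).
  by apply/funext => w; rewrite !indicE.
have c0 i : 0 <= c i.
  by rewrite -lee_fin -fc; apply: integral_ge0 => w _; rewrite lee_fin.
(* Independence is given for events, so the induction needs a mixed statement with [f] on [s1] and
   indicators on [s2]; [integral_factor] trades one indicator for [f] at a time. *)
suff main s1 : forall (B : I -> set V) s2, uniq (s1 ++ s2) -> (forall i, measurable (B i)) ->
    (\int[P]_w ((\prod_(i <- s1) f (X i w)) * \prod_(i <- s2) \1_(B i) (X i w))%:E
     = ((\prod_(i <- s1) c i) * \prod_(i <- s2) p B i)%:E)%E.
  have := main s (fun=> setT) [::]; rewrite cats0 big_nil => /(_ us (fun=> measurableT)).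
  rewrite mulr1 => <-; apply: eq_integral => w _.
  by rewrite big_nil mulr1.
elim: s1 => [|i s1 IH] B s2 us2 mB.
  rewrite big_nil mul1r.
  have := indX us2 mB; rewrite (eq_bigr (EFin \o p B)) => [|i _]; last exact: pE.
  rewrite prodEFin => <-; rewrite -[in RHS](setIT (\bigcap_(i in _) _)).
  rewrite -integral_indic //; last first.
    by apply: fin_bigcap_measurable; [exact: finite_seq|move=> i _; exact: mXB].
  apply: eq_integral => w _; rewrite big_nil mul1r indicE; congr EFin.
  elim: (s2) => [|i s3 IH]; first by rewrite big_nil mem_set.
  rewrite big_cons IH indicE -natrM mulnb; congr (_%:R : R); congr nat_of_bool.
  apply/andP/idP => [[/set_mem Bi /set_mem H]|/set_mem H]; [apply/mem_set|split; apply/mem_set].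
  - by move=> j /=; rewrite inE => /predU1P[->//|]; exact: H.
  - by apply: H => /=; rewrite inE eqxx.
  - by move=> j js; apply: H => /=; rewrite inE js orbT.
have [is2 us12] : i \notin s1 ++ s2 /\ uniq (s1 ++ s2) by move: us2 => /= /andP[].
pose Z w := (\prod_(j <- s1) f (X j w)) * \prod_(j <- s2) (\1_(B j) (X j w) : R).
have mZ : measurable_fun setT Z.
  apply: measurable_funM; apply: measurable_prod => j _.
    exact: measurableT_comp.
  exact: mind.
have Z0 w : 0 <= Z w.
  by rewrite mulr_ge0 ?prodr_ge0 // => j _; rewrite indicE ler0n.
pose C := (\prod_(j <- s1) c j) * \prod_(j <- s2) p B j.
have C0 : 0 <= C.
  by rewrite mulr_ge0 ?prodr_ge0 // => j _; rewrite /p fine_ge0.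
transitivity (\int[P]_w (f (X i w) * Z w)%:E)%E.
  by apply: eq_integral => w _; rewrite big_cons /Z !mulrA.
rewrite (@integral_factor _ _ _ _ _ _ _ _ C) //; last first.
  move=> B0 mB0; pose B' j := if j == i then B0 else B j.
  have mB' j : measurable (B' j) by rewrite /B'; case: ifP.
  have B'E j : j \in s1 ++ s2 -> B' j = B j.
    by rewrite /B'; case: eqP => // ->; rewrite (negbTE is2).
  have us' : uniq (s1 ++ i :: s2) by rewrite -cat1s uniq_catCA.
  rewrite -[Y in P (_ @^-1` Y)](_ : B' i = B0); last by rewrite /B' eqxx.
  rewrite pE // -EFinM.
  transitivity (\int[P]_w ((\prod_(j <- s1) f (X j w)) * \prod_(j <- i :: s2) \1_(B' j) (X j w))%:E)%E.
    apply: eq_integral => w _; congr EFin.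
    rewrite big_cons /Z {1}/B' eqxx mulrCA; congr (_ * (_ * _)).
    by apply: eq_big_seq => j js; rewrite B'E // mem_cat js orbT.
  rewrite IH // big_cons mulrCA; congr (_ * (_ * _))%:E.
  by apply: eq_big_seq => j js; rewrite /p B'E // mem_cat js orbT.
by rewrite fc -EFinM big_cons mulrA.
Qed.

Lemma chernoff_sum (psi : V -> R) (k a : R) (s : seq I) :
  measurable_fun setT psi -> uniq s ->
  (forall i, \int[P]_w (expR (psi (X i w)))%:E <= (expR k)%:E)%E ->
  (P [set w | (a <= \sum_(i <- s) psi (X i w))%R] <= (expR ((size s)%:R * k - a))%:E)%E.
Proof.
move=> mpsi us hk.
pose c i := fine (\int[P]_w (expR (psi (X i w)))%:E)%E.
have I0 i : (0 <= \int[P]_w (expR (psi (X i w)))%:E)%E.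
  by apply: integral_ge0 => w _; rewrite lee_fin expR_ge0.
have cE i : (\int[P]_w (expR (psi (X i w)))%:E = (c i)%:E)%E.
  by rewrite /c fineK // ge0_fin_numE // (le_lt_trans (hk i)) // ltry.
have mpX i : measurable_fun setT (fun w => psi (X i w)) by exact: measurableT_comp.
have mS : measurable_fun setT (fun w => \sum_(i <- s) psi (X i w)) by exact: measurable_sum.
have mE : measurable [set w | a <= \sum_(i <- s) psi (X i w)].
  rewrite (_ : [set _ | _] = (fun w => \sum_(i <- s) psi (X i w)) @^-1` `[a, +oo[).
    by rewrite -[X in measurable X]setTI; exact: mS.
  by apply/seteqP; split => w /=; rewrite in_itv /= andbT.
rewrite -[leLHS]mul1e -integral_cst //.
apply: (@le_trans _ _ (\int[P]_(w in [set w | (a <= \sum_(i <- s) psi (X i w))%R])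
   (expR (- a) * \prod_(i <- s) expR (psi (X i w)))%:E)%E).
  apply: ge0_le_integral => //.
  - apply/measurable_EFinP; apply: measurable_funM => //.
    apply: measurable_funTS; apply: measurable_prod => i _.
    by apply: measurableT_comp.
  - move=> w /= aw; rewrite lee_fin -expR_sum -expRD -expR0 ler_expR; lra.
apply: (@le_trans _ _ (\int[P]_w
   (expR (- a) * \prod_(i <- s) expR (psi (X i w)))%:E)%E).
  apply: ge0_subset_integral => //.
  - apply/measurable_EFinP; apply: measurable_funM => //.
    by apply: measurable_prod => i _; apply: measurableT_comp.
  - by move=> w _; rewrite lee_fin mulr_ge0 ?expR_ge0 // prodr_ge0 // => i _; exact: expR_ge0.
under eq_integral do rewrite EFinM.
rewrite ge0_integralZl_EFin ?expR_ge0 //; last 2 first.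
- by move=> w _; rewrite lee_fin prodr_ge0 // => i _; exact: expR_ge0.
- by apply/measurable_EFinP; apply: measurable_prod => i _; apply: measurableT_comp.
rewrite (@integral_prod_independent (expR \o psi) c) //; last 2 first.
- by apply: measurableT_comp.
- by move=> v /=; exact: expR_ge0.
rewrite -EFinM lee_fin addrC expRD ler_wpM2l ?expR_ge0 //.
rewrite expRM_natl.
elim: {us mS mE} s => [|i s IH]; first by rewrite big_nil.
rewrite big_cons /= exprS ler_pM //.
- by rewrite /c fine_ge0.
- by rewrite prodr_ge0 // => j _; rewrite /c fine_ge0.
- by rewrite -lee_fin -cE.
Qed.

End Independence.

Lemma expRN_le_quad (R : realType) (x : R) : 0 <= x -> expR (- x) <= 1 - x + x ^+ 2.
Proof.
move=> x0; rewrite expRN.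
have y0 : 0 < 1 + x by lra.
apply: (@le_trans _ _ ((1 + x)^-1)); first by rewrite lef_pV2 ?posrE ?expR_gt0 ?expR_ge1Dx.
rewrite -[leLHS]mul1r ler_pdivrMr //.
have : 0 <= x ^+ 3 by rewrite exprn_ge0.
by lra.
Qed.

Lemma expR_le_lin (R : realType) (x b : R) : 0 <= x -> x <= b -> b <= 2^-1 ->
  expR x <= 1 + x * (1 + 2 * b).
Proof.
move=> x0 xb b1.
have y0 : 0 < 1 - x by lra.
apply: (@le_trans _ _ ((1 - x)^-1)).
  rewrite -[x in leLHS]opprK expRN lef_pV2 ?posrE ?expR_gt0 //.
  exact: expR_ge1Dx.
rewrite -[leLHS]mul1r ler_pdivrMr //.
have : 0 <= x * (b - x) by rewrite mulr_ge0 // subr_ge0.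
have : 0 <= x * b * (1 - 2 * x) by rewrite !mulr_ge0 //; lra.
by lra.
Qed.

Section LawOfLargeNumbers.
Context {d : measure_display} {T : measurableType d} {R : realType}.
Context {d' : measure_display} {V : measurableType d'}.
Variables (P : probability T R) (X : int -> T -> V).
Hypotheses (mX : forall i, measurable_fun setT (X i))
  (indX : mutually_independent P X).
Variable psi : V -> R.
Hypotheses (mpsi : measurable_fun setT psi) (psi0 : forall v, 0 <= psi v).

Let integral1 : (\int[P]_w 1 = 1)%E.
Proof. by rewrite (integral_cst P measurableT 1%E) mul1e; exact: probability_setT. Qed.

Let chernoff_nat (phi : V -> R) (k a : R) (n : nat) :
  measurable_fun setT phi ->
  (forall i, \int[P]_w (expR (phi (X i w)))%:E <= (expR k)%:E)%E ->
  (P [set w | (a <= \sum_(i < n) phi (X i%:Z w))%R] <= (expR (n%:R * k - a))%:E)%E.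
Proof.
move=> mphi hk.
have us : uniq [seq Posz i | i <- iota 0 n].
  by rewrite map_inj_uniq ?iota_uniq // => ? ? [].
have := chernoff_sum mX indX a mphi us hk.
rewrite size_map size_iota; congr (P _ <= _)%E; apply/funext => w /=.
by rewrite big_map -[n in iota 0 n]subn0 -/(index_iota 0 n) big_mkord.
Qed.

(** As [psi] lies between 0 and [M], its exponential moment at [delta / M] is controlled by the mean
    alone. No variance enters, so [M] may grow like the inverse of [tau], as it does for the gaps
    behind a slow leader. *)
Lemma upper_deviation (M mu eps delta a : R) n : 0 < M -> 0 <= mu ->
  (forall v, psi v <= M) ->
  (forall i, \int[P]_w (psi (X i w))%:E <= mu%:E)%E ->
  0 < delta <= 2^-1 -> 2 * delta * mu <= eps ->
  (P [set w | (n%:R * (mu + eps) + a <= \sum_(i < n) psi (X i%:Z w))%R]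
   <= (expR (- (delta / M * a)))%:E)%E.
Proof.
move=> M0 mu0 psiM Epsi /andP[delta0 delta1] dmu.
pose s := delta / M; have s0 : 0 < s by rewrite divr_gt0.
have -> : [set w | n%:R * (mu + eps) + a <= \sum_(i < n) psi (X i%:Z w)]
    = [set w | s * (n%:R * (mu + eps) + a) <= \sum_(i < n) s * psi (X i%:Z w)].
  by apply/seteqP; split => w /=; rewrite -mulr_sumr ler_pM2l.
apply: le_trans (@chernoff_nat (fun v => s * psi v) (s * (1 + 2 * delta) * mu) _ n _ _) _.
- exact: measurable_funM.
- move=> i; apply: (@le_trans _ _ (\int[P]_w (1 + s * (1 + 2 * delta) * psi (X i w))%:E)%E).
    apply: ge0_le_integral => //.
    + by apply/measurable_EFinP; apply: measurableT_comp => //; apply: measurable_funM => //; exact: measurableT_comp.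
    + apply/measurable_EFinP; apply: measurable_funD => //; apply: measurable_funM => //; exact: measurableT_comp.
    + move=> w _; rewrite lee_fin (le_trans (@expR_le_lin _ _ delta _ _ _)) //.
      * by rewrite mulr_ge0 // ltW.
      * by rewrite /s mulrAC ler_pdivrMr // ler_wpM2l // ltW.
      * by rewrite lerD2l mulrAC.
  under eq_integral do rewrite EFinD EFinM.
  have mf : measurable_fun setT (fun w => (psi (X i w))%:E).
    by apply/measurable_EFinP; exact: measurableT_comp.
  have sd0 : 0 <= s * (1 + 2 * delta) by rewrite mulr_ge0 ?ltW // addr_gt0 // mulr_gt0.
  rewrite ge0_integralD //; last 2 first.
  + by move=> w _; rewrite mule_ge0 // lee_fin.
  + by apply: emeasurable_funM.
  rewrite integral1 ge0_integralZl_EFin //; last by move=> w _; rewrite lee_fin.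
  apply: (@le_trans _ _ (1 + s * (1 + 2 * delta) * mu)%:E).
    by rewrite EFinD leeD2l // (EFinM _ mu) lee_wpmul2l // lee_fin.
  by rewrite lee_fin expR_ge1Dx.
rewrite lee_fin ler_expR.
have : 0 <= n%:R * s * (eps - 2 * delta * mu).
  by rewrite mulr_ge0 ?subr_ge0 // mulr_ge0 // ltW.
rewrite -/s; lra.
Qed.

(** A nonnegative variable has an exponential lower tail as soon as its second moment is finite,
    because [expR (- x) <= 1 - x + x ^+ 2]; this is how the finite variance of the initial gaps
    suffices for their lower deviations. *)
Lemma lower_deviation (W mu eps s a : R) n :
  (forall i, mu%:E <= \int[P]_w (psi (X i w))%:E)%E ->
  (forall i, \int[P]_w (psi (X i w) ^+ 2)%:E <= W%:E)%E ->
  0 < s -> s * W <= eps ->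
  (P [set w | (\sum_(i < n) psi (X i%:Z w) <= n%:R * (mu - eps) - a)%R]
   <= (expR (- (s * a)))%:E)%E.
Proof.
move=> Epsi Epsi2 s0 sW.
have -> : [set w | \sum_(i < n) psi (X i%:Z w) <= n%:R * (mu - eps) - a]
    = [set w | - s * (n%:R * (mu - eps) - a) <= \sum_(i < n) - s * psi (X i%:Z w)].
  by apply/seteqP; split => w /=; rewrite -mulr_sumr !mulNr lerN2 ler_pM2l.
apply: le_trans (@chernoff_nat (fun v => - s * psi v) (s ^+ 2 * W - s * mu) _ n _ _) _.
- exact: measurable_funM.
- move=> i.
  have mp : measurable_fun setT (fun w => psi (X i w)) by exact: measurableT_comp.
  have mf : measurable_fun setT (fun w => (psi (X i w))%:E) by exact/measurable_EFinP.
  have mf2 : measurable_fun setT (fun w => (psi (X i w) ^+ 2)%:E).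
    by apply/measurable_EFinP; exact: measurable_funX.
  have f0 w : setT w -> (0 <= (psi (X i w))%:E)%E by rewrite lee_fin.
  have f20 w : setT w -> (0 <= (psi (X i w) ^+ 2)%:E)%E by rewrite lee_fin sqr_ge0.
  have mE : measurable_fun setT (fun w => (expR (- s * psi (X i w)))%:E).
    by apply/measurable_EFinP; apply: measurableT_comp => //; apply: measurable_funM.
  have E0 : (0 <= \int[P]_w (expR (- s * psi (X i w)))%:E)%E.
    by apply: integral_ge0 => w _; rewrite lee_fin expR_ge0.
  (* The term [s * mu] is added on the left instead of being subtracted on the right, so that only
     sums of nonnegative integrals occur. *)
  have H : (\int[P]_w (expR (- s * psi (X i w)))%:E + (s * mu)%:E <= (1 + s ^+ 2 * W)%:E)%E.
    apply: (@le_trans _ _ (\int[P]_w (expR (- s * psi (X i w)))%:E + \int[P]_w (s%:E * (psi (X i w))%:E))%E).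
      rewrite leeD2l // ge0_integralZl_EFin ?(ltW s0) //.
      by rewrite EFinM lee_wpmul2l // lee_fin ltW.
    rewrite -ge0_integralD //; last 2 first.
    + by move=> w _; rewrite mule_ge0 // lee_fin // ltW.
    + by apply: emeasurable_funM.
    apply: (@le_trans _ _ (\int[P]_w (1 + (s ^+ 2)%:E * (psi (X i w) ^+ 2)%:E))%E).
      apply: ge0_le_integral => //.
      * by move=> w _; rewrite adde_ge0 ?mule_ge0 ?lee_fin ?expR_ge0 // ltW.
      * by apply: emeasurable_funD => //; exact: emeasurable_funM.
      * by apply: emeasurable_funD => //; exact: emeasurable_funM.
      * move=> w _; rewrite -!EFinM -!EFinD lee_fin.
        have := expRN_le_quad (mulr_ge0 (ltW s0) (psi0 (X i w))).
        by rewrite mulNr exprMn; lra.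
    rewrite ge0_integralD //; last 2 first.
    * by move=> w _; rewrite mule_ge0 // lee_fin ?sqr_ge0.
    * by apply: emeasurable_funM.
    rewrite integral1 ge0_integralZl_EFin ?sqr_ge0 //.
    by rewrite EFinD leeD2l // (EFinM _ W) lee_wpmul2l // lee_fin sqr_ge0.
  have fE : (\int[P]_w (expR (- s * psi (X i w)))%:E)%E \is a fin_num.
    rewrite ge0_fin_numE //; apply: (@le_lt_trans _ _ (\int[P]_w 1)%E); last first.
      by rewrite integral1 ltry.
    apply: ge0_le_integral => // w _; rewrite lee_fin ?expR_ge0 // -expR0 ler_expR.
    by rewrite mulNr oppr_le0 mulr_ge0 // ltW.
  move: H; rewrite -(fineK fE) -EFinD !lee_fin => H.
  by apply: le_trans (expR_ge1Dx _); lra.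
rewrite lee_fin ler_expR.
have : 0 <= n%:R * s * (eps - s * W).
  by rewrite mulr_ge0 ?subr_ge0 // mulr_ge0 // ltW.
lra.
Qed.

End LawOfLargeNumbers.

(** * Moments of the rates and of the initial gaps *)

Section RateDistribution.
Context {d : measure_display} {T : measurableType d} {R : realType}.
Variables (P : probability T R) (c : R) (F : cumulativeBounded (0 : R) (1 : R))
  (X : {RV P >-> R}).
Hypothesis cdfX : forall p, cdf X p = (F p)%:E.

Let mu := lebesgue_stieltjes_measure F.

Lemma prob_rate_le p : P [set w | X w <= p] = (F p)%:E.
Proof. by rewrite -cdfX /cdf /distribution /pushforward; congr (P _); apply/seteqP; split => w /=; rewrite in_itv. Qed.

Let measurable_stieltjes : @measurable_fun _ _ T (measurableTypeR R) setT X.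
Proof.
move=> mT B mB; rewrite setTI; have := @measurable_funPTI _ _ _ _ X B.
by apply; exact: mB.
Qed.

(* The rate as a random variable for the copy of the Borel sigma-algebra on
   which Lebesgue-Stieltjes measures are defined. *)
Let Y : {mfun T >-> measurableTypeR R} :=
  HB.pack (X : T -> measurableTypeR R)
    (isMeasurableFun.Build _ _ _ _ (X : T -> measurableTypeR R) measurable_stieltjes).

(** Both measures give [F b - F a] to the half-open intervals, which determines them. *)
Lemma rate_distributionE (A : set (measurableTypeR R)) : measurable A ->
  mu A = distribution P Y A.
Proof.
move=> mA.
have := (fun H => @lebesgue_stieltjes_measure_unique R F (distribution P Y) H A mA).
apply => I [[a b]]/= _ <-.
rewrite /lebesgue_stieltjes_measure /measure_extension/=.
rewrite measurable_mu_extE/=; last exact: is_ocitv.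
have [ab | ba] := leP a b; last first.
  by rewrite set_itv_ge ?wlength0 ?measure0// bnd_simp -leNgt ltW.
rewrite wlength_itv_bnd// EFinB -!cdfX /cdf.
have : `]a, b]%classic = `]-oo, b] `\` `]-oo, a] => [|->].
  by rewrite -[RHS]setCK setCD setCitvl setUC -[LHS]setCK setCitv.
rewrite [RHS]measureD ?setIidr//; first exact: subset_itvl.
by rewrite -ge0_fin_numE// fin_num_measure.
Qed.

Lemma integral_rate (g : R -> R) : measurable_fun setT g -> (forall p, 0 <= g p) ->
  (\int[P]_w (g (X w))%:E = \int[mu]_p (g p)%:E)%E.
Proof.
move=> mg g0.
rewrite -(@ge0_integral_distribution _ _ _ _ _ P Y (EFin \o g)) //.
- by apply: eq_measure_integral => A mA _; apply/esym; exact: rate_distributionE.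
- exact/measurable_EFinP.
Qed.

Hypotheses (Fc : F c = 0) (F1 : F 1 = 1).

Lemma rate_in_support : {ae P, forall w, c < X w <= 1}.
Proof.
have H0 : P.-negligible [set w | X w <= c].
  apply/negligibleP; last by apply: etrans (prob_rate_le c) _; rewrite Fc.
  rewrite (_ : [set _ | _] = X @^-1` `]-oo, c]).
    by rewrite -[Y in measurable Y]setTI; exact: measurable_funP.
  by apply/seteqP; split => w /=; rewrite in_itv.
have m1 : measurable [set w | X w <= 1].
  rewrite (_ : [set _ | _] = X @^-1` `]-oo, 1]).
    by rewrite -[Y in measurable Y]setTI; exact: measurable_funP.
  by apply/seteqP; split => w /=; rewrite in_itv.
have H1 : P.-negligible (~` [set w | X w <= 1]).
  apply/negligibleP; first exact: measurableC.
  by apply: etrans (probability_setC P m1) _; rewrite prob_rate_le F1 subee.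
apply: negligibleS (negligibleU H0 H1) => w /= nw.
have [?|?] := leP (X w) c; [by left|right => Xw; apply: nw].
by apply/andP.
Qed.

End RateDistribution.

Section CriticalGap.
Variables (R : realType) (c : R) (F : cumulativeBounded (0 : R) (1 : R)).
Hypotheses (c0 : 0 < c) (c1 : c < 1).

Let mu := lebesgue_stieltjes_measure F.

Definition mean_gap (p : R) : R := if c < p <= 1 then c / (p - c) else 0.

Lemma mean_gap_ge0 p : 0 <= mean_gap p.
Proof. by rewrite /mean_gap; case: ifP => // /andP[cp _]; rewrite divr_ge0 ?subr_ge0 ?(ltW c0) ?(ltW cp). Qed.

Lemma measurable_inv_shift (k l : R) (g : R -> R) :
  measurable_fun setT g -> (forall p, l < g p) ->
  measurable_fun setT (fun p => k / (g p - l)).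
Proof.
move=> mg lg.
have -> : (fun p => k / (g p - l)) = (fun p => k * (g p - l) `^ (-1)).
  by apply/funext => p; rewrite powR_inv1 // subr_ge0 ltW.
apply: measurable_funM => //; apply: (measurableT_comp (@measurable_powR R (-1))).
exact: measurable_funB.
Qed.

Lemma measurable_window (k l a b : R) : l <= a ->
  measurable_fun setT (fun p => if a < p <= b then k / (p - l) else 0).
Proof.
move=> la.
have -> : (fun p => if a < p <= b then k / (p - l) else 0)
    = (fun p => if (a < p) && (p <= b) then k * (p - l) `^ (-1) else 0).
  apply/funext => p; case: ifP => // /andP[ap _].
  by rewrite powR_inv1 // subr_ge0 (le_trans la) // ltW.
apply: measurable_fun_ifT => //.
  by apply: measurable_and; [exact: measurable_fun_ltr|exact: measurable_fun_ler].
apply: measurable_funM => //; apply: (measurableT_comp (@measurable_powR R (-1))).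
exact: measurable_funB.
Qed.

Lemma measurable_mean_gap : measurable_fun setT mean_gap.
Proof. exact: measurable_window. Qed.

Lemma integral_mean_gap : (\int[mu]_p (mean_gap p)%:E = critical_gap c F)%E.
Proof.
rewrite /critical_gap [RHS]integral_mkcond; apply: eq_integral => p _.
by rewrite patchE mem_setE in_itv /= /mean_gap; case: ifP.
Qed.

Lemma critical_gap_ge0 : (0 <= critical_gap c F)%E.
Proof. by rewrite -integral_mean_gap; apply: integral_ge0 => p _; rewrite lee_fin mean_gap_ge0. Qed.

Hypothesis ufin : (critical_gap c F < +oo)%E.

Let ustar := fine (critical_gap c F).

Lemma critical_gapE : critical_gap c F = ustar%:E.
Proof. by rewrite /ustar fineK // ge0_fin_numE // critical_gap_ge0. Qed.

Definition mean_gap_above (b p : R) : R := if b < p <= 1 then c / (p - c) else 0.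
Definition mean_gap_below (b p : R) : R := if c < p <= b then c / (p - c) else 0.

Lemma measurable_mean_gap_above b : c <= b -> measurable_fun setT (mean_gap_above b).
Proof. exact: measurable_window. Qed.

Lemma measurable_mean_gap_below b : measurable_fun setT (mean_gap_below b).
Proof. exact: measurable_window. Qed.

Lemma mean_gap_above_ge0 b p : c <= b -> 0 <= mean_gap_above b p.
Proof.
move=> cb; rewrite /mean_gap_above; case: ifP => // /andP[bp _].
by rewrite divr_ge0 ?subr_ge0 ?(ltW c0) // (le_trans cb) // ltW.
Qed.

Lemma mean_gap_below_ge0 b p : 0 <= mean_gap_below b p.
Proof.
rewrite /mean_gap_below; case: ifP => // /andP[bp _].
by rewrite divr_ge0 ?subr_ge0 ?(ltW c0) // ltW.
Qed.

Lemma mean_gap_split b p : c <= b -> b <= 1 ->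
  mean_gap p = mean_gap_below b p + mean_gap_above b p.
Proof.
move=> cb b1; rewrite /mean_gap /mean_gap_below /mean_gap_above.
have [pb|bp] := leP p b.
  by rewrite (le_trans pb b1) addr0.
by rewrite (le_lt_trans cb bp) andbF add0r.
Qed.

(** The rates close to c, where [c / (p - c)] blows up, are cut off at a level [b] found by monotone
    convergence, so that they carry at most [eps] of the mean. *)
Lemma mean_gap_truncation (eps : R) : 0 < eps -> exists b, [/\ c < b < 1,
  (\int[mu]_p (mean_gap_below b p)%:E <= eps%:E)%E &
  ((ustar - eps)%:E <= \int[mu]_p (mean_gap_above b p)%:E)%E].
Proof.
(* The denominator [n.+2] rather than [n.+1] keeps [b n < 1]. *)
move=> eps0; pose b n : R := c + (1 - c) / n.+2%:R.
have cb n : c < b n by rewrite /b ltrDl divr_gt0 ?subr_gt0.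
have b1 n : b n < 1.
  rewrite /b -ltrBrDl ltr_pdivrMr // ltr_pMr ?subr_gt0 //.
  by rewrite (ltr_nat R 1).
have cvg1 : (fun n => \int[mu]_p (mean_gap_above (b n) p)%:E)%E @ \oo --> ustar%:E.
  rewrite -critical_gapE -integral_mean_gap.
  rewrite (_ : (\int[mu]_p (mean_gap p)%:E)%E
      = (\int[mu]_p limn (fun n => (mean_gap_above (b n) p)%:E))%E); last first.
    apply: eq_integral => p _; apply/esym/cvg_lim => //.
    have [pc|cp] := leP p c.
      rewrite (_ : (fun n => _) = fun=> (mean_gap p)%:E); first exact: cvg_cst.
      apply/funext => n; rewrite /mean_gap /mean_gap_above.
      by rewrite [c < p]ltNge pc [b n < p]ltNge (le_trans pc (ltW (cb n))).
    apply: cvg_near_cst; near=> n; rewrite /mean_gap /mean_gap_above cp /=.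
    suff -> : b n < p by [].
    rewrite /b -ltrBrDl ltr_pdivrMr // mulrC -ltr_pdivrMr ?subr_gt0 //.
    apply: (@lt_trans _ _ n%:R); last by rewrite ltr_nat.
    near: n; exact: nbhs_infty_gtr.
  apply: cvg_monotone_convergence => //.
  - by move=> n; apply/measurable_EFinP; apply: measurable_mean_gap_above; exact: ltW.
  - by move=> n p _; rewrite lee_fin mean_gap_above_ge0 // ltW.
  - move=> p _ m n mn; rewrite lee_fin /mean_gap_above.
    have bnm : b n <= b m.
      rewrite /b lerD2l ler_wpM2l ?subr_ge0 ?(ltW c1) //.
      by rewrite lef_pV2 ?posrE // ler_nat !ltnS.
    case: ifP => [/andP[bp p1]|_]; first by rewrite (le_lt_trans bnm bp) p1.
    case: ifP => // /andP[bp _].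
    by rewrite divr_ge0 ?subr_ge0 ?(ltW c0) // ltW // (lt_trans (cb n)).
have : \forall n \near \oo, ((ustar - eps)%:E < \int[mu]_p (mean_gap_above (b n) p)%:E)%E.
  have /fine_cvgP[fin1 fcvg] := cvg1.
  near=> n; have finn : (\int[mu]_p (mean_gap_above (b n) p)%:E)%E \is a fin_num by near: n.
  rewrite -(fineK finn) lte_fin; near: n.
  by apply: (cvgr_gt _ fcvg); rewrite ltrBlDr ltrDl.
move=> /filter_ex[n Hn]; exists (b n); split; [by rewrite cb b1| |exact: ltW].
have E : (\int[mu]_p (mean_gap_below (b n) p)%:E + \int[mu]_p (mean_gap_above (b n) p)%:E = ustar%:E)%E.
  rewrite -critical_gapE -integral_mean_gap -ge0_integralD //.
  - by apply: eq_integral => p _; rewrite (mean_gap_split p (ltW (cb n)) (ltW (b1 n))).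
  - by move=> p _; rewrite lee_fin mean_gap_below_ge0.
  - by apply/measurable_EFinP; exact: measurable_mean_gap_below.
  - by move=> p _; rewrite lee_fin mean_gap_above_ge0 // ltW.
  - by apply/measurable_EFinP; apply: measurable_mean_gap_above; exact: ltW.
have I0 : (0 <= \int[mu]_p (mean_gap_below (b n) p)%:E)%E.
  by apply: integral_ge0 => p _; rewrite lee_fin mean_gap_below_ge0.
move: E Hn I0.
set A := (\int[mu]_p (mean_gap_below _ p)%:E)%E; set B := (\int[mu]_p (mean_gap_above _ p)%:E)%E.
case: A => [x| |]; case: B => [y| |] //=.
by rewrite -EFinD => -[<-]; rewrite lte_fin !lee_fin; lra.
Unshelve. all: by end_near. Qed.

End CriticalGap.

Section PlatoonGaps.
Variables (R : realType) (c : R) (F : cumulativeBounded (0 : R) (1 : R)).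
Hypotheses (c0 : 0 < c) (c1 : c < 1).
Hypothesis ufin : (critical_gap c F < +oo)%E.

Let mu := lebesgue_stieltjes_measure F.
Let ustar := fine (critical_gap c F).

(* Mean equilibrium gap in front of a particle of rate p > a behind a leader
   of rate l. *)
Definition window_gap (l a p : R) : R := if a < p <= 1 then l / (p - l) else 0.

Lemma measurable_window_gap l a : l <= a -> measurable_fun setT (window_gap l a).
Proof. exact: measurable_window. Qed.

Lemma window_gap_ge0 l a p : 0 <= l -> l <= a -> 0 <= window_gap l a p.
Proof.
move=> l0 la; rewrite /window_gap; case: ifP => // /andP[ap _].
by rewrite divr_ge0 ?subr_ge0 // (le_trans la) // ltW.
Qed.

Lemma window_gap_le l a p : 0 <= l -> l < a -> window_gap l a p <= l / (a - l).
Proof.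
move=> l0 la; rewrite /window_gap; case: ifP => [/andP[ap _]|_].
  rewrite ler_wpM2l // lef_pV2 ?posrE ?subr_gt0 // ?(lt_trans la) //.
  by rewrite lerD2r ltW.
by rewrite divr_ge0 // subr_ge0 ltW.
Qed.

Lemma ler_div_sub (l l' p : R) : 0 <= l -> l <= l' -> l' < p ->
  l / (p - l) <= l' / (p - l').
Proof.
move=> l0 ll' lp; have p1 : 0 < p - l' by rewrite subr_gt0.
have p2 : 0 < p - l by rewrite subr_gt0 (le_lt_trans ll').
rewrite ler_pdivrMr // mulrAC ler_pdivlMr //.
have : 0 <= p * (l' - l).
  by rewrite mulr_ge0 // ?subr_ge0 // ltW // (le_lt_trans (le_trans l0 ll')).
lra.
Qed.

Lemma integral_low_gap l : 0 <= l < c ->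
  (\int[mu]_p (window_gap l c p)%:E <= ustar%:E)%E.
Proof.
move=> /andP[l0 lc]; rewrite -critical_gapE // -integral_mean_gap.
apply: ge0_le_integral => //.
- by move=> p _; rewrite lee_fin window_gap_ge0 // ltW.
- by apply/measurable_EFinP; apply: measurable_window_gap; exact: ltW.
- by apply/measurable_EFinP; exact: measurable_mean_gap.
- move=> p _; rewrite lee_fin /window_gap /mean_gap; case: ifP => // /andP[cp _].
  by apply: ler_div_sub => //; exact: ltW.
Qed.

(** Rates below [b] are raised to [b], as in [quenched_upper_tail]; this bounds the gap and keeps
    its mean above the contribution of the rates larger than [b]. *)
Definition capped_gap (b p : R) : R := if c < p <= 1 then c / (Num.max p b - c) else 0.

Lemma measurable_capped_gap b : c < b -> measurable_fun setT (capped_gap b).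
Proof.
move=> cb.
have -> : capped_gap b = fun p => if (c < p) && (p <= 1) then c / (Num.max p b - c) else 0.
  by [].
apply: measurable_fun_ifT => //.
  by apply: measurable_and; [exact: measurable_fun_ltr|exact: measurable_fun_ler].
apply: measurable_inv_shift => [|p]; last by rewrite lt_max cb orbT.
exact: measurable_maxr.
Qed.

Lemma capped_gap_ge0 b p : c < b -> 0 <= capped_gap b p.
Proof.
move=> cb; rewrite /capped_gap; case: ifP => // /andP[cp _].
by rewrite divr_ge0 ?(ltW c0) // subr_ge0 le_max (ltW cp).
Qed.

Lemma capped_gap_le b p : c < b -> capped_gap b p <= c / (b - c).
Proof.
move=> cb; rewrite /capped_gap; case: ifP => [/andP[cp _]|_].
  rewrite ler_wpM2l ?(ltW c0) // lef_pV2 ?posrE ?subr_gt0 ?lt_max ?cp //.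
  by rewrite lerD2r le_max lexx orbT.
by rewrite divr_ge0 ?(ltW c0) // subr_ge0 ltW.
Qed.

Lemma integral_capped_gap b : c < b ->
  (\int[mu]_p (mean_gap_above c b p)%:E <= \int[mu]_p (capped_gap b p)%:E)%E.
Proof.
move=> cb; apply: ge0_le_integral => //.
- by move=> p _; rewrite lee_fin mean_gap_above_ge0 // ltW.
- by apply/measurable_EFinP; apply: measurable_mean_gap_above; exact: ltW.
- by apply/measurable_EFinP; exact: measurable_capped_gap.
- move=> p _; rewrite lee_fin /mean_gap_above.
  case: ifP => [/andP[bp p1]|_]; last exact: capped_gap_ge0.
  by rewrite /capped_gap (lt_trans cb bp) p1 max_l // ltW.
Qed.

(** Below a fixed level [b] the window gap is at most [C] times the critical one, and [b] is chosen
    so that this part contributes at most [eps / 2]; above [b] it differs from the critical one by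
    O(tau). *)
Lemma integral_high_gap (x' x eps : R) : 0 < x' -> x' < x -> 0 < eps ->
  exists2 tau0, 0 < tau0 & forall tau, 0 < tau < tau0 ->
    (\int[mu]_p (window_gap (c + x' * tau) (c + x * tau) p)%:E
     <= (ustar + eps)%:E)%E.
Proof.
move=> x'0 x'x eps0; have x0 : 0 < x by rewrite (lt_trans x'0).
(* On the window [p - c > x * tau], hence [p - l >= (p - c) * (x - x') / x], while [l <= 2 * c] for
   small [tau]. *)
have [C C0 CE] : exists2 C, 0 < C & C = 2 * (x / (x - x')).
  by exists (2 * (x / (x - x'))) => //; rewrite mulr_gt0 // divr_gt0 // subr_gt0.
have [b [/andP[cb b1] below above]] : exists b, [/\ c < b < 1,
  (\int[mu]_p (mean_gap_below c b p)%:E <= (eps / (2 * C))%:E)%E &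
  ((ustar - eps / (2 * C))%:E <= \int[mu]_p (mean_gap_above c b p)%:E)%E].
  by apply: mean_gap_truncation => //; rewrite divr_gt0 // mulr_gt0.
have bc : 0 < b - c by rewrite subr_gt0.
(* The excess over the critical gap is [p * (x' * tau) / ((p - l) * (p - c))]; for [b < p <= 1] it
   is at most [K * tau], since [p - l >= (b - c) / 2]. *)
have [K K0 KE] : exists2 K, 0 < K & K = 2 * x' / (b - c) ^+ 2.
  by exists (2 * x' / (b - c) ^+ 2) => //; rewrite divr_gt0 ?mulr_gt0 ?exprn_gt0.
exists (Num.min (c / x') (Num.min ((b - c) / (2 * x')) (eps / (2 * K)))).
  rewrite !lt_min; apply/and3P; split; apply: divr_gt0 => //; exact: mulr_gt0.
move=> tau /andP[tau0]; rewrite !lt_min => /and3P[t1 t2 t3].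
have t1' : x' * tau < c by move: t1; rewrite ltr_pdivlMr // mulrC.
have t2' : 2 * (x' * tau) < b - c.
  by move: t2; rewrite ltr_pdivlMr ?mulr_gt0 // mulrC mulrA.
have t3' : K * tau < eps / 2.
  by move: t3; rewrite ltr_pdivlMr ?mulr_gt0 //; lra.
have xt0 : 0 < x' * tau by rewrite mulr_gt0.
have xtx : x' * tau < x * tau by rewrite ltr_pM2r.
set l := c + x' * tau.
have mb : measurable_fun setT (fun p => (mean_gap_below c b p)%:E).
  by apply/measurable_EFinP; exact: measurable_mean_gap_below.
have ma : measurable_fun setT (fun p => (mean_gap_above c b p)%:E).
  by apply/measurable_EFinP; apply: measurable_mean_gap_above; exact: ltW.
have b0 p : (0 <= (mean_gap_below c b p)%:E)%E by rewrite lee_fin mean_gap_below_ge0.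
have a0 p : (0 <= (mean_gap_above c b p)%:E)%E by rewrite lee_fin mean_gap_above_ge0 // ltW.
apply: (@le_trans _ _ (\int[mu]_p ((C%:E * (mean_gap_below c b p)%:E
   + (mean_gap_above c b p)%:E) + (K * tau)%:E))%E).
  apply: ge0_le_integral => //.
  - by move=> p _; rewrite lee_fin window_gap_ge0 // /l ?lerD2l ?(ltW xtx) // addr_ge0 // ltW.
  - by apply/measurable_EFinP; apply: measurable_window_gap; rewrite lerD2l ltW.
  - by apply: emeasurable_funD => //; apply: emeasurable_funD => //; exact: emeasurable_funM.
  - move=> p _; rewrite -EFinM -!EFinD lee_fin /window_gap.
    have Ktau0 : 0 <= K * tau by rewrite mulr_ge0 // ltW.
    have pb0 := mean_gap_below_ge0 c0 b p; have pa0 := mean_gap_above_ge0 c0 p (ltW cb).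
    case: ifP => [/andP[ap p1]|_]; last by rewrite addr_ge0 // addr_ge0 // mulr_ge0 // ltW.
    have cp : c < p by rewrite (lt_trans _ ap) // ltrDl mulr_gt0.
    have lp : l < p by rewrite (lt_trans _ ap) // ltrD2l.
    have pc : 0 < p - c by rewrite subr_gt0.
    have pl : 0 < p - l by rewrite subr_gt0.
    have [pb|bp] := leP p b.
      rewrite /mean_gap_below cp pb /= (@le_trans _ _ (C * (c / (p - c)))) //; last first.
        by rewrite -addrA lerDl addr_ge0.
      have -> : C * (c / (p - c)) = 2 * c / ((p - c) * (x - x') / x).
        by rewrite CE; field; rewrite subr_eq0 !gt_eqF // subr_gt0.
      apply: ler_pM; rewrite ?invr_ge0 ?(ltW pl) //.
      + by rewrite /l addr_ge0 ?(ltW c0) ?(ltW xt0).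
      + by rewrite /l; lra.
      rewrite lef_pV2 ?posrE // ?divr_gt0 ?mulr_gt0 ?subr_gt0 //.
      rewrite ler_pdivrMr // /l; have : x * tau < p - c by lra.
      by nra.
    rewrite /mean_gap_above bp p1 /= (@le_trans _ _ (c / (p - c) + K * tau)) //; last first.
      by rewrite lerD2r lerDr mulr_ge0 // ltW.
    have -> : l / (p - l) = c / (p - c) + p * (x' * tau) / ((p - l) * (p - c)).
      by rewrite /l; field; rewrite -/l !gt_eqF.
    rewrite lerD2l; have -> : K * tau = 1 * (x' * tau) / ((b - c) / 2 * (b - c)).
      by rewrite KE; field; rewrite gt_eqF.
    apply: ler_pM.
    + by rewrite mulr_ge0 // ltW // (lt_trans c0).
    + by rewrite invr_ge0 mulr_ge0 // ltW.
    + by rewrite ler_wpM2r // ltW.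
    rewrite lef_pV2 ?posrE ?mulr_gt0 ?divr_gt0 //.
    apply: ler_pM; rewrite ?divr_ge0 ?(ltW bc) //; rewrite /l; lra.
have Ktau0 : 0 <= K * tau by rewrite mulr_ge0 // ltW.
rewrite ge0_integralD //; last 2 first.
- by move=> p _; rewrite adde_ge0 // mule_ge0 // lee_fin ltW.
- by apply: emeasurable_funD => //; exact: emeasurable_funM.
rewrite ge0_integralD //; last 2 first.
- by move=> p _; rewrite mule_ge0 // lee_fin ltW.
- exact: emeasurable_funM.
rewrite ge0_integralZl_EFin ?(ltW C0) //.
rewrite [X in (_ + X <= _)%E](_ : _ = (K * tau)%:E); last first.
  apply: etrans (integral_cst mu measurableT _) _.
  by rewrite -[RHS]mule1; congr (_ * _)%E; exact: probability_setT.
have aE : (\int[mu]_p (mean_gap_above c b p)%:E <= ustar%:E)%E.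
  rewrite -critical_gapE // -integral_mean_gap; apply: ge0_le_integral => //.
    by apply/measurable_EFinP; exact: measurable_mean_gap.
  move=> p _; rewrite lee_fin (mean_gap_split p (ltW cb) (ltW b1)) lerDr.
  exact: mean_gap_below_ge0.
apply: (@le_trans _ _ (C%:E * (eps / (2 * C))%:E + ustar%:E + (eps / 2)%:E)%E).
  apply: leeD; last by rewrite lee_fin ltW.
  by apply: leeD => //; rewrite lee_wpmul2l // lee_fin ltW.
rewrite -EFinM -!EFinD lee_fin le_eqVlt; apply/orP; left; apply/eqP.
by field; rewrite gt_eqF.
Qed.

End PlatoonGaps.

Section InitialGaps.
Context {d : measure_display} {T : measurableType d} {R : realType}.
Variables (P : probability T R) (u : R) (eta : int -> T -> int).
Hypotheses (meta : forall i, measurable_fun setT (eta i))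
  (eta_ge0 : {ae P, forall w, forall i, 0 <= eta i w})
  (eta_id : identically_distributed P eta)
  (Eeta : forall i, ('E_P[fun w => (eta i w)%:~R] = u%:E)%E)
  (Veta : forall i, ('V_P[fun w => ((eta i w)%:~R : R)] < +oo)%E).

(** The initial gaps are nonnegative only almost surely; the maximum gives a function that is
    nonnegative everywhere, as the deviation bounds require. *)
Definition size_of_gap (z : int) : R := Num.max z%:~R 0.

Lemma measurable_int_fun (f : int -> R) : measurable_fun setT f.
Proof. by move=> _ B mB. Qed.

Let eta' i : {mfun T >-> int} :=
  HB.pack (eta i) (isMeasurableFun.Build _ _ _ _ (eta i) (meta i)).

Lemma integral_gap_eq (f : int -> R) i j : (forall z, 0 <= f z) ->
  (\int[P]_w (f (eta i w))%:E = \int[P]_w (f (eta j w))%:E)%E.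
Proof.
move=> f0; have mf : measurable_fun setT (EFin \o f).
  by apply/measurable_EFinP; exact: measurable_int_fun.
rewrite -(@ge0_integral_distribution _ _ _ _ _ P (eta' i) (EFin \o f)) //.
rewrite -(@ge0_integral_distribution _ _ _ _ _ P (eta' j) (EFin \o f)) //.
by apply: eq_measure_integral => A mA _; exact: eta_id.
Qed.

Let meta_real i : measurable_fun setT (fun w => (eta i w)%:~R : R).
Proof.
exact: (measurableT_comp (measurable_int_fun (fun z => z%:~R)) (meta i)).
Qed.

Lemma integral_size_of_gap i : (\int[P]_w (size_of_gap (eta i w))%:E = u%:E)%E.
Proof.
rewrite -(Eeta i) unlock; apply: ae_eq_integral => //.
- apply/measurable_EFinP.
  exact: (measurableT_comp (measurable_int_fun size_of_gap) (meta i)).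
- exact/measurable_EFinP.
- by apply: filterS eta_ge0 => w H _; rewrite /size_of_gap max_l // ler0z.
Qed.

Lemma integral_size_of_gap_sqr :
  exists W : R, forall i, (\int[P]_w (size_of_gap (eta i w) ^+ 2)%:E <= W%:E)%E.
Proof.
have fE : fine ('E_P[fun w => ((eta 0 w)%:~R : R)]) = u by rewrite (Eeta 0).
have V0 : (\int[P]_w ((((eta 0 w)%:~R : R) - u) ^+ 2)%:E < +oo)%E.
  have := Veta 0; rewrite /variance covariance.unlock fE expectation.unlock.
  by under eq_integral do rewrite /= -expr2.
have m1 : measurable_fun setT (fun w => ((((eta 0 w)%:~R : R) - u) ^+ 2)%:E).
  apply/measurable_EFinP; apply: measurable_funX; exact: measurable_funB.
have m2 : measurable_fun setT (fun w => (size_of_gap (eta 0 w) ^+ 2)%:E).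
  apply/measurable_EFinP.
  exact: (measurableT_comp (measurable_int_fun (fun z => size_of_gap z ^+ 2)) (meta 0)).
have W0 : (\int[P]_w (size_of_gap (eta 0 w) ^+ 2)%:E < +oo)%E.
  apply: (@le_lt_trans _ _ (\int[P]_w (2%:E * ((((eta 0 w)%:~R : R) - u) ^+ 2)%:E
      + (2 * u ^+ 2)%:E))%E).
    apply: ge0_le_integral => //.
    - by move=> w _; rewrite lee_fin sqr_ge0.
    - by apply: emeasurable_funD => //; exact: emeasurable_funM.
    - move=> w _; rewrite -EFinM -EFinD lee_fin /size_of_gap.
      (* The square of z is at most [2 * (z - u) ^+ 2 + 2 * u ^+ 2], the difference being
         [(z - 2 * u) ^+ 2]. *)
      set z := (eta 0 w)%:~R; have := sqr_ge0 (z - 2 * u).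
      by rewrite /Num.max; case: ifP => _ H; [rewrite expr0n /= addr_ge0 // mulr_ge0 // sqr_ge0|lra].
  rewrite ge0_integralD //; last 3 first.
  - by move=> w _; rewrite mule_ge0 // lee_fin sqr_ge0.
  - exact: emeasurable_funM.
  - by move=> w _; rewrite lee_fin mulr_ge0 ?sqr_ge0.
  rewrite ge0_integralZl_EFin //; last by move=> w _; rewrite lee_fin sqr_ge0.
  rewrite [X in (_ + X < _)%E](_ : _ = (2 * u ^+ 2)%:E); last first.
    apply: etrans (integral_cst P measurableT _) _.
    by rewrite -[RHS]mule1; congr (_ * _)%E; exact: probability_setT.
  by rewrite lte_add_pinfty ?ltry // lte_mul_pinfty // ?lee_fin.
exists (fine (\int[P]_w (size_of_gap (eta 0 w) ^+ 2)%:E)%E) => i.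
rewrite (integral_gap_eq (f := fun z => size_of_gap z ^+ 2) i 0); last by move=> z; exact: sqr_ge0.
rewrite fineK // ge0_fin_numE //.
by apply: integral_ge0 => w _; rewrite lee_fin sqr_ge0.
Qed.

End InitialGaps.

(** * Comparison with finite systems *)

Lemma displacement_ge0 n k (o : seq (option 'I_n)) : 0 <= displacement k o.
Proof.
rewrite /displacement; suff : forall x, (forall j, packed j <= x j) ->
    forall j, packed j <= run k x o j by apply.
by elim: o => [|a o IH] x px //=; apply: IH; exact: step_ge.
Qed.

Section Coupling.
Context {d : measure_display} {T : measurableType d} {R : realType}.
Variables (N : int -> R -> T -> nat) (sigma : int -> R -> T -> int).

Definition total_gap (w : T) (k : nat) : int := \sum_(j < k) initial_gap sigma j%:Z w.

Lemma position_total_gap w k : sigma 0 0 w = 0 -> sigma k%:Z 0 w = k%:Z + total_gap w k.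
Proof.
move=> s0; elim: k => [|k IH]; first by rewrite s0 /total_gap big_ord0.
rewrite /total_gap big_ord_recr /= -/(total_gap w k) /initial_gap IH.
have -> : k.+1%:Z = k%:Z + 1 by lia.
by lia.
Qed.

Section Path.
Variable w : T.
Hypotheses (clockP : forall i, counting_path (fun t => N i t w))
  (xP : exclusion_path (fun i t => N i t w) (fun i t => sigma i t w))
  (sigma0 : sigma 0 0 w = 0).

Lemma total_gap_mono k k' : (k <= k')%N -> total_gap w k <= total_gap w k'.
Proof.
move=> kk'; rewrite -(subnKC kk'); elim: (k' - k)%N => [|j IH]; first by rewrite addn0.
apply: le_trans IH _; rewrite addnS /total_gap [leRHS]big_ord_recr /= lerDl.
rewrite /initial_gap; have /= := exclusion_order xP (k + j)%N%:Z (lexx 0).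
by move: (sigma _ _ _) (sigma _ _ _) => a b; lia.
Qed.

Variables (n : nat) (h : R) (o : seq (option 'I_n.+1)).
Hypotheses (h0 : 0 < h) (ow : rings_as N h o w).

Let follows_sigma : follows n (fun l i => sigma i%:Z (h * l%:R) w) o.
Proof. by apply: (follows_of_paths clockP xP h0); exact: rings_asP ow. Qed.

Lemma position_le_displacement k : (k < n)%N ->
  sigma 0 (h * (size o)%:R) w <= displacement k o + total_gap w k.
Proof.
move=> kn; apply: (follows_le kn follows_sigma) => i ik.
by rewrite mulr0 position_total_gap // /packed lerD2l total_gap_mono.
Qed.

(** Initially particle i sits where the packed system shifted by [total_gap w i] has it, so the
    invariant of [follows_ge] starts with leader i. The second alternative cuts the minimum over all
    leaders off at n. *)
Lemma position_ge_displacement :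
  (exists2 k, (k < n)%N & displacement k o + total_gap w k
     <= sigma 0 (h * (size o)%:R) w)
  \/ total_gap w n <= sigma 0 (h * (size o)%:R) w.
Proof.
apply: (follows_ge (x := fun=> packed) (b := total_gap w) follows_sigma) => i.
rewrite leq_eqVlt => /predU1P[->|iN].
  by right; rewrite mulr0 position_total_gap.
by left; exists i; rewrite ?leqnn // mulr0 position_total_gap.
Qed.

End Path.
End Coupling.

(** * Tails of the displacement at real thresholds *)

Section Thresholds.
Variable R : realType.
Implicit Types s y : R.

(** Powers of [1 - s] become exponentials; the quadratic loss is the second-order term against which
    the tilt is optimized later. *)
Lemma one_sub_ge_expR s : 0 <= s <= 2^-1 -> expR (- (s + 2 * s ^+ 2)) <= 1 - s.
Proof.
move=> /andP[s0 s1]; rewrite expRN.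
have p0 : 0 < 1 + (s + 2 * s ^+ 2) by nra.
apply: (@le_trans _ _ ((1 + (s + 2 * s ^+ 2))^-1)).
  by rewrite lef_pV2 ?posrE ?expR_gt0 // expR_ge1Dx.
rewrite -[leLHS]mul1r ler_pdivrMr //.
have : 0 <= s ^+ 2 * (1 - 2 * s) by rewrite mulr_ge0 ?sqr_ge0 //; lra.
by nra.
Qed.

Lemma one_add_ge_expR s : 0 <= s <= 1 -> expR (s - s ^+ 2) <= 1 + s.
Proof.
move=> /andP[s0 s1]; rewrite -[X in expR X]opprK expRN.
have p0 : 0 < 1 - (s - s ^+ 2) by nra.
apply: (@le_trans _ _ ((1 - (s - s ^+ 2))^-1)).
  by rewrite lef_pV2 ?posrE ?expR_gt0 // expR_ge1Dx.
rewrite -[leLHS]mul1r ler_pdivrMr //.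
have : 0 <= s ^+ 3 by rewrite exprn_ge0.
by nra.
Qed.

Lemma exprz_expR s (z : int) : 0 <= z -> expR s ^ z = expR (s * z%:~R).
Proof. by case: z => // z _; rewrite -exprnP -expRM_natr. Qed.

Lemma lower_threshold n k (o : seq (option 'I_n)) s y : 0 <= s <= 2^-1 ->
  (displacement k o)%:~R <= y ->
  1 <= (1 - s) ^ displacement k o * expR ((s + 2 * s ^+ 2) * y).
Proof.
move=> s01 Dy; have := one_sub_ge_expR s01; have /andP[s0 s1] := s01.
set D := displacement k o in Dy *; have D0 : 0 <= D by exact: displacement_ge0.
move=> H; apply: (@le_trans _ _ (expR (- (s + 2 * s ^+ 2)) ^ D * expR ((s + 2 * s ^+ 2) * y))).
  rewrite exprz_expR // -expRD -[leLHS]expR0 ler_expR mulNr addrC subr_ge0.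
  by rewrite ler_wpM2l // addr_ge0 // mulr_ge0 // sqr_ge0.
apply: ler_wpM2r; first exact: expR_ge0.
move: D0; case: (D) => // m _; rewrite -!exprnP lerXn2r ?nnegrE ?expR_ge0 //; lra.
Qed.

Lemma weighted_lower_tail n (h : R) S (p : nat -> R) k l s y G m : 0 < h ->
  (forall i, 0 <= p i) -> h * \sum_(i < n) p i <= 1 + h * S -> (k < n)%N ->
  0 < l <= p k -> (forall i, (i < k)%N -> l < p i) -> 0 < s <= 2^-1 ->
  \sum_(i < k) l / (p i - l) <= G ->
  \sum_(o : m.-tuple (option 'I_n) | (displacement k o)%:~R <= y)
     \prod_(a <- o) rated_weights h S p a
  <= expR (s * (y + G - m%:R * h * l) + 2 * s ^+ 2 * y).
Proof.
move=> h0 p0 pS kn lk lp /andP[s0 s1] sG.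
have w0 a := rated_weights_ge0 h0 p0 pS a.
have E := @quenched_lower_tail R n h h0 S p k l s m p0 pS kn lk lp.
have s01 : 0 < s < 1 by rewrite s0 (le_lt_trans s1) // invf_lt1 // ltr1n.
apply: (@le_trans _ _ (expR ((s + 2 * s ^+ 2) * y) *
    expect (rated_weights h S p) k m (fun x => (1 - s) ^ x 0%N) packed)).
  rewrite -expectE mulr_sumr big_mkcond /=; apply: ler_sum => o _.
  have W0 : 0 <= \prod_(a <- o) rated_weights h S p a by apply: prodr_ge0 => a _.
  case: ifP => [Dy|_]; last first.
    by rewrite mulr_ge0 ?expR_ge0 // mulr_ge0 // ltW // exprz_gt0 // subr_gt0; case/andP: s01.
  rewrite mulrCA -[leLHS]mulr1 ler_wpM2l // mulrC.
  by apply: lower_threshold Dy; rewrite (ltW s0).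
apply: (@le_trans _ _ (expR ((s + 2 * s ^+ 2) * y) *
    expR (s * (\sum_(i < k) l / (p i - l) - m%:R * h * l)))).
  by rewrite ler_wpM2l ?expR_ge0 // E.
rewrite -expRD ler_expR.
have : 0 <= s * (G - \sum_(i < k) l / (p i - l)) by rewrite mulr_ge0 ?subr_ge0 // ltW.
lra.
Qed.

Lemma weighted_upper_tail n (h : R) S (p : nat -> R) k b l l2 s s2 rho y G m : 0 < h ->
  (forall i, 0 <= p i) -> h * \sum_(i < n) p i <= 1 + h * S -> h * (b *+ n) <= 1 ->
  S = \sum_(i < n) p i ->
  (k.+1 < n)%N -> 0 < l -> l < b -> 0 < l2 -> l2 < b -> p k.+1 <= l ->
  0 < s <= 1 -> 0 < s2 <= 2^-1 -> rho < 1 -> (1 + s) / (1 - s2) * (l / b) <= rho ->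
  0 <= y -> G <= \sum_(i < k.+1) l / (Num.max (p i) b - l) ->
  \sum_(o : m.-tuple (option 'I_n) | y <= (displacement k.+1 o)%:~R)
     \prod_(a <- o) rated_weights h S p a
  <= expR (s * (m%:R * h * l - G - y) + s ^+ 2 * y)
   + expR ((s2 + 2 * s2 ^+ 2) * (y + 1) - s2 * (m%:R * h * l2)
           + (s2 * (l2 / (b - l2)) + ln ((1 - rho)^-1)) * k.+1%:R).
Proof.
move=> h0 p0 pS hbn SE kn l0 lb l20 l2b pl /andP[s0 s1] /andP[s20 s21] rho1 tr y0 sG.
(* The displacement is an integer, so the threshold can be rounded up; this costs the [+ 1] in the
   second exponential. *)
pose yz := Num.ceil y.
have yz0 : 0 <= yz by rewrite /yz ceil_ge0 (lt_le_trans _ y0) // ltrN10.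
have yzy : y <= yz%:~R by exact: ceil_ge.
have yzy1 : yz%:~R <= y + 1.
  by have := ceilB1_lt y; rewrite -/yz intrB => /ltW; rewrite lerBlDr.
have w0 a := rated_weights_ge0 h0 p0 pS a.
have s201 : 0 < s2 < 1 by rewrite s20 (le_lt_trans s21) // invf_lt1 // ltr1n.
have E := @quenched_upper_tail R n h h0 S p k b l l2 s s2 rho m yz p0 pS hbn SE kn l0 lb
  l20 l2b pl s0 s201 rho1 tr.
apply: le_trans (le_trans _ E) _.
  rewrite -expectE big_mkcond /=; apply: ler_sum => o _.
  rewrite /displacement ceil_le_int.
  by case: ifP => _; rewrite ?mulr1 ?mulr0.
have s1pos : 0 < 1 + s by rewrite addr_gt0.
have s2pos : 0 < 1 - s2 by rewrite subr_gt0; case/andP: s201.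
apply: lerD.
  apply: (@le_trans _ _ (expR (s * (m%:R * h * l - G)) * expR (- ((s - s ^+ 2) * yz%:~R)))).
    apply: ler_pM; rewrite ?expR_ge0 ?(ltW (exprz_gt0 _ _)) //.
      rewrite ler_expR ler_wpM2l ?(ltW s0) // lerD2l lerN2.
      exact: sG.
    rewrite -invr_expz expRN lef_pV2 ?posrE ?exprz_gt0 ?expR_gt0 //.
    rewrite -exprz_expR //; case: (yz) yz0 => // j _; rewrite -!exprnP.
    rewrite lerXn2r ?nnegrE ?expR_ge0 ?(ltW s1pos) // one_add_ge_expR //.
    by rewrite (ltW s0).
  rewrite -expRD ler_expR.
  have : 0 <= (s - s ^+ 2) * (yz%:~R - y).
    by rewrite mulr_ge0 ?subr_ge0 // -[leRHS]mulr1 expr2 ler_wpM2l // ltW.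
  lra.
have rho0 : 0 < (1 - rho)^-1 by rewrite invr_gt0 subr_gt0.
apply: (@le_trans _ _ (expR ((s2 + 2 * s2 ^+ 2) * yz%:~R)
    * expR (s2 * (l2 / (b - l2) *+ k - m%:R * h * l2)) * expR (ln (1 - rho)^-1 * k.+1%:R))).
  apply: ler_pM.
  - by rewrite mulr_ge0 ?expR_ge0 // ltW // exprz_gt0.
  - by rewrite exprn_ge0 // ltW.
  - apply: ler_wpM2r; first exact: expR_ge0.
    rewrite -exprz_inv -exprz_expR //; case: (yz) yz0 => // j _; rewrite -!exprnP.
    rewrite lerXn2r ?nnegrE ?expR_ge0 ?invr_ge0 ?(ltW s2pos) //.
    rewrite -[leRHS]invrK lef_pV2 ?posrE ?invr_gt0 ?expR_gt0 // -expRN.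
    by apply: one_sub_ge_expR; rewrite (ltW s20).
  - by rewrite expRM_natr lnK.
rewrite -!expRD ler_expR.
have H1 : (s2 + 2 * s2 ^+ 2) * yz%:~R <= (s2 + 2 * s2 ^+ 2) * (y + 1).
  by rewrite ler_wpM2l // addr_ge0 ?mulr_ge0 ?sqr_ge0 // ltW.
have H2 : s2 * (l2 / (b - l2) *+ k) <= s2 * (l2 / (b - l2)) * k.+1%:R.
  rewrite -mulr_natr mulrA ler_wpM2l ?ler_nat //.
  by rewrite mulr_ge0 ?(ltW s20) // divr_ge0 ?subr_ge0 ?(ltW l20) ?(ltW l2b).
lra.
Qed.

End Thresholds.

Section RateEvents.
Context {d : measure_display} {T : measurableType d} {R : realType}.
Variables (P : probability T R) (rate : int -> {RV P >-> R}).

(** A copy of [T] whose measurable sets are the events of the rates, so that closure properties of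
    [sigma_rates] become statements about measurability. *)
Let ratesT := g_sigma_algebraType (preimages setT (fun i => rate i : T -> R)).

Let measurable_ratesE (A : set T) : sigma_rates rate A = measurable (A : set ratesT).
Proof. by []. Qed.

Let measurable_rate i : measurable_fun setT (rate i : ratesT -> R).
Proof.
move=> _ B mB; rewrite setTI; apply: sub_sigma_algebra; exists i => //.
by exists B => //; rewrite setTI.
Qed.

Lemma sigma_ratesI A B : sigma_rates rate A -> sigma_rates rate B ->
  sigma_rates rate (A `&` B).
Proof. rewrite !measurable_ratesE; exact: measurableI. Qed.

Lemma sigma_rates_forall (D : set nat) (Q : nat -> T -> Prop) :
  (forall i, D i -> sigma_rates rate [set w | Q i w]) ->
  sigma_rates rate [set w | forall i, D i -> Q i w].
Proof.
move=> mQ; rewrite measurable_ratesE.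
rewrite (_ : [set w | _] = \bigcap_(i in D) [set w | Q i w]).
  by apply: bigcap_measurableType => i ni; have := mQ i ni.
by apply/seteqP; split => w /=.
Qed.

Lemma sigma_rates_preimage i (B : set R) : measurable B ->
  sigma_rates rate [set w | B (rate i w)].
Proof.
move=> mB; rewrite measurable_ratesE -[X in measurable X]setTI.
exact: (measurable_rate i measurableT mB).
Qed.

Lemma sigma_rates_sum (psi : R -> R) k (B : set R) : measurable_fun setT psi ->
  measurable B -> sigma_rates rate [set w | B (\sum_(i < k) psi (rate i%:Z w))].
Proof.
move=> mpsi mB; rewrite measurable_ratesE -[X in measurable X]setTI.
have mS : measurable_fun setT (fun w : ratesT => \sum_(i < k) psi (rate i%:Z w)).
  by apply: measurable_sum => i; exact: measurableT_comp.
exact: (mS measurableT _ mB).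
Qed.

End RateEvents.

Lemma sum_exists_le (R : realType) (I J : finType) (Q : J -> pred I) (w : I -> R) (B : R) :
  (forall i, 0 <= w i) -> (forall j, \sum_(i | Q j i) w i <= B) ->
  \sum_(i | [exists j, Q j i]) w i <= #|J|%:R * B.
Proof.
move=> w0 QB; apply: (@le_trans _ _ (\sum_(j : J) \sum_(i | Q j i) w i)).
  rewrite (exchange_big_dep xpredT) //= big_mkcond /=; apply: ler_sum => i _.
  case: ifP => [/existsP[j Qji]|_]; last exact: sumr_ge0.
  by rewrite (bigD1 j) //= lerDl sumr_ge0.
apply: (@le_trans _ _ (\sum_(j : J) B)); first exact: ler_sum.
by rewrite sumr_const mulr_natl.
Qed.

(** * The motion of particle 0 for typical rates *)

Section Quenched.
Context {R : realType}.
Variables (c u ustar e z x y t tau Lam : R) (p : nat -> R).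
Hypotheses (c0 : 0 < c) (t0 : 0 < t) (tau0 : 0 < tau) (tau1 : tau <= 1)
  (tL : t * tau = Lam) (e0 : 0 < e) (z0 : 0 < z)
  (p01 : forall i, c < p i <= 1).

(** [C1 * t] bounds the thresholds of the displacement, and s below minimizes
    [- s * e * Lam + 2 * s ^+ 2 * (C1 * t)]; the minimum is the exponent in [exponent_le]. *)
Let C1 := c + z + e.
Let s := e * tau / (4 * C1).
Let C10 : 0 < C1. Proof. by rewrite !addr_gt0. Qed.
Let Lam0 : 0 < Lam. Proof. by rewrite -tL mulr_gt0. Qed.
Let Lamt : Lam <= t. Proof. by rewrite -tL ler_piMr // ltW. Qed.
Let p0 i : 0 <= p i.
Proof. by have /andP[cp _] := p01 i; rewrite ltW // (lt_trans c0). Qed.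

Let s_bounds : 0 < s <= 2^-1.
Proof.
rewrite /s divr_gt0 ?mulr_gt0 //= ler_pdivrMr ?mulr_gt0 //.
have : e * tau <= e by rewrite ler_piMr // ltW.
by rewrite /C1; move: c0 z0 e0; nra.
Qed.

Let exponent_le X Y : X <= - e * Lam -> Y <= C1 * t ->
  s * X + 2 * s ^+ 2 * Y <= - (e ^+ 2 / (8 * C1) * (tau * Lam)).
Proof.
move=> XL YC; have /andP[s0 _] := s_bounds.
apply: (@le_trans _ _ (s * (- e * Lam) + 2 * s ^+ 2 * (C1 * t))).
  by rewrite lerD // ler_pM2l // mulr_gt0 // exprn_gt0.
rewrite le_eqVlt -tL /s; apply/orP; left; apply/eqP.
by field; rewrite gt_eqF.
Qed.

Section Lower.
Variables (K n : nat).
Hypotheses (etau : e * tau < c) (yK : y * Lam <= K%:R) (U3 : 3 * e <= u - ustar)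
  (ustar0 : 0 <= ustar) (zx : z + 3 * e < x)
  (zyU : z + 4 * e <= y * (u - ustar - 2 * e))
  (fast : forall i, (i < K)%N -> c + x * tau < p i)
  (windows1 : forall k, (k < n)%N ->
     \sum_(i < k) window_gap (c + (z + 3 * e) * tau) (c + x * tau) (p i)
       <= k%:R * (ustar + 2 * e) + e * Lam)
  (windows2 : forall k, (k < n)%N ->
     \sum_(i < k) window_gap (c - e * tau) c (p i) <= k%:R * (ustar + e) + e * Lam).

(** This is what a position of particle 0 at most [c * t + z * Lam] forces on some displacement,
    once the first k gaps sum to at least [k%:R * (u - e) - e * Lam]. *)
Definition slow_pattern (o : seq (option 'I_n.+1)) : bool :=
  [exists k : 'I_n, (displacement k o)%:~R
     <= c * t + z * Lam - k%:R * (u - e) + e * Lam].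

(* A leader [k < K] is compared with the speed [c + (z + 3 * e) * tau], a leader
   [k >= K], possibly slow, only with [c - e * tau]. *)
Lemma quenched_slow m :
  \sum_(o : m.+1.-tuple (option 'I_n.+1) | slow_pattern o)
     \prod_(a <- o) rated_weights (t / m.+1%:R) (\sum_(i < n.+1) p i) p a
  <= n%:R * expR (- (e ^+ 2 / (8 * C1) * (tau * Lam))).
Proof.
set h := t / m.+1%:R.
have h0 : 0 < h by rewrite divr_gt0.
have mh : m.+1%:R * h = t by rewrite /h mulrC divfK.
have pS : h * \sum_(i < n.+1) p i <= 1 + h * \sum_(i < n.+1) p i by rewrite lerDr.
have w0 a := rated_weights_ge0 h0 p0 pS a.
rewrite -[n in n%:R]card_ord.
apply: (sum_exists_le (Q := fun (k : 'I_n) (o : m.+1.-tuple _) =>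
  (displacement k o)%:~R <= c * t + z * Lam - k%:R * (u - e) + e * Lam)).
  by move=> o; exact: prodr_ge0.
move=> k; have kn : (k < n.+1)%N by rewrite ltnS ltnW.
have Y1 : c * t + z * Lam - k%:R * (u - e) + e * Lam <= C1 * t.
  have : 0 <= k%:R * (u - e) by rewrite mulr_ge0 //; move: U3 ustar0 e0; lra.
  have : z * Lam <= z * t by rewrite ler_pM2l.
  have : e * Lam <= e * t by rewrite ler_pM2l.
  rewrite /C1; lra.
have [kK|kK] := ltnP k K.
- have lp i : (i <= k)%N -> c + (z + 3 * e) * tau < p i.
    move=> ik; apply: le_lt_trans (fast (leq_ltn_trans ik kK)).
    by rewrite lerD2l ler_pM2r // ltW.
  apply: le_trans (weighted_lower_tail (l := c + (z + 3 * e) * tau) (s := s)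
    (G := k%:R * (ustar + 2 * e) + e * Lam) _ _ h0 p0 pS kn _ _ s_bounds _) _.
  + apply/andP; split; last by rewrite ltW // lp.
    by rewrite addr_gt0 // mulr_gt0 // addr_gt0 // mulr_gt0.
  + by move=> i /ltnW; exact: lp.
  + apply: le_trans (windows1 (ltn_ord k)); rewrite le_eqVlt; apply/orP; left; apply/eqP.
    apply: eq_bigr => i _; rewrite /window_gap fast /=; last exact: ltn_trans kK.
    by have /andP[_ ->] := p01 i.
  (* The excess speed [3 * e] of the leader pays for the two fluctuations [e * Lam], of the gaps and
     of the windows, and leaves [- e * Lam]; the remaining multiple of k is nonpositive. *)
  + rewrite ler_expR mh; apply: exponent_le => //.
    have : 0 <= k%:R * (u - ustar - 3 * e) by rewrite mulr_ge0 //; move: U3; lra.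
    rewrite -tL; lra.
- have lp i : c - e * tau < p i.
    by have /andP[cp _] := p01 i; apply: lt_trans cp; rewrite ltrBlDr ltrDl mulr_gt0.
  apply: le_trans (weighted_lower_tail (l := c - e * tau) (s := s)
    (G := k%:R * (ustar + e) + e * Lam) _ _ h0 p0 pS kn _ _ s_bounds _) _.
  + by rewrite subr_gt0 etau ltW // lp.
  + by move=> i _; exact: lp.
  + apply: le_trans (windows2 (ltn_ord k)); rewrite le_eqVlt; apply/orP; left; apply/eqP.
    by apply: eq_bigr => i _; rewrite /window_gap p01.
  (* The slack [4 * e] of [zyU] covers the missing speed [e] and the two fluctuations [e * Lam],
     with [e] left; it is available because [k >= K]. *)
  + rewrite ler_expR mh; apply: exponent_le => //.
    have : y * Lam * (u - ustar - 2 * e) <= k%:R * (u - ustar - 2 * e).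
      rewrite ler_wpM2r //; first by move: U3 e0; lra.
      by rewrite (le_trans yK) // ler_nat.
    have : (z + 4 * e) * Lam <= y * (u - ustar - 2 * e) * Lam by rewrite ler_pM2r.
    rewrite -tL; lra.
Qed.

End Lower.

Section Upper.
Variables (b s2 rho kap : R) (k n : nat).
Hypotheses (cb : c < b) (x0 : 0 < x) (k0 : (0 < k)%N) (kn : (k < n)%N)
  (ky : k%:R <= y * Lam) (U0 : 0 < u - ustar)
  (xyU : x + y * (u - ustar) + e * (3 + 3 * y) <= z)
  (Y0 : (y * (u + e) + e) * tau <= c)
  (xb : c + x * tau < b) (slow : p k <= c + x * tau) (ustar0 : 0 <= ustar)
  (s2_bounds : 0 < s2 <= 2^-1) (rho1 : rho < 1)
  (s2c : (1 + 2 * s2) * c <= c + (b - c) / 4)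
  (tr : (1 + s) / (1 - s2) * ((c + x * tau) / b) <= rho)
  (kapE : kap = s2 * ((b + c) / 2 / (b - (b + c) / 2)) + ln ((1 - rho)^-1))
  (big : s2 * (2 * (z * Lam + 1)) + kap * (y * Lam) <= s2 * ((b - c) / 8) * t)
  (capped : k%:R * (ustar - 2 * e) - e * Lam <= \sum_(i < k) capped_gap c b (p i)).

(** A slow leader k holds the displacement near [(c + x * tau) * t - k * ustar]. The first
    exponential is the cost of a fluctuation; the second is the alternative of leader k - 1, whose
    rate is raised to at least [b] and which would have to fall behind by a multiple of t. *)
Lemma quenched_fast m : t / m.+1%:R * (b *+ n) <= 1 ->
  \sum_(o : m.+1.-tuple (option 'I_n) |
       c * t + z * Lam - k%:R * (u + e) - e * Lam <= (displacement k o)%:~R)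
     \prod_(a <- o) rated_weights (t / m.+1%:R) (\sum_(i < n) p i) p a
  <= expR (- (e ^+ 2 / (8 * C1) * (tau * Lam))) + expR (- (s2 * ((b - c) / 8) * t)).
Proof.
set h := t / m.+1%:R => hbn.
have h0 : 0 < h by rewrite divr_gt0.
have mh : m.+1%:R * h = t by rewrite /h mulrC divfK.
have pS : h * \sum_(i < n) p i <= 1 + h * \sum_(i < n) p i by rewrite lerDr.
have /andP[s20 s21] := s2_bounds.
have s01 : 0 < s <= 1.
  by have /andP[-> s1] := s_bounds; rewrite (le_trans s1) // invf_le1 // ler1n.
have ue0 : 0 <= u + e by move: U0 ustar0 e0; lra.
have kL : y * (u + e) * Lam >= k%:R * (u + e).
  rewrite mulrAC ler_wpM2r //.
have YL : (y * (u + e) + e) * Lam <= c * t.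
  by rewrite -tL [c * t]mulrC [X in X <= _]mulrC -mulrA ler_pM2l // mulrC.
have zL0 : 0 <= z * Lam by rewrite mulr_ge0 // ltW.
have ct0 : 0 < c * t by rewrite mulr_gt0.
have Y1 : 0 <= c * t + z * Lam - k%:R * (u + e) - e * Lam by lra.
(* The alternative involves particle k - 1, whence [0 < k]. *)
case: k k0 kn ky slow capped kL Y1 => // j _ jn jy jslow jcapped jL Y1.
have xt0 : 0 < x * tau by rewrite mulr_gt0.
have l0 : 0 < c + x * tau by rewrite addr_gt0.
have bc : 0 < (b + c) / 2 by move: c0 cb; lra.
apply: le_trans (weighted_upper_tail (l := c + x * tau) (b := b) (s := s)
  (l2 := (b + c) / 2) (s2 := s2) (rho := rho) (G := j.+1%:R * (ustar - 2 * e) - e * Lam)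
  _ h0 p0 pS hbn _ jn l0 xb bc _ jslow s01 s2_bounds rho1 tr Y1 _) _ => //.
- by move: cb; lra.
- apply: le_trans jcapped _; apply: ler_sum => i _; rewrite /capped_gap p01.
  apply: ler_div_sub; [exact: ltW | by rewrite lerDl ltW | by rewrite lt_max xb orbT].
rewrite mh -kapE; apply: lerD; rewrite ler_expR.
- apply: (@le_trans _ _ (s * (t * (c + x * tau) - (j.+1%:R * (ustar - 2 * e) - e * Lam)
      - (c * t + z * Lam - j.+1%:R * (u + e) - e * Lam))
    + 2 * s ^+ 2 * (c * t + z * Lam - j.+1%:R * (u + e) - e * Lam))).
    rewrite lerD2l; have : 0 <= s ^+ 2 * (c * t + z * Lam - j.+1%:R * (u + e) - e * Lam).
      by rewrite mulr_ge0 // sqr_ge0.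
    lra.
  apply: exponent_le.
    (* In [xyU] the slack [3 * e * y] absorbs the errors proportional to k, and [3 * e] the two
       fluctuations [e * Lam], with [e] left. *)
    have : j.+1%:R * (u - ustar + 3 * e) <= y * Lam * (u - ustar + 3 * e).
      by rewrite ler_wpM2r //; move: U0 e0; lra.
    have : (x + y * (u - ustar) + e * (3 + 3 * y)) * Lam <= z * Lam by rewrite ler_pM2r.
    rewrite -tL; lra.
  rewrite /C1; have : z * Lam <= z * t by rewrite ler_pM2l.
  have : 0 <= e * Lam by rewrite mulr_ge0 // ltW.
  have : 0 <= e * t by rewrite mulr_ge0 // ltW.
  have : 0 <= j.+1%:R * (u + e) by rewrite mulr_ge0.
  lra.
- have kap0 : 0 <= kap.
    rewrite kapE addr_ge0 //.
      by rewrite mulr_ge0 ?(ltW s20) // divr_ge0 ?(ltW bc) //; move: cb; lra.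
    have rho0 : 0 <= rho.
      have /andP[s0 _] := s01; apply: le_trans tr; apply: mulr_ge0.
        by apply: divr_ge0; move: s0 s21; lra.
      by apply: divr_ge0; rewrite ltW // (lt_trans c0).
    have rr : 0 < 1 - rho by rewrite subr_gt0.
    by rewrite ln_ge0 // invf_ge1 // lerBlDr lerDl.
  have H : kap * j.+1%:R <= kap * (y * Lam) by rewrite ler_wpM2l.
  have Y2 : (s2 + 2 * s2 ^+ 2) * (c * t + z * Lam - j.+1%:R * (u + e) - e * Lam + 1)
     <= (s2 + 2 * s2 ^+ 2) * (c * t + (z * Lam + 1)).
    rewrite ler_wpM2l //.
      by rewrite addr_ge0 ?(ltW s20) // mulr_ge0 // sqr_ge0.
    have : 0 <= e * Lam by rewrite mulr_ge0 // ltW.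
    have : 0 <= j.+1%:R * (u + e) by rewrite mulr_ge0.
    lra.
  have Y3 : s2 * (1 + 2 * s2) * (z * Lam + 1) <= s2 * 2 * (z * Lam + 1).
    rewrite ler_wpM2r // ?ler_wpM2l ?(ltW s20) //; last by move: s21; lra.
    by rewrite addr_ge0 // mulr_ge0 // ltW.
  have Y4 : s2 * ((1 + 2 * s2) * c * t) <= s2 * ((c + (b - c) / 4) * t).
    by rewrite ler_pM2l // ler_pM2r.
  (* The speed [(b + c) / 2] exceeds [c + (b - c) / 4] by [(b - c) / 4], which yields
     [s2 * ((b - c) / 4) * t] in the exponent; [big] spends half of it. *)
  apply: (@le_trans _ _ ((s2 + 2 * s2 ^+ 2) * (c * t + (z * Lam + 1))
      - s2 * (t * ((b + c) / 2)) + kap * (y * Lam))); first by rewrite !lerD.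
  move: Y3 Y4 big; generalize (kap * (y * Lam)) (z * Lam + 1) => A B.
  lra.
Qed.

End Upper.
End Quenched.

(** * Asymptotics *)

Section Asymptotics.
Context {R : realType}.
Implicit Types a b k t x y v : R.

Lemma powR_near_ge a v : 0 < a -> \forall t \near +oo, v <= t `^ a.
Proof.
move=> a0; near=> t.
apply: (@le_trans _ _ (Num.max v 1)); first by rewrite le_max lexx.
have M0 : 0 <= Num.max v 1 by rewrite le_max ler01 orbT.
rewrite -[leLHS]powRr1 // -(mulVf (lt0r_neq0 a0)) powRrM.
apply: ge0_ler_powR; rewrite ?nnegrE ?powR_ge0 ?(ltW a0) //.
Unshelve. all: by end_near. Qed.

Lemma powR_near_le a e : 0 < a -> 0 < e -> \forall t \near +oo, t `^ (- a) <= e.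
Proof.
move=> a0 e0; near=> t; rewrite powRN -[leRHS]invrK lef_pV2 ?posrE ?invr_gt0 //.
  near: t; exact: powR_near_ge.
by rewrite powR_gt0 //; near: t; exact: nbhs_pinfty_gt (num_real _).
Unshelve. all: by end_near. Qed.

Lemma powR_cvg_pinfty0 a : 0 < a -> t `^ (- a) @[t --> +oo] --> (0 : R).
Proof.
move=> a0; apply/cvgr0Pnorm_le => e e0; near=> t.
by rewrite ger0_norm ?powR_ge0 //; near: t; exact: powR_near_le.
Unshelve. all: by end_near. Qed.

(* With [T = t `^ (b / 2)] one has [ln t <= (2 / b) * T], so the exponent is at most
   [(2 / b) * T - k * T ^+ 2 <= - T] for large [t]. *)
Lemma exp_decay b k C e : 0 < b -> 0 < k -> 0 <= C -> 0 < e ->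
  \forall t \near +oo, C * t * expR (- (k * t `^ b)) <= e.
Proof.
move=> b0 k0 C0 e0; have b20 : 0 < b / 2 by rewrite divr_gt0.
near=> t.
have t0 : 0 < t by near: t; exact: nbhs_pinfty_gt (num_real _).
have T1 : (2 / b + 1) / k <= t `^ (b / 2) by near: t; exact: powR_near_ge.
have T2 : C / e <= t `^ (b / 2) by near: t; exact: powR_near_ge.
set T := t `^ (b / 2) in T1 T2 *; have T0 : 0 < T by rewrite powR_gt0.
have TT : t `^ b = T ^+ 2.
  by rewrite -powR_mulrn ?powR_ge0 // /T -powRrM; congr (_ `^ _); field.
have lnt : ln t <= 2 / b * T.
  have -> : ln t = 2 / b * ln T by rewrite ln_powR; field; rewrite gt_eqF.
  by rewrite ler_pM2l ?divr_gt0 // ltW // ln_sublinear.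
apply: (@le_trans _ _ (C * expR (- T))).
  rewrite -mulrA ler_wpM2l // -{1}(lnK t0) -expRD ler_expR TT.
  move: T1; rewrite ler_pdivrMr // => T1.
  have : (2 / b + 1) * T <= T * k * T by rewrite ler_pM2r.
  by move: lnt; generalize (2 / b) => r; nra.
rewrite expRN ler_pdivrMr ?expR_gt0 //.
move: T2; rewrite ler_pdivrMr // => T2; apply: le_trans T2 _.
rewrite mulrC ler_pM2l //; apply: le_trans (expR_ge1Dx _); lra.
Unshelve. all: by end_near. Qed.

(** The exponents of the theorem are homogeneous of degree [nu + 2] in z, so slack in the exponent
    can be traded for a factor s on z; this makes the constraints on x and y strict. *)
Lemma scale_lt a V v : 0 < a -> 0 < V -> v < V -> exists2 s, 0 < s < 1 & v < s `^ a * V.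
Proof.
move=> a0 V0 vV; have [r [/andP[r0 r1] rv]] : exists r, 0 < r < 1 /\ v < r * V.
  exists ((Num.max v 0 + V) / 2 / V); rewrite divfK ?gt_eqF //.
  have m0 : 0 <= Num.max v 0 by rewrite le_max lexx orbT.
  have mv : v <= Num.max v 0 by rewrite le_max lexx.
  have mV : Num.max v 0 < V by rewrite gt_max vV.
  split; last by move: mv vV; lra.
  rewrite divr_gt0 ?divr_gt0 ?(ltr_wpDl m0) //= ltr_pdivrMr // mul1r.
  by move: mV; lra.
have p1 : 1 `^ a^-1 = 1 :> R by rewrite powR1.
exists (r `^ a^-1).
  rewrite powR_gt0 //= -[ltRHS]p1.
  by apply: gt0_ltr_powR; rewrite ?nnegrE ?invr_gt0 // ltW.
by rewrite -powRrM mulVf ?gt_eqF // powRr1 // ltW.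
Qed.

Lemma scale_gt a V v : 0 < a -> 0 < V -> V < v -> exists2 s, 1 < s & s `^ a * V < v.
Proof.
move=> a0 V0 vV; have [r [r1 rv]] : exists r, 1 < r /\ r * V < v.
  exists ((v + V) / 2 / V); rewrite divfK ?gt_eqF //.
  split; last by move: vV; lra.
  by rewrite ltr_pdivlMr // mul1r; move: vV; lra.
have r0 : 0 < r by rewrite (lt_trans ltr01).
have p1 : 1 `^ a^-1 = 1 :> R by rewrite powR1.
exists (r `^ a^-1).
  rewrite -[ltLHS]p1.
  by apply: gt0_ltr_powR; rewrite ?nnegrE ?invr_gt0 // ltW.
by rewrite -powRrM mulVf ?gt_eqF // powRr1 // ltW.
Qed.

Lemma limf_esup_near (f : R -> \bar R) B : (\forall t \near +oo, (f t <= B)%E) ->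
  (limf_esup f (pinfty_nbhs R) <= B)%E.
Proof.
move=> fB; rewrite limf_esupE; apply: (le_trans (ereal_inf_lbound _)).
  by exists [set t | (f t <= B)%E].
by apply: ge_ereal_sup => _ [t /= ft <-].
Qed.

Lemma limf_einf_near (f : R -> \bar R) B : (\forall t \near +oo, (B <= f t)%E) ->
  (B <= limf_einf f (pinfty_nbhs R))%E.
Proof.
move=> fB; rewrite limf_einfE; apply: (le_trans _ (ereal_sup_ubound _)); last first.
  by exists [set t | (B <= f t)%E].
by apply: le_ereal_inf_tmp => _ [t /= ft <-].
Qed.

End Asymptotics.

Section NoSlowRate.
Context {R : realType}.
Variables (c nu kappa : R) (F : R -> R).
Hypotheses (nu0 : 0 < nu) (F0 : forall p, 0 <= F p)
  (Fkappa : (F p / (p - c) `^ (nu + 1)) @[p --> c^'+] --> kappa).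

Let Lam t : R := t `^ (1 - alpha nu).
Let tau t : R := t `^ (- alpha nu).

Lemma alpha_gt0 : 0 < alpha nu. Proof. by rewrite invr_gt0 addr_gt0. Qed.
Lemma alpha_lt_half : 2 * alpha nu < 1.
Proof. by rewrite /alpha ltr_pdivrMr ?addr_gt0 // mul1r ltrDr. Qed.

Let Lam_exp_gt0 : 0 < 1 - alpha nu.
Proof. by have := alpha_gt0; have := alpha_lt_half; lra. Qed.

Lemma time_mul_tau t : 0 < t -> t * tau t = Lam t.
Proof. by move=> t0; rewrite /tau /Lam -{1}[t]powRr1 ?ltW // -powRD // gt_eqF ?implybT. Qed.

Lemma cvg_scaled_distribution x : 0 < x ->
  (Lam t * F (c + x * tau t)) @[t --> +oo] --> kappa * x `^ (nu + 1).
Proof.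
move=> x0.
have H1 : (F (c + x * tau t) / (x * tau t) `^ (nu + 1)) @[t --> +oo] --> kappa.
  apply/cvgrPdist_lt => e e0.
  have /cvgrPdist_lt/(_ e e0) := Fkappa; move=> /near_right_ex[r r0 Hr].
  near=> t; have t0 : 0 < t by near: t; exact: nbhs_pinfty_gt (num_real _).
  have xt0 : 0 < x * tau t by rewrite mulr_gt0 // powR_gt0.
  have -> : x * tau t = c + x * tau t - c by rewrite addrC addKr.
  rewrite [c + (c + _ - c)]addrC subrK; apply: Hr; first by rewrite ltrDl.
  rewrite ltrD2l mulrC -ltr_pdivlMr //.
  apply: (@le_lt_trans _ _ (r / x / 2)); last by rewrite ltr_pdivrMr // ltr_pMr ?divr_gt0 // ltr1n.
  near: t; apply: powR_near_le; first exact: alpha_gt0.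
  by rewrite !divr_gt0.
have : (F (c + x * tau t) / (x * tau t) `^ (nu + 1) * x `^ (nu + 1)) @[t --> +oo]
    --> kappa * x `^ (nu + 1) by apply: cvgM; [exact: H1|exact: cvg_cst].
apply: cvg_trans; apply: near_eq_cvg; near=> t.
have t0 : 0 < t by near: t; exact: nbhs_pinfty_gt (num_real _).
rewrite powRM ?(ltW x0) ?powR_ge0 //.
have -> : tau t `^ (nu + 1) = (Lam t)^-1.
  rewrite /tau /Lam -powRrM -powRN; congr (_ `^ _); rewrite /alpha.
  by field; rewrite gt_eqF // addr_gt0.
have xn : x `^ (nu + 1) != 0 by rewrite gt_eqF // powR_gt0.
have Ln : Lam t != 0 by rewrite gt_eqF // powR_gt0.
by field; rewrite ?xn ?Ln.
Unshelve. all: by end_near. Qed.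

Lemma cvg_distribution0 x : 0 < x -> F (c + x * tau t) @[t --> +oo] --> (0 : R).
Proof.
move=> x0; have : (t `^ (- (1 - alpha nu)) * (Lam t * F (c + x * tau t))) @[t --> +oo]
    --> 0 * (kappa * x `^ (nu + 1)).
  by apply: cvgM; [exact: powR_cvg_pinfty0|exact: cvg_scaled_distribution].
rewrite mul0r; apply: cvg_trans; apply: near_eq_cvg; near=> t.
have t0 : 0 < t by near: t; exact: nbhs_pinfty_gt (num_real _).
by rewrite powRN mulKf // gt_eqF // powR_gt0.
Unshelve. all: by end_near. Qed.

Lemma no_slow_rate_le x y v : 0 < x -> 0 < y -> v < y * (kappa * x `^ (nu + 1)) ->
  \forall t \near +oo,
    (1 - F (c + x * tau t)) ^+ Num.truncn (y * Lam t) <= expR (- v).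
Proof.
move=> x0 y0 vy.
(* The subtracted [F] accounts for rounding [y * Lam t] down. *)
have H : (y * (Lam t * F (c + x * tau t)) - F (c + x * tau t)) @[t --> +oo]
    --> y * (kappa * x `^ (nu + 1)) - 0.
  apply: cvgB; last exact: cvg_distribution0.
  by apply: cvgM; [exact: cvg_cst|]; exact: cvg_scaled_distribution.
near=> t.
have vt : v < y * (Lam t * F (c + x * tau t)) - F (c + x * tau t).
  by near: t; apply: (cvgr_gt _ H); rewrite subr0.
have p1 : F (c + x * tau t) <= 1.
  by near: t; apply: (cvgr_le _ (cvg_distribution0 x0)).
set p := F _ in vt p1 *; set K := Num.truncn _.
have KL : y * Lam t - 1 <= K%:R.
  by rewrite lerBlDr natr1 ltW // truncnS_gt.
apply: (@le_trans _ _ (expR (- p) ^+ K)).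
  by rewrite lerXn2r ?nnegrE ?expR_ge0 ?subr_ge0 // expR_ge1Dx.
rewrite -expRM_natr ler_expR mulNr lerN2.
have : p * (y * Lam t - 1) <= p * K%:R by rewrite ler_wpM2l // F0.
by apply: le_trans; apply: le_trans (ltW vt) _; rewrite le_eqVlt; apply/orP; left; apply/eqP; ring.
Unshelve. all: by end_near. Qed.

Lemma no_slow_rate_ge x y v : 0 < x -> 0 < y -> y * (kappa * x `^ (nu + 1)) < v ->
  \forall t \near +oo,
    expR (- v) <= (1 - F (c + x * tau t)) ^+ (Num.truncn (y * Lam t)).+1.
Proof.
move=> x0 y0 vy.
(* The added [F] accounts for rounding up, and the factor [1 + 2 * F] for the quadratic loss in
   [one_sub_ge_expR]. *)
have H : ((y * (Lam t * F (c + x * tau t)) + F (c + x * tau t)) *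
     (1 + 2 * F (c + x * tau t))) @[t --> +oo]
    --> (y * (kappa * x `^ (nu + 1)) + 0) * (1 + 2 * 0).
  apply: cvgM; apply: cvgD.
  - by apply: cvgM; [exact: cvg_cst|]; exact: cvg_scaled_distribution.
  - exact: cvg_distribution0.
  - exact: cvg_cst.
  - by apply: cvgM; [exact: cvg_cst|]; exact: cvg_distribution0.
near=> t.
have vt : (y * (Lam t * F (c + x * tau t)) + F (c + x * tau t))
    * (1 + 2 * F (c + x * tau t)) < v.
  by near: t; apply: (cvgr_lt _ H); rewrite mulr0 !addr0 mulr1.
have p1 : F (c + x * tau t) <= 2^-1.
  by near: t; apply: (cvgr_le _ (cvg_distribution0 x0)); rewrite invr_gt0.
set p := F _ in vt p1 *; set K := Num.truncn _.
have p0 : 0 <= p by exact: F0.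
have KL : K.+1%:R <= y * Lam t + 1.
  by rewrite -natr1 lerD2r truncn_le // mulr_ge0 ?powR_ge0 // ltW.
apply: (@le_trans _ _ (expR (- (p + 2 * p ^+ 2)) ^+ K.+1)); last first.
  rewrite lerXn2r ?nnegrE ?expR_ge0 //; first by move: p1; lra.
  by apply: one_sub_ge_expR; rewrite p0.
rewrite -expRM_natr ler_expR mulNr lerN2.
apply: le_trans (ltW vt).
apply: (@le_trans _ _ ((p + 2 * p ^+ 2) * (y * Lam t + 1))).
  by rewrite ler_wpM2l // addr_ge0 // mulr_ge0 // sqr_ge0.
rewrite le_eqVlt; apply/orP; left; apply/eqP; ring.
Unshelve. all: by end_near. Qed.

End NoSlowRate.

Lemma powR_succ (R : realType) (nu x : R) : 0 < nu -> 0 < x -> x * x `^ (nu + 1) = x `^ (nu + 2).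
Proof.
move=> nu0 x0; have -> : nu + 1 = nu + 2 - 1 by ring.
by rewrite mulr_powRB1 // ?ltW // addr_gt0.
Qed.

(* The choice of [x] and [y] maximizing [y * x `^ (nu + 1)] subject to [x + y * U = s * z]. *)
Lemma optimal_window (R : realType) (nu U s z : R) : 0 < nu -> 0 < U -> 0 < s -> 0 < z ->
  s * z / ((nu + 2) * U) * (s * z * ((nu + 1) / (nu + 2))) `^ (nu + 1)
  = s `^ (nu + 2) * ((Anu nu)^-1 / U * z `^ (nu + 2)).
Proof.
move=> nu0 U0 s0 z0.
have n1 : 0 < nu + 1 by rewrite addr_gt0.
have n2 : 0 < nu + 2 by rewrite addr_gt0.
rewrite /Anu !powRM ?invr_ge0 ?mulr_ge0 ?(ltW s0) ?(ltW z0) ?(ltW n1) ?(ltW n2) //; last first.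
  by rewrite invr_ge0 ltW.
have -> : (nu + 2)^-1 `^ (nu + 1) = ((nu + 2) `^ (nu + 1))^-1.
  by rewrite -powR_inv1 ?(ltW n2) // -powRrM mulN1r powRN.
rewrite -!powR_succ //.
by field; rewrite !lt0r_neq0 ?powR_gt0.
Qed.

Lemma complement_ge (R : realDomainType) (a q r m e : R) :
  a <= 1 - q + r -> m <= q -> r <= e -> m - e <= 1 - a.
Proof. lra. Qed.

(** * The position of particle 0 *)

Section RandomRates.
Context {R : realType} {d : measure_display} {T : measurableType d}.
Variables (P : probability T R) (c u : R) (F : cumulativeBounded (0 : R) (1 : R))
  (rate : int -> {RV P >-> R}) (N : int -> R -> T -> nat)
  (sigma : int -> R -> T -> int).
Hypotheses (c0 : 0 < c) (c1 : c < 1) (Fc : F c = 0) (F1 : F 1 = 1)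
  (tasep : disordered_tasep F rate N sigma)
  (sigma0 : {ae P, forall w, sigma 0 0 w = 0})
  (gaps_iid : iid P (initial_gap sigma))
  (gaps_mean : forall i, ('E_P[fun w => (initial_gap sigma i w)%:~R] = u%:E)%E)
  (gaps_var : forall i, ('V_P[fun w => ((initial_gap sigma i w)%:~R : R)] < +oo)%E)
  (ufin : (critical_gap c F < +oo)%E).

Let ustar := fine (critical_gap c F).
Let eta := initial_gap sigma.

Lemma measurable_initial_gap i : measurable_fun setT (eta i).
Proof.
have m0 j (z : int) : measurable [set w | sigma j 0 w = z].
  rewrite -[X in measurable X]setTI.
  by have H := positions_measurable tasep j (lexx 0); exact: (H measurableT [set z] I).
move=> _ B _; rewrite setTI.
rewrite (_ : eta i @^-1` B = \bigcup_z (\bigcup_k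
   ([set w | sigma i 0 w = z] `&` [set w | sigma (i + 1) 0 w = k]
     `&` [set w | B (k - z - 1)]))); last first.
  apply/seteqP; split => [w Bw|w [z _ [k _ [[/= <- <-]]]] //].
  exists (sigma i 0 w) => //; exists (sigma (i + 1) 0 w) => //.
have : countable [set: int] by [].
move=> cZ; apply: countable_bigcupT_measurable => // z.
apply: countable_bigcupT_measurable => // k.
apply: measurableI; first exact: measurableI.
have [Bk|Bk] := pselect (B (k - z - 1)).
  by have -> : [set w : T | B (k - z - 1)] = setT by apply/seteqP; split.
by have -> : [set w : T | B (k - z - 1)] = set0 by apply/seteqP; split.
Qed.

Lemma good_paths : {ae P, forall w,
  [/\ forall i, counting_path (fun t => N i t w),
      exclusion_path (fun i t => N i t w) (fun i t => sigma i t w),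
      sigma 0 0 w = 0 & forall i : nat, c < rate i%:Z w <= 1]}.
Proof.
have rates : {ae P, forall w, forall i : nat, c < rate i%:Z w <= 1}.
  apply: ae_foralln => i; apply: (rate_in_support (F := F)) => // p.
  exact: rates_distribution tasep _ _.
have paths := positions_exclusion tasep.
have clocks := clocks_counting tasep.
by near=> w; split; near: w.
Unshelve. all: by end_near. Qed.

Let meta := measurable_initial_gap.
Let mrate i : measurable_fun setT (rate i : T -> R). Proof. exact: measurable_funP. Qed.
Let rate_law i (g : R -> R) := integral_rate (rates_distribution tasep i) (g := g).

Lemma initial_gap_ge0 w : exclusion_path (fun i t => N i t w) (fun i t => sigma i t w) ->
  forall i, 0 <= eta i w.
Proof.
move=> xP i; have := exclusion_order xP i (lexx 0).
by rewrite /eta /initial_gap; move: (sigma _ _ _) (sigma _ _ _) => a b; lia.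
Qed.

Let gaps_ge0 : {ae P, forall w, forall i, 0 <= eta i w}.
Proof. by have := positions_exclusion tasep; apply: filterS => w; exact: initial_gap_ge0. Qed.

Let ustar0 : 0 <= ustar. Proof. by rewrite fine_ge0 // critical_gap_ge0. Qed.

Let small_delta (mu e : R) : 0 <= mu -> 0 < e ->
  exists2 delta, 0 < delta <= 2^-1 & 2 * delta * mu <= e.
Proof.
move=> mu0 e0; exists (Num.min 2^-1 (e / (2 * (mu + e)))).
  by rewrite lt_min ge_min lexx invr_gt0 ltr0n divr_gt0 // mulr_gt0 // ltr_wpDl.
apply: (@le_trans _ _ (2 * (e / (2 * (mu + e))) * (mu + e))).
  rewrite ler_pM // ?mulr_ge0 //.
  + by rewrite le_min invr_ge0 ler0n divr_ge0 // ?mulr_ge0 // ?addr_ge0 // ltW.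
  + by rewrite ler_wpM2l // ge_min lexx orbT.
  + by rewrite lerDl ltW.
by rewrite le_eqVlt; apply/orP; left; apply/eqP; field; rewrite gt_eqF // ltr_wpDl.
Qed.

Lemma few_gaps (e : R) : 0 < e -> exists2 s0, 0 < s0 & forall (a : R) k,
  (P [set w | (\sum_(j < k) size_of_gap (eta j%:Z w) <= k%:R * (u - e) - a)%R]
   <= (expR (- (s0 * a)))%:E)%E.
Proof.
move=> e0.
have [W HW] := integral_size_of_gap_sqr meta (proj2 gaps_iid) gaps_mean gaps_var.
have W0 : 0 < `|W| + 1 by rewrite ltr_wpDl.
exists (e / (`|W| + 1)); first by rewrite divr_gt0.
move=> a k; apply: (lower_deviation meta (proj1 gaps_iid) _ _ (W := W)) => //.
- by move=> z; rewrite /size_of_gap le_max lexx orbT.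
- by move=> i; rewrite (integral_size_of_gap meta gaps_ge0 gaps_mean).
- by rewrite divr_gt0.
- by rewrite mulrAC ler_pdivrMr // ler_pM2l // ler_wpDr // ler_norm.
Qed.

(** With only a finite variance the upper tail of the gaps need not be exponential: they are
    truncated at M, and a single gap larger than M is handled by Chebyshev's inequality. *)
Lemma many_gaps (e : R) : 0 < e -> exists2 W, 0 < W & exists2 s0, 0 < s0 &
  forall (M a : R) k, 0 < M ->
  (P [set w | (k%:R * (u + e) + a <= \sum_(j < k) Num.min (size_of_gap (eta j%:Z w)) M)%R]
   <= (expR (- (s0 / M * a)))%:E)%E
  /\ (P [set w | (M < size_of_gap (eta k%:Z w))%R] <= (W / M ^+ 2)%:E)%E.
Proof.
move=> e0.
have u0 : 0 <= u.
  rewrite -lee_fin -(integral_size_of_gap meta gaps_ge0 gaps_mean 0).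
  by apply: integral_ge0 => w _; rewrite lee_fin le_max lexx orbT.
have [W HW] := integral_size_of_gap_sqr meta (proj2 gaps_iid) gaps_mean gaps_var.
exists (`|W| + 1); first by rewrite ltr_wpDl.
have [delta /andP[d0 d1] d2] := small_delta u0 e0.
exists delta => // M a k M0.
have msz i : measurable_fun setT (fun w => size_of_gap (eta i w) : R).
  exact: (measurableT_comp (measurable_int_fun (@size_of_gap R)) (meta i)).
have sz0 z : 0 <= size_of_gap z :> R by rewrite le_max lexx orbT.
split.
  apply: (upper_deviation meta (proj1 gaps_iid)
    (psi := fun z => Num.min (size_of_gap z) M)) => //.
  - by move=> z; rewrite le_min sz0 ltW.
  - by move=> z; rewrite ge_min lexx orbT.
  - move=> i; rewrite -(integral_size_of_gap meta gaps_ge0 gaps_mean i).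
    apply: ge0_le_integral => //.
    + by move=> w _; rewrite lee_fin le_min sz0 ltW.
    + apply/measurable_EFinP; apply: measurable_minr => //; exact: msz.
    + by apply/measurable_EFinP; exact: msz.
    + by move=> w _; rewrite lee_fin ge_min lexx.
  - by rewrite d0.
have M20 : 0 < M ^+ 2 by rewrite exprn_gt0.
have := @le_integral_comp_abse _ _ _ P setT measurableT
  (fun w => (size_of_gap (eta k%:Z w) ^+ 2)%:E) (M ^+ 2) id.
have m2 : measurable_fun setT (fun w => (size_of_gap (eta k%:Z w) ^+ 2 : R)%:E).
  by apply/measurable_EFinP; apply: measurable_funX; exact: msz.
move=> /(_ (@measurable_id _ _ _) (fun _ H => H) (fun _ _ _ _ H => H) m2 M20) H.
have A0 : 0 <= (M ^+ 2)^-1 by rewrite invr_ge0 ltW.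
apply: (@le_trans _ _ ((M ^+ 2)^-1%:E * ((M ^+ 2)%:E *
    P [set w | (M < size_of_gap (eta k%:Z w))%R]))%E).
  by rewrite muleA -EFinM mulVf ?gt_eqF // mul1e.
have -> : ((`|W| + 1) / M ^+ 2)%:E = ((M ^+ 2)^-1%:E * (`|W| + 1)%:E)%E :> \bar R.
  by rewrite -EFinM mulrC.
apply: lee_wpmul2l; first by rewrite lee_fin.
apply: (@le_trans _ _ (\int[P]_w (size_of_gap (eta k%:Z w) ^+ 2)%:E)%E); last first.
  by apply: le_trans (HW _) _; rewrite lee_fin ler_wpDr // ler_norm.
have absE w : `|(size_of_gap (eta k%:Z w) ^+ 2)%:E|%E = (size_of_gap (eta k%:Z w) ^+ 2 : R)%:E.
  by rewrite gee0_abs // lee_fin sqr_ge0.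
under eq_integral do rewrite -absE.
apply: le_trans H; apply: lee_wpmul2l; first by rewrite lee_fin ltW.
have mM : measurable [set w | (M ^+ 2)%:E <= `|(size_of_gap (eta k%:Z w) ^+ 2)%:E|]%E.
  under eq_set do rewrite absE lee_fin.
  rewrite -[X in measurable X]setTI; apply: (measurable_fun_ler (f := cst _)) => //.
  by apply: measurable_funX; exact: msz.
apply: le_measure; rewrite ?inE //.
- by rewrite -[X in measurable X]setTI; apply: (measurable_fun_ltr (f := cst M)).
- exact: measurableI.
- move=> w /= Mw; split => //; rewrite lee_fin ger0_norm ?sqr_ge0 //.
  by rewrite lerXn2r ?nnegrE // ltW.
Qed.

(** On the window [p - l > (x - x') * tau] and [l < 1], so the gaps are bounded by the inverse of
    [(x - x') * tau]; hence the factor [tau] in the exponent. *)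
Lemma high_windows (x' x e : R) : 0 < x' -> x' < x -> 0 < e ->
  exists2 tau0, 0 < tau0 & exists2 s0, 0 < s0 & forall (tau a : R) k, 0 < tau < tau0 ->
  (P [set w | (k%:R * (ustar + 2 * e) + a
      <= \sum_(j < k) window_gap (c + x' * tau) (c + x * tau) (rate j%:Z w))%R]
   <= (expR (- (s0 * (tau * a))))%:E)%E.
Proof.
move=> x'0 x'x e0; have [tau1 tau10 H] := integral_high_gap c0 c1 ufin x'0 x'x e0.
have [delta /andP[d0 d1] d2] := small_delta (addr_ge0 ustar0 (ltW e0)) e0.
(* The bound [(1 - c) / x'] keeps the speed of the leader below 1. *)
exists (Num.min tau1 ((1 - c) / x')); first by rewrite lt_min tau10 divr_gt0 // subr_gt0.
exists (delta * (x - x')); first by rewrite mulr_gt0 // subr_gt0.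
move=> tau a k /andP[t0]; rewrite lt_min => /andP[t1 t2].
have l1 : c + x' * tau < 1.
  by rewrite -ltrBrDl mulrC -ltr_pdivlMr.
have M0 : 0 < (x - x') * tau by rewrite mulr_gt0 // subr_gt0.
have l0 : 0 < c + x' * tau by rewrite addr_gt0 // mulr_gt0.
have la : c + x' * tau < c + x * tau by rewrite ltrD2l ltr_pM2r.
have -> : delta * (x - x') * (tau * a) = delta / ((x - x') * tau)^-1 * a.
  by rewrite invrK; ring.
have -> : ustar + 2 * e = ustar + e + e by ring.
apply: (upper_deviation mrate (rates_independent tasep)) => //.
- by apply: measurable_window_gap; exact: ltW.
- by move=> p; apply: window_gap_ge0; exact: ltW.
- by rewrite invr_gt0.
- by rewrite addr_ge0 // ltW.
- move=> p; apply: le_trans (window_gap_le _ (ltW l0) la) _.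
  have -> : c + x * tau - (c + x' * tau) = (x - x') * tau by ring.
  by rewrite ler_piMl ?invr_ge0 // ltW.
- move=> i; rewrite rate_law; first by apply: H; rewrite t0.
  + by apply: measurable_window_gap; exact: ltW.
  + by move=> p; apply: window_gap_ge0; exact: ltW.
- by rewrite d0.
Qed.

Lemma low_windows (e : R) : 0 < e ->
  exists2 s0, 0 < s0 & forall (tau a : R) k, 0 < tau -> e * tau < c ->
  (P [set w | (k%:R * (ustar + e) + a
      <= \sum_(j < k) window_gap (c - e * tau) c (rate j%:Z w))%R]
   <= (expR (- (s0 * (tau * a))))%:E)%E.
Proof.
move=> e0.
have [delta /andP[d0 d1] d2] := small_delta ustar0 e0.
exists (delta * e); first by rewrite mulr_gt0.
move=> tau a k t0 etau.
have M0 : 0 < e * tau by rewrite mulr_gt0.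
have l0 : 0 <= c - e * tau < c by rewrite subr_ge0 ltW //= ltrBlDr ltrDl.
have /andP[l1 l2] := l0.
have -> : delta * e * (tau * a) = delta / (e * tau)^-1 * a.
  by rewrite invrK; ring.
apply: (upper_deviation mrate (rates_independent tasep)) => //.
- by apply: measurable_window_gap; exact: ltW.
- by move=> p; apply: window_gap_ge0 => //; exact: ltW.
- by rewrite invr_gt0.
- move=> p; apply: le_trans (window_gap_le _ l1 l2) _.
  have -> : c - (c - e * tau) = e * tau by ring.
  by rewrite ler_piMl ?invr_ge0 ?(ltW M0) // (le_trans (ltW l2)) // ltW.
- move=> i; rewrite rate_law; first exact: integral_low_gap.
  + by apply: measurable_window_gap; exact: ltW.
  + by move=> p; apply: window_gap_ge0 => //; exact: ltW.
- by rewrite d0.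
Qed.

Lemma capped_deviation (e : R) : 0 < e -> exists2 b, c < b < 1 & exists2 s0, 0 < s0 &
  forall (a : R) k,
  (P [set w | (\sum_(j < k) capped_gap c b (rate j%:Z w) <= k%:R * (ustar - 2 * e) - a)%R]
   <= (expR (- (s0 * a)))%:E)%E.
Proof.
move=> e0; have [b [/andP[cb b1] _ Hb]] := mean_gap_truncation c0 c1 ufin e0.
exists b; first by rewrite cb.
have W0 : 0 < (c / (b - c)) ^+ 2 by rewrite exprn_gt0 // divr_gt0 // subr_gt0.
exists (e / (c / (b - c)) ^+ 2); first by rewrite divr_gt0.
move=> a k; have -> : ustar - 2 * e = ustar - e - e by ring.
apply: (lower_deviation mrate (rates_independent tasep) _ _ (W := (c / (b - c)) ^+ 2)) => //.
- exact: measurable_capped_gap.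
- by move=> p; exact: capped_gap_ge0.
- move=> i; rewrite rate_law.
  + exact: le_trans Hb (integral_capped_gap F c0 cb).
  + exact: measurable_capped_gap.
  + by move=> p; exact: capped_gap_ge0.
- move=> i; apply: (@le_trans _ _ (\int[P]_w ((c / (b - c)) ^+ 2)%:E)%E).
    apply: ge0_le_integral => //.
    + by move=> w _; rewrite lee_fin sqr_ge0.
    + by apply/measurable_EFinP; apply: measurable_funX;
        apply: measurableT_comp => //; exact: measurable_capped_gap.
    + by move=> w _; rewrite lee_fin lerXn2r ?nnegrE ?capped_gap_ge0 ?capped_gap_le //
        divr_ge0 ?subr_ge0 // ltW.
  rewrite le_eqVlt; apply/orP; left; apply/eqP.
  apply: etrans (integral_cst P measurableT _) _; rewrite -[RHS]mule1; congr (_ * _)%E.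
  exact: probability_setT.
- by rewrite divr_gt0.
- by rewrite divfK // gt_eqF.
Qed.

Lemma measurable_exists (n : nat) (B : nat -> set T) : (forall k, measurable (B k)) ->
  measurable [set w | exists2 k, (k < n)%N & B k w].
Proof.
move=> mB; rewrite (_ : [set w | _] = \bigcup_(k in [set k | (k < n)%N]) B k).
  by apply: bigcup_measurable => k _.
by apply/seteqP; split => w /=.
Qed.

Lemma prob_exists_le (n : nat) (B : nat -> set T) (b : R) : (forall k, measurable (B k)) ->
  (forall k, (k < n)%N -> (P (B k) <= b%:E)%E) ->
  (P [set w | exists2 k, (k < n)%N & B k w] <= (n%:R * b)%:E)%E.
Proof.
move=> mB Bb; rewrite (_ : [set w | _] = \big[setU/set0]_(k < n) B k).
  apply: le_trans (prob_bigsetU_le P _ _ _) _ => //.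
  apply: (@le_trans _ _ (\sum_(k < n) b%:E)%E); first by apply: lee_sum => k _; exact: Bb.
  by rewrite sumEFin lee_fin sumr_const card_ord mulr_natl.
by rewrite -bigcup_mkord; apply/seteqP; split => w /=.
Qed.

Lemma total_gap_size w k : (forall i, 0 <= eta i w) ->
  (total_gap sigma w k)%:~R = \sum_(j < k) size_of_gap (eta j%:Z w) :> R.
Proof.
move=> eta0; rewrite /total_gap rmorph_sum /=; apply: eq_bigr => j _.
by rewrite /size_of_gap max_l // ler0z eta0.
Qed.

Let measurable_sum_rates (psi : R -> R) k (B : set R) : measurable_fun setT psi ->
  measurable B -> measurable [set w | B (\sum_(i < k) psi (rate i%:Z w))].
Proof.
move=> mpsi mB; apply: (sigma_rates_measurable (rate := rate)).
exact: (@sigma_rates_sum _ _ _ P rate psi k B mpsi mB).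
Qed.

Let measurable_sum_gaps (psi : int -> R) k (B : set R) :
  measurable B -> measurable [set w | B (\sum_(i < k) psi (eta i%:Z w))].
Proof.
move=> mB; rewrite -[X in measurable X]setTI.
have : measurable_fun setT (fun w => \sum_(i < k) psi (eta i%:Z w)).
  by apply: measurable_sum => i; exact: (measurableT_comp (measurable_int_fun psi) (meta i%:Z)).
by move=> /(_ measurableT _ mB).
Qed.

Let measurable_ray (P0 : R -> bool) (I0 : interval R) : (forall v, P0 v = (v \in I0)) ->
  measurable [set v | P0 v].
Proof.
move=> H; rewrite (_ : [set v | P0 v] = [set` I0]) //.
by apply/seteqP; split => v /=; rewrite H.
Qed.

Let measurable_le r : measurable [set v : R | v <= r].
Proof. by apply: (@measurable_ray _ `]-oo, r]) => v; rewrite in_itv. Qed.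
Let measurable_lt r : measurable [set v : R | v < r].
Proof. by apply: (@measurable_ray _ `]-oo, r[) => v; rewrite in_itv. Qed.
Let measurable_ge r : measurable [set v : R | r <= v].
Proof. by apply: (@measurable_ray _ `[r, +oo[) => v; rewrite in_itv /= andbT. Qed.
Let measurable_gt r : measurable [set v : R | r < v].
Proof. by apply: (@measurable_ray _ `]r, +oo[) => v; rewrite in_itv /= andbT. Qed.
Let measurable_supp : measurable [set v : R | c < v <= 1].
Proof. by apply: (@measurable_ray _ `]c, 1]) => v; rewrite in_itv. Qed.

Let measurable_position t (Q : int -> Prop) : 0 <= t -> measurable [set w | Q (sigma 0 t w)].
Proof.
move=> t0; have H := positions_measurable tasep 0 t0.
by rewrite -[X in measurable X]setTI; exact: (H measurableT [set z | Q z] I).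
Qed.

Section Lower.
Variables (z x y : R).
Hypotheses (z0 : 0 < z) (zx : z < x) (y0 : 0 < y) (U0 : ustar < u) (zyU : z < y * (u - ustar)).

Lemma position_lower_tail : exists2 tau0, 0 < tau0 & exists2 C, 0 < C & exists2 c2, 0 < c2 &
  forall (t tau Lam : R) (K : nat), 1 <= t -> 0 < tau < tau0 -> t * tau = Lam ->
  y * Lam <= K%:R ->
  (P [set w | ((sigma 0 t w)%:~R <= c * t + z * Lam)%R]
   <= P [set w | exists2 i, (i < K)%N & (rate i%:Z w <= c + x * tau)%R]
      + (C * t * expR (- (c2 * (tau * Lam))))%:E)%E.
Proof.
have [e [e0 ex eyU eU]] : exists e, [/\ 0 < e, z + 3 * e < x,
    z + 4 * e <= y * (u - ustar - 2 * e) & 3 * e <= u - ustar].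
  (* A single [e] that stays within the slack of each of the strict inequalities [zx], [zyU] and
     [U0]. *)
  exists (Num.min ((x - z) / 4) (Num.min ((y * (u - ustar) - z) / (4 + 2 * y)) ((u - ustar) / 3))).
  set e := Num.min _ _.
  have e1 : e <= (x - z) / 4 by rewrite ge_min lexx.
  have e2 : e <= (y * (u - ustar) - z) / (4 + 2 * y) by rewrite !ge_min lexx orbT.
  have e3 : e <= (u - ustar) / 3 by rewrite !ge_min lexx !orbT.
  split.
  - by rewrite !lt_min !divr_gt0 ?subr_gt0 // addr_gt0 // mulr_gt0.
  - by move: zx e1; lra.
  - by move: e2; rewrite ler_pdivlMr ?addr_gt0 ?mulr_gt0 //; lra.
  - by move: e3; lra.
have [s0 s00 H0] := few_gaps e0.
have x'0 : 0 < z + 3 * e by rewrite addr_gt0 // mulr_gt0.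
have [tau1 tau10 [s1 s10 H1]] := high_windows x'0 ex e0.
have [s2 s20 H2] := low_windows e0.
have C10 : 0 < c + z + e by rewrite !addr_gt0.
have c30 : 0 < e ^+ 2 / (8 * (c + z + e)) by rewrite divr_gt0 ?exprn_gt0 // mulr_gt0.
exists (Num.min 1 (Num.min tau1 (c / e))); first by rewrite !lt_min ltr01 tau10 divr_gt0.
(* The error terms add up to [4 * n + 1] times one exponential, with
   [n <= (c + z + e) * t / (2 * e) + 1]. *)
exists (4 * ((c + z + e) / (2 * e) + 2)).
  by rewrite mulr_gt0 // addr_gt0 // divr_gt0 // mulr_gt0.
have [c2 c20 [c2a c2b c2c c2d]] : exists2 c2, 0 < c2 & [/\ c2 <= s0 * e, c2 <= s1 * e,
    c2 <= s2 * e & c2 <= e ^+ 2 / (8 * (c + z + e))].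
  exists (Num.min (s0 * e) (Num.min (s1 * e) (Num.min (s2 * e) (e ^+ 2 / (8 * (c + z + e)))))).
    by rewrite !lt_min c30 (mulr_gt0 s00 e0) (mulr_gt0 s10 e0) (mulr_gt0 s20 e0).
  by split; rewrite !ge_min lexx ?orbT.
exists c2 => // t tau Lam K t1 /andP[tau0]; rewrite !lt_min => /and3P[tau1' tau2 tau3] tL yK.
have t0 : 0 < t by rewrite (lt_le_trans ltr01).
have Lam0 : 0 < Lam by rewrite -tL mulr_gt0.
have Lamt : Lam <= t by rewrite -tL ler_piMr // ltW.
have tauLam : tau * Lam <= Lam by rewrite ler_piMl // ltW.
have tauLam0 : 0 < tau * Lam by rewrite mulr_gt0.
(* With typical gaps [total_gap] at this n exceeds [2 * e * n - e * Lam], hence [c * t + z * Lam],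
   which rules out the second alternative of [position_ge_displacement]. *)
pose n := (Num.truncn ((c + z + e) * t / (2 * e))).+1.
have nt : (c + z + e) * t < n%:R * (2 * e).
  rewrite -ltr_pdivrMr ?mulr_gt0 //.
  by rewrite /n; apply: truncnS_gt.
have etau : e * tau < c by rewrite mulrC -ltr_pdivlMr.
pose E := [set w | ((sigma 0 t w)%:~R <= c * t + z * Lam)%R].
pose BI k := [set w | (\sum_(j < k) size_of_gap (eta j%:Z w) <= k%:R * (u - e) - e * Lam)%R].
pose B1 k := [set w | (k%:R * (ustar + 2 * e) + e * Lam
   <= \sum_(j < k) window_gap (c + (z + 3 * e) * tau) (c + x * tau) (rate j%:Z w))%R].
pose B2 k := [set w | (k%:R * (ustar + e) + e * Lam
   <= \sum_(j < k) window_gap (c - e * tau) c (rate j%:Z w))%R].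
pose A0 := [set w | forall i, [set: nat] i -> c < rate i%:Z w <= 1].
pose A1 := [set w | forall i, [set i | (i < K)%N] i -> c + x * tau < rate i%:Z w].
pose A2 := [set w | forall k, [set k | (k < n)%N] k ->
  (\sum_(j < k) window_gap (c + (z + 3 * e) * tau) (c + x * tau) (rate j%:Z w)
    < k%:R * (ustar + 2 * e) + e * Lam)%R].
pose A3 := [set w | forall k, [set k | (k < n)%N] k ->
  (\sum_(j < k) window_gap (c - e * tau) c (rate j%:Z w) < k%:R * (ustar + e) + e * Lam)%R].
have mw1 : measurable_fun setT (window_gap (c + (z + 3 * e) * tau) (c + x * tau)).
  by apply: measurable_window_gap; rewrite lerD2l ler_pM2r // ltW.
have mw2 : measurable_fun setT (window_gap (c - e * tau) c).
  by apply: measurable_window_gap; rewrite gerBl ltW // mulr_gt0.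
have mE : measurable E by apply: (measurable_position (fun v => v%:~R <= c * t + z * Lam)); exact: ltW.
have mBI k : measurable (BI k).
  by apply: (@measurable_sum_gaps (@size_of_gap R) k [set v | v <= k%:R * (u - e) - e * Lam] (measurable_le _)).
have mB1 k : measurable (B1 k).
  exact: (@measurable_sum_rates _ k [set v | k%:R * (ustar + 2 * e) + e * Lam <= v] mw1 (measurable_ge _)).
have mB2 k : measurable (B2 k).
  exact: (@measurable_sum_rates _ k [set v | k%:R * (ustar + e) + e * Lam <= v] mw2 (measurable_ge _)).
(* The rates enter through [A] and the gaps through [E']: [clock_event_bound] conditions on rates
   alone and accepts any measurable [E'], whatever its dependence on the clocks. *)
pose E' := E `&` ~` [set w | exists2 k, (k < n.+1)%N & BI k w].
pose A := A0 `&` A1 `&` (A2 `&` A3).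
have mE' : measurable E'.
  by apply: measurableI => //; apply: measurableC; exact: measurable_exists.
have sA : sigma_rates rate A.
  apply: sigma_ratesI; apply: sigma_ratesI; apply: sigma_rates_forall => i _.
  - exact: (@sigma_rates_preimage _ _ _ P rate i%:Z [set v | c < v <= 1] measurable_supp).
  - exact: (@sigma_rates_preimage _ _ _ P rate i%:Z [set v | c + x * tau < v] (measurable_gt _)).
  - exact: (@sigma_rates_sum _ _ _ P rate _ i [set v | v < i%:R * (ustar + 2 * e) + e * Lam] mw1 (measurable_lt _)).
  - exact: (@sigma_rates_sum _ _ _ P rate _ i [set v | v < i%:R * (ustar + e) + e * Lam] mw2 (measurable_lt _)).
have main : (P (A `&` E') <= (n%:R * expR (- (c2 * (tau * Lam))))%:E)%E.
  apply: (@clock_event_bound _ _ _ P rate N (clocks_measurable tasep) (clocks_poisson tasep)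
    n.+1 A sA _ E' (@slow_pattern R c u e z t Lam n) t _ 0%N mE' t0) => //.
  - move=> w [[w0 _] _] i _; have /andP[cp ->] := w0 i I.
    by rewrite (lt_trans c0).
  - move=> m; move: good_paths; apply: filterS => w [clockP xP s00w rates01] o ow [Ew nBI].
    have h0 : 0 < t / m.+1%:R by rewrite divr_gt0.
    have to : t / m.+1%:R * (size o)%:R = t by rewrite size_tuple divfK.
    have eta0 := initial_gap_ge0 xP.
    have Hk k : (k < n.+1)%N -> k%:R * (u - e) - e * Lam < (total_gap sigma w k)%:~R.
      move=> kn; rewrite total_gap_size // ltNge; apply/negP => BIk.
      by apply: nBI; exists k.
    have := position_ge_displacement clockP xP s00w h0 ow; rewrite to.
    case=> [[k kn Dk]|Hn].
      apply/existsP; exists (Ordinal kn) => /=.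
      have := Hk k (ltnW kn); move: Dk; rewrite -(ler_int R) rmorphD /=.
      by move: Ew; rewrite /E /=; lra.
    exfalso; have := Hk n (leqnn _); move: Hn; rewrite -(ler_int R).
    move: Ew; rewrite /E /= => Ew Hn Hn'.
    have : n%:R * (2 * e) <= n%:R * (u - e) by rewrite ler_wpM2l //; move: eU ustar0; lra.
    have : (z + e) * Lam <= (z + e) * t by rewrite ler_wpM2l // addr_ge0 // ltW.
    lra.
  - move=> m w _ [[w0 w1] [w2 w3]].
    apply: le_trans (quenched_slow (ustar := ustar) (x := x) (y := y) (K := K) (tau := tau) (p := fun i => rate i%:Z w)
       c0 t0 tau0 (ltW tau1') tL e0 z0 _ _ _ _ _ _ _ _ _ _ _) _ => //.
    + by move=> i; exact: w0.
    + by move=> k kn; apply: ltW; exact: w2.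
    + by move=> k kn; apply: ltW; exact: w3.
    + by rewrite ler_wpM2l // ler_expR lerN2 ler_wpM2r // ltW.
have mA := sigma_rates_measurable sA.
have mS i : measurable [set w | (rate i%:Z w <= c + x * tau)%R].
  apply: (@sigma_rates_measurable _ _ _ P rate).
  exact: (@sigma_rates_preimage _ _ _ P rate i%:Z _ (measurable_le (c + x * tau))).
have mAE : measurable (A `&` E') by exact: measurableI.
have mSlow := measurable_exists K mS.
have mXI := measurable_exists n.+1 mBI.
have mX1 := measurable_exists n mB1.
have mX2 := measurable_exists n mB2.
set b0 := expR (- (c2 * (tau * Lam))) in main *.
have small s' : c2 <= s' * e -> expR (- (s' * (tau * (e * Lam)))) <= b0.
  move=> c2s; rewrite /b0 ler_expR lerN2.
  have -> : s' * (tau * (e * Lam)) = s' * e * (tau * Lam) by ring.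
  by rewrite ler_wpM2r // ltW.
have pI : (P [set w | exists2 k, (k < n.+1)%N & BI k w] <= (n.+1%:R * b0)%:E)%E.
  apply: prob_exists_le => // k _; apply: le_trans (H0 _ _) _; rewrite lee_fin.
  apply: le_trans (small _ c2a); rewrite ler_expR lerN2 ler_wpM2l ?(ltW s00) //.
  by rewrite ler_piMl ?mulr_ge0 // ltW.
have p1 : (P [set w | exists2 k, (k < n)%N & B1 k w] <= (n%:R * b0)%:E)%E.
  apply: prob_exists_le => // k _; apply: le_trans (H1 _ _ _ _) _; first by rewrite tau0.
  by rewrite lee_fin; exact: small.
have p2 : (P [set w | exists2 k, (k < n)%N & B2 k w] <= (n%:R * b0)%:E)%E.
  apply: prob_exists_le => // k _; apply: le_trans (H2 _ _ _ tau0 etau) _.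
  by rewrite lee_fin; exact: small.
apply: (@le_trans _ _ (P ([set w | exists2 i, (i < K)%N & (rate i%:Z w <= c + x * tau)%R] `|`
   ((A `&` E') `|` ([set w | exists2 k, (k < n.+1)%N & BI k w] `|`
   ([set w | exists2 k, (k < n)%N & B1 k w] `|` [set w | exists2 k, (k < n)%N & B2 k w])))))).
  apply: le_prob_ae => //; first by do ! apply: measurableU.
  move: good_paths; apply: filterS => w [_ _ _ rates01] Ew.
  have [|nS] := pselect (exists2 i, (i < K)%N & rate i%:Z w <= c + x * tau); first by left.
  have [|nI] := pselect (exists2 k, (k < n.+1)%N & BI k w); first by right; right; left.
  have [|n1] := pselect (exists2 k, (k < n)%N & B1 k w); first by right; right; right; left.
  have [|n2] := pselect (exists2 k, (k < n)%N & B2 k w); first by right; right; right; right.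
  right; left; split; last by split.
  split; split=> i /= iK; rewrite ?rates01 // ltNge; apply/negP => H.
  - by apply: nS; exists i.
  - by apply: n1; exists i.
  - by apply: n2; exists i.
apply: le_trans (measureU2 _ _ _) _ => //; first by do ! apply: measurableU.
rewrite leeD2l //.
apply: (@le_trans _ _ ((n%:R * b0)%:E + ((n.+1%:R * b0)%:E + ((n%:R * b0)%:E + (n%:R * b0)%:E)))%E).
  apply: le_trans (measureU2 _ _ _) _ => //; first by do ! apply: measurableU.
  apply: leeD => //; apply: le_trans (measureU2 _ _ _) _ => //; first by apply: measurableU.
  by apply: leeD => //; apply: le_trans (measureU2 _ _ _) _ => //; exact: leeD.
rewrite -!EFinD lee_fin -!mulrDl ler_wpM2r ?expR_ge0 //.
have nle : n%:R <= (c + z + e) * t / (2 * e) + 1.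
  rewrite /n -natr1 lerD2r; rewrite truncn_le.
  by rewrite divr_ge0 ?mulr_ge0 // ltW.
have -> : (c + z + e) / (2 * e) = (c + z + e) * t / (2 * e) / t.
  by field; rewrite !gt_eqF.
have -> : n.+1%:R = n%:R + 1 :> R by rewrite natr1.
have -> : 4 * ((c + z + e) * t / (2 * e) / t + 2) * t
    = 4 * ((c + z + e) * t / (2 * e)) + 8 * t.
  by field; rewrite !gt_eqF.
have arith (X Y v : R) : X <= Y + 1 -> 1 <= v -> X + (X + 1 + (X + X)) <= 4 * Y + 8 * v by lra.
exact: arith.
Qed.

End Lower.

Section Upper.
Variables (z x y : R).
Hypotheses (z0 : 0 < z) (x0 : 0 < x) (y0 : 0 < y) (U0 : ustar < u)
  (xyz : x + y * (u - ustar) < z).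

(** The rates are tested from index 1 on, because the comparison with a slow leader involves the
    particle just behind it. *)
Lemma position_upper_tail : exists2 tau0, 0 < tau0 & exists2 c2, 0 < c2 &
  exists2 s3, 0 < s3 & exists2 W, 0 < W &
  forall (t tau Lam M : R) (K : nat), 1 <= Lam -> 0 < tau < tau0 -> t * tau = Lam ->
  K%:R <= y * Lam -> 0 < M ->
  (P [set w | (c * t + z * Lam < (sigma 0 t w)%:~R)%R]
   <= P [set w | forall i, (i < K)%N -> (c + x * tau < rate i.+1%:Z w)%R]
      + (K%:R * (3 * expR (- (c2 * (tau * Lam))) + expR (- (s3 / M * Lam)) + W / M ^+ 2))%:E)%E.
Proof.
have [e [e0 exyz]] : exists e, 0 < e /\ x + y * (u - ustar) + e * (3 + 3 * y) <= z.
  have y3 : 0 < 3 + 3 * y by rewrite addr_gt0 // mulr_gt0.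
  exists ((z - (x + y * (u - ustar))) / (3 + 3 * y)); split; first by rewrite divr_gt0 // subr_gt0.
  by rewrite divfK ?gt_eqF //; lra.
have [W W0 [s3 s30 H3]] := many_gaps e0.
have [b /andP[cb b1] [s1 s10 H1]] := capped_deviation e0.
have b0 : 0 < b by rewrite (lt_trans c0).
have bc : 0 < b - c by rewrite subr_gt0.
have C10 : 0 < c + z + e by rewrite !addr_gt0.
have c30 : 0 < e ^+ 2 / (8 * (c + z + e)) by rewrite divr_gt0 ?exprn_gt0 // mulr_gt0.
(* This [s2] gives [(1 + 2 * s2) * c <= c + (b - c) / 4] and leaves [g = b * (1 - s2)] above c. *)
have [s2 s20 s2E] : exists2 s2, 0 < s2 & s2 * b = (b - c) / 8.
  by exists ((b - c) / 8 / b); [rewrite !divr_gt0|rewrite divfK // gt_eqF].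
have s21 : s2 <= 2^-1.
  by rewrite -(ler_pM2r b0) s2E; move: c0 b0; lra.
have [g g0 gE] : exists2 g, 0 < g & g = b * (1 - s2).
  by exists (b * (1 - s2)) => //; rewrite mulr_gt0 // subr_gt0; move: s21; lra.
have gE' : g = b - (b - c) / 8 by rewrite gE mulrBr mulr1 [b * s2]mulrC s2E.
(* [rho * g] is the midpoint of c and g; for small [tau] the product [(1 + s) * (c + x * tau)], with
   s of order [tau], stays below it. *)
have [rho rhoE] : exists rho, rho * g = (g + c) / 2.
  by exists ((g + c) / 2 / g); rewrite divfK // gt_eqF.
have rho1 : rho < 1 by rewrite -(ltr_pM2r g0) rhoE; move: gE' cb; lra.
have [kap kapE] : exists kap,
  kap = s2 * ((b + c) / 2 / (b - (b + c) / 2)) + ln ((1 - rho)^-1) by eexists.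
(* For [tau <= 1], [D * tau] bounds the excess over c of [(1 + e * tau / (4 * (c + z + e))) * (c + x
   * tau)]. *)
have [D D0 DE] : exists2 D, 0 < D & D = x + e / (4 * (c + z + e)) * (c + x).
  exists (x + e / (4 * (c + z + e)) * (c + x)) => //.
  by rewrite addr_gt0 // mulr_gt0 ?divr_gt0 ?mulr_gt0 // addr_gt0.
have [Q [Q0 QE]] : exists Q, 0 < Q /\ s2 * (2 * (z + 1)) + kap * y <= Q.
  exists (`|s2 * (2 * (z + 1)) + kap * y| + 1); split; first by rewrite ltr_wpDl.
  by rewrite ler_wpDr // ler_norm.
have ye0 : 0 < y * (u + e) + e.
  by rewrite addr_gt0 // mulr_gt0 // addr_gt0 // (le_lt_trans ustar0).
have s8 : 0 < s2 * ((b - c) / 8) by rewrite mulr_gt0 // divr_gt0.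
(* In order, these bounds serve [tau <= 1], [c + x * tau < b], the ratio condition [tr], the
   condition [big], and the nonnegativity of the threshold. *)
exists (Num.min 1 (Num.min ((b - c) / x) (Num.min ((b - c) / 4 / D)
   (Num.min (s2 * ((b - c) / 8) / Q) (c / (y * (u + e) + e)))))).
  by rewrite !lt_min ltr01 !divr_gt0.
have [c2 c20 [c2a c2b c2c]] : exists2 c2, 0 < c2 & [/\ c2 <= s1 * e,
    c2 <= s2 * ((b - c) / 8) & c2 <= e ^+ 2 / (8 * (c + z + e))].
  exists (Num.min (s1 * e) (Num.min (s2 * ((b - c) / 8)) (e ^+ 2 / (8 * (c + z + e))))).
    by rewrite !lt_min c30 s8 (mulr_gt0 s10 e0).
  by split; rewrite !ge_min lexx ?orbT.
exists c2 => //; exists (s3 * e); first exact: mulr_gt0.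
exists W => // t tau Lam M K Lam1 /andP[tau0]; rewrite !lt_min.
move=> /and5P[tau1 tau2 tau3 tau4 tau5] tL Ky M0.
have Lam0 : 0 < Lam by rewrite (lt_le_trans ltr01).
have t0 : 0 < t by rewrite -(pmulr_lgt0 _ tau0) tL.
have Lamt : Lam <= t by rewrite -tL ler_piMr // ltW.
have tauLam : tau * Lam <= Lam by rewrite ler_piMl // ltW.
have tauLam0 : 0 < tau * Lam by rewrite mulr_gt0.
have xb : c + x * tau < b by rewrite -ltrBrDl mulrC -ltr_pdivlMr.
have tau3' : tau * D <= (b - c) / 4 by rewrite -ler_pdivlMr // ltW.
have tau4' : tau * Q <= s2 * ((b - c) / 8) by rewrite -ler_pdivlMr // ltW.
have tau5' : (y * (u + e) + e) * tau <= c by rewrite mulrC -ler_pdivlMr // ltW.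
pose E := [set w | (c * t + z * Lam < (sigma 0 t w)%:~R)%R].
pose BI k := [set w | (k.+1%:R * (u + e) + e * Lam
   <= \sum_(j < k.+1) Num.min (size_of_gap (eta j%:Z w)) M)%R].
pose BM k := [set w | (M < size_of_gap (eta k%:Z w))%R].
pose BC k := [set w | (\sum_(j < k.+1) capped_gap c b (rate j%:Z w)
   <= k.+1%:R * (ustar - 2 * e) - e * Lam)%R].
pose fast := [set w | forall i, [set i | (i < K)%N] i -> c + x * tau < rate i.+1%:Z w].
pose A0 := [set w | forall i, [set: nat] i -> c < rate i%:Z w <= 1].
pose A k := A0 `&` ([set w | (rate k.+1%:Z w <= c + x * tau)%R]
   `&` [set w | (k.+1%:R * (ustar - 2 * e) - e * Lam
     < \sum_(j < k.+1) capped_gap c b (rate j%:Z w))%R]).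
have mcap : measurable_fun setT (capped_gap c b) by exact: measurable_capped_gap.
have mE : measurable E.
  by apply: (measurable_position (fun v => c * t + z * Lam < v%:~R)); exact: ltW.
have mBI k : measurable (BI k).
  exact: (@measurable_sum_gaps (fun v => Num.min (size_of_gap v) M) k.+1
    [set v | k.+1%:R * (u + e) + e * Lam <= v] (measurable_ge _)).
have mBM k : measurable (BM k).
  rewrite -[X in measurable X]setTI.
  by have H := meta k%:Z; exact: (H measurableT [set v | M < size_of_gap v] I).
have mBC k : measurable (BC k).
  exact: (@measurable_sum_rates _ k.+1 [set v | v <= k.+1%:R * (ustar - 2 * e) - e * Lam]
    mcap (measurable_le _)).
have sA k : sigma_rates rate (A k).
  apply: sigma_ratesI; last apply: sigma_ratesI.
  - apply: sigma_rates_forall => i _.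
    exact: (@sigma_rates_preimage _ _ _ P rate i%:Z [set v | c < v <= 1] measurable_supp).
  - exact: (@sigma_rates_preimage _ _ _ P rate k.+1%:Z _ (measurable_le (c + x * tau))).
  - exact: (@sigma_rates_sum _ _ _ P rate _ k.+1 _ mcap (measurable_gt _)).
have mA k : measurable (A k) by exact: sigma_rates_measurable (sA k).
have mfast : measurable fast.
  apply: (@sigma_rates_measurable _ _ _ P rate); apply: sigma_rates_forall => i _.
  exact: (@sigma_rates_preimage _ _ _ P rate i.+1%:Z _ (measurable_gt (c + x * tau))).
have mXI := measurable_exists K mBI.
have mXM := measurable_exists K mBM.
have mXC := measurable_exists K mBC.
pose E' := E `&` ~` ([set w | exists2 k, (k < K)%N & BI k w]
   `|` [set w | exists2 k, (k < K)%N & BM k w]).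
have mE' : measurable E'.
  by apply: measurableI => //; apply: measurableC; exact: measurableU.
set q := expR (- (c2 * (tau * Lam))).
have u0 : 0 < u - ustar by rewrite subr_gt0.
have s2b : 0 < s2 <= 2^-1 by rewrite s20.
have s2c : (1 + 2 * s2) * c <= c + (b - c) / 4.
  have : s2 * c <= s2 * b by rewrite ler_pM2l // ltW.
  by rewrite s2E; lra.
have tr : (1 + e * tau / (4 * (c + z + e))) / (1 - s2) * ((c + x * tau) / b) <= rho.
  have ->: (1 + e * tau / (4 * (c + z + e))) / (1 - s2) * ((c + x * tau) / b)
      = (1 + e * tau / (4 * (c + z + e))) * (c + x * tau) / g.
    rewrite gE; field; rewrite !gt_eqF //=; last by move: s21; lra.
  rewrite ler_pdivrMr // rhoE gE'; move: tau3' DE.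
  have -> : e * tau / (4 * (c + z + e)) = e / (4 * (c + z + e)) * tau by rewrite mulrAC.
  have : 0 < e / (4 * (c + z + e)) by rewrite divr_gt0 // mulr_gt0.
  generalize (e / (4 * (c + z + e))) => r r0 tD DE.
  have : 0 <= r * tau * (x * (1 - tau)).
    by rewrite mulr_ge0 ?mulr_ge0 ?subr_ge0 // ltW.
  by move: tD; rewrite DE; move: bc; lra.
have big : s2 * (2 * (z * Lam + 1)) + kap * (y * Lam) <= s2 * ((b - c) / 8) * t.
  apply: (@le_trans _ _ (Q * Lam)); last first.
    have -> : Q * Lam = t * (tau * Q) by rewrite -tL; ring.
    by rewrite [leRHS]mulrC ler_pM2l.
  apply: (@le_trans _ _ ((s2 * (2 * (z + 1)) + kap * y) * Lam)); last by rewrite ler_pM2r.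
  have : s2 * 1 <= s2 * Lam by rewrite ler_pM2l.
  by move: s20; lra.
have main k : (k < K)%N -> (P (A k `&` E') <= (2 * q)%:E)%E.
  move=> kK.
  (* Leaders go up to K and the particle ahead of the leader is observed too, hence [K.+2] clocks.
     The minimal number of steps ensures [h * (b *+ K.+2) <= 1]. *)
  apply: (@clock_event_bound _ _ _ P rate N (clocks_measurable tasep) (clocks_poisson tasep)
    K.+2 (A k) (sA k) _ E' (fun o => c * t + z * Lam - k.+1%:R * (u + e) - e * Lam
      <= (displacement k.+1 o)%:~R) t _ (Num.truncn (t * (b *+ K.+2))) mE' t0) => //.
  - move=> w [w0 _] i _; have /andP[cp ->] := w0 i I.
    by rewrite (lt_trans c0).
  - move=> m; move: good_paths; apply: filterS => w [clockP xP s00w rates01] o ow [Ew nB].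
    have h0 : 0 < t / m.+1%:R by rewrite divr_gt0.
    have to : t / m.+1%:R * (size o)%:R = t by rewrite size_tuple divfK.
    have eta0 := initial_gap_ge0 xP.
    have := position_le_displacement clockP xP s00w h0 ow (k := k.+1); rewrite to => /(_ kK).
    rewrite -(ler_int R) rmorphD /= total_gap_size // => Dk.
    have Hk : \sum_(j < k.+1) size_of_gap (eta j%:Z w) < k.+1%:R * (u + e) + e * Lam.
      rewrite ltNge; apply/negP => BIk; apply: (nB); left; exists k => //.
      rewrite /BI /=; apply: le_trans BIk _; rewrite le_eqVlt; apply/orP; left; apply/eqP.
      apply: eq_bigr => j _; rewrite min_l // leNgt; apply/negP => Mj.
      by apply: nB; right; exists j => //; exact: leq_trans (ltn_ord j) kK.
    by move: Ew; rewrite /E /=; lra.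
  - move=> m w mm [w0 [wk wC]].
    have p01 i : c < rate i%:Z w <= 1 by exact: w0.
    have ky : k.+1%:R <= y * Lam by apply: le_trans Ky; rewrite ler_nat.
    have hb : t / m.+1%:R * (b *+ K.+2) <= 1.
      rewrite mulrAC ler_pdivrMr // mul1r ltW // (lt_le_trans (truncnS_gt _)) //.
      by rewrite ler_nat ltnS.
    apply: le_trans (quenched_fast (p := fun i => rate i%:Z w) c0 t0 tau0 (ltW tau1) tL e0 z0 p01
       cb x0 (ltn0Sn k) (n := K.+2) (leqW kK) ky u0 exyz tau5' xb wk ustar0 s2b rho1 s2c tr
       kapE big (ltW wC) hb) _.
    have -> : 2 * q = q + q by ring.
    apply: lerD.
      by rewrite /q ler_expR lerN2 ler_wpM2r // ltW.
    rewrite /q ler_expR lerN2; apply: ler_pM => //; try exact: ltW.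
    exact: le_trans tauLam Lamt.
  - by rewrite mulr_ge0 // expR_ge0.
have pI : (P [set w | exists2 k, (k < K)%N & BI k w] <= (K%:R * expR (- (s3 * e / M * Lam)))%:E)%E.
  apply: prob_exists_le; first exact: mBI.
  move=> k _; apply: le_trans (proj1 (H3 _ _ _ M0)) _.
  by rewrite lee_fin ler_expR lerN2 le_eqVlt; apply/orP; left; apply/eqP; ring.
have pM : (P [set w | exists2 k, (k < K)%N & BM k w] <= (K%:R * (W / M ^+ 2))%:E)%E.
  apply: prob_exists_le; first exact: mBM.
  by move=> k _; exact: (proj2 (H3 M 0 k M0)).
have pC : (P [set w | exists2 k, (k < K)%N & BC k w] <= (K%:R * q)%:E)%E.
  apply: prob_exists_le; first exact: mBC.
  move=> k _; apply: le_trans (H1 _ _) _.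
  rewrite lee_fin ler_expR lerN2 mulrA; apply: ler_pM => //; exact: ltW.
have mAE k : measurable (A k `&` E') by exact: measurableI.
have pA : (P [set w | exists2 k, (k < K)%N & (A k `&` E') w] <= (K%:R * (2 * q))%:E)%E.
  exact: prob_exists_le.
have mXA := measurable_exists K mAE.
apply: (@le_trans _ _ (P (fast `|` ([set w | exists2 k, (k < K)%N & (A k `&` E') w] `|`
   ([set w | exists2 k, (k < K)%N & BC k w] `|`
   ([set w | exists2 k, (k < K)%N & BI k w] `|` [set w | exists2 k, (k < K)%N & BM k w])))))).
  apply: le_prob_ae => //; first by do ! apply: measurableU.
  move: good_paths; apply: filterS => w [_ _ _ rates01] Ew.
  have [|nC] := pselect (exists2 k, (k < K)%N & BC k w); first by right; right; left.
  have [|nI] := pselect (exists2 k, (k < K)%N & BI k w); first by right; right; right; left.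
  have [|nM] := pselect (exists2 k, (k < K)%N & BM k w); first by right; right; right; right.
  have [nf|nf] := pselect (exists2 k, (k < K)%N & rate k.+1%:Z w <= c + x * tau).
    right; left; case: nf => k kK slow; exists k => //; split; last by split=> // -[].
    split; first by move=> i _; exact: rates01.
    by split=> //=; rewrite ltNge; apply/negP => H; apply: nC; exists k.
  by left => i iK; rewrite ltNge; apply/negP => H; apply: nf; exists i.
apply: le_trans (measureU2 _ _ _) _ => //; first by do ! apply: measurableU.
rewrite leeD2l //.
apply: (@le_trans _ _ ((K%:R * (2 * q))%:E + ((K%:R * q)%:E
   + ((K%:R * expR (- (s3 * e / M * Lam)))%:E + (K%:R * (W / M ^+ 2))%:E)))%E).
  apply: le_trans (measureU2 _ _ _) _ => //; first by do ! apply: measurableU.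
  apply: leeD => //; apply: le_trans (measureU2 _ _ _) _ => //; first by apply: measurableU.
  by apply: leeD => //; apply: le_trans (measureU2 _ _ _) _ => //; exact: leeD.
rewrite -!EFinD lee_fin le_eqVlt; apply/orP; left; apply/eqP; ring.
Qed.

End Upper.

Lemma prob_all_gt (f : nat -> int) K v : injective f ->
  (P [set w | forall i, (i < K)%N -> (v < rate (f i) w)%R] = ((1 - F v) ^+ K)%:E)%E.
Proof.
move=> injf; pose s := [seq f i | i <- iota 0 K].
have us : uniq s by rewrite map_inj_uniq // iota_uniq.
have Pgt i : P (rate i @^-1` [set p | v < p]) = (1 - F v)%:E.
  rewrite (_ : _ @^-1` _ = ~` [set w | rate i w <= v]); last first.
    by apply/seteqP; split => w /=; rewrite ltNge => /negP.
  have mle : measurable [set w | rate i w <= v].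
    rewrite (_ : [set w | _] = rate i @^-1` `]-oo, v]).
      by rewrite -[Y in measurable Y]setTI; exact: measurable_funP.
    by apply/seteqP; split => w /=; rewrite in_itv.
  by rewrite probability_setC // (prob_rate_le (rates_distribution tasep i)) EFinB.
have := rates_independent tasep (B := fun=> [set p | v < p]) us.
move=> H; transitivity (P (\bigcap_(i in [set` s]) rate i @^-1` [set p | v < p])).
  congr (P _); apply/seteqP; split => w /= Hw.
    by move=> _ /= /mapP[i iK ->]; apply: Hw; rewrite mem_iota add0n in iK.
  move=> i iK; apply: (Hw (f i)) => /=; apply/mapP; exists i => //.
  by rewrite mem_iota add0n.
rewrite H => [|i]; last first.
  exact: measurable_gt.
rewrite (eq_bigr (fun=> (1 - F v)%:E)); last by move=> i _; exact: Pgt.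
by rewrite prodEFin big_const_seq count_predT size_map size_iota iter_mulr_1.
Qed.

Hypotheses (nu kappa : R) (nu0 : 0 < nu) (kappa0 : 0 < kappa) (U0 : ustar < u)
  (Fkappa : (F p / (p - c) `^ (nu + 1)) @[p --> c^'+] --> kappa).


Let F0 p : 0 <= F p.
Proof. by have := prob_rate_le (rates_distribution tasep 0) p; rewrite -lee_fin => <-. Qed.

Let Lam t : R := t `^ (1 - alpha nu).
Let tau t : R := t `^ (- alpha nu).

Let scaled_position t z : 0 < t ->
  [set w | (z < ((sigma 0 t w)%:~R - c * t) / t `^ (1 - alpha nu))%R]
  = [set w | (c * t + z * Lam t < (sigma 0 t w)%:~R)%R].
Proof.
move=> t0; apply/seteqP; split => w /=;
by rewrite ltr_pdivlMr ?powR_gt0 // ltrBrDl.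
Qed.

Let tau_Lam t : 0 < t -> tau t * Lam t = t `^ (1 - 2 * alpha nu).
Proof.
move=> t0; rewrite -powRD; last by rewrite (lt0r_neq0 t0) implybT.
by congr (_ `^ _); ring.
Qed.

Let near_time tau0 : 0 < tau0 -> \forall t \near +oo,
  [/\ 1 <= t, 1 <= Lam t, 0 < tau t < tau0, t * tau t = Lam t & Lam t <= t].
Proof.
move=> tau00; have a0 := alpha_gt0 nu0; have a1 := alpha_lt_half nu0.
near=> t; have t1 : 1 <= t by near: t; exact: nbhs_pinfty_ge (num_real _).
have t0 : 0 < t by rewrite (lt_le_trans ltr01).
split => //.
- near: t; apply: powR_near_ge; lra.
- rewrite powR_gt0 //=; apply: (@le_lt_trans _ _ (tau0 / 2)); last lra.
  by near: t; apply: powR_near_le; rewrite ?divr_gt0.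
- exact: time_mul_tau.
- by apply: ler1_powR => //; lra.
Unshelve. all: by end_near. Qed.

Let scaled_tail_le z x y v e : 0 < z -> 0 < x -> 0 < y -> x + y * (u - ustar) < z ->
  v < y * (kappa * x `^ (nu + 1)) -> 0 < e ->
  \forall t \near +oo,
   (P [set w | (z < ((sigma 0 t w)%:~R - c * t) / t `^ (1 - alpha nu))%R]
    <= (expR (- v) + e)%:E)%E.
Proof.
move=> z0 x0 y0 xyz vy e0.
have [tau0 tau00 [c2 c20 [s3 s30 [W W0 H]]]] := position_upper_tail z0 x0 y0 U0 xyz.
have a0 := alpha_gt0 nu0; have a1 := alpha_lt_half nu0.
have b0 : 0 < 1 - 2 * alpha nu by lra.
have l0 : 0 < (1 - alpha nu) / 4 by lra.
have l1 : 0 < (1 - alpha nu) / 2 by lra.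
have yW : 0 < e / 3 / (y * W) by rewrite !divr_gt0 // mulr_gt0.
near=> t.
have [t1 L1 tau1 tL Lt] : [/\ 1 <= t, 1 <= Lam t, 0 < tau t < tau0, t * tau t = Lam t & Lam t <= t].
  by near: t; exact: near_time.
have t0 : 0 < t by rewrite (lt_le_trans ltr01).
have L0 : 0 < Lam t by rewrite (lt_le_trans ltr01).
have e1 : (3 * y) * t * expR (- (c2 * t `^ (1 - 2 * alpha nu))) <= e / 3.
  by near: t; apply: exp_decay; rewrite ?divr_gt0 // mulr_ge0 // ltW.
have e2 : y * t * expR (- (s3 * t `^ ((1 - alpha nu) / 4))) <= e / 3.
  by near: t; apply: exp_decay => //; [exact: ltW|rewrite divr_gt0].
have e3 : t `^ (- ((1 - alpha nu) / 2)) <= e / 3 / (y * W).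
  by near: t; exact: powR_near_le.
have vF : (1 - F (c + x * tau t)) ^+ Num.truncn (y * Lam t) <= expR (- v).
  by near: t; exact: (no_slow_rate_le nu0 F0 Fkappa).
(* The initial gaps are truncated at [Lam t `^ (3 / 4)]. *)
have M0 : 0 < t `^ ((1 - alpha nu) * (3 / 4)) by rewrite powR_gt0.
have Ky : (Num.truncn (y * Lam t))%:R <= y * Lam t.
  by rewrite truncn_le mulr_ge0 // ltW.
rewrite scaled_position //.
apply: le_trans (H t (tau t) (Lam t) _ _ L1 tau1 tL Ky M0) _.
rewrite (@prob_all_gt (fun i => i.+1%:Z)); last by move=> i j [].
rewrite -EFinD lee_fin lerD // tau_Lam //.
set M := t `^ ((1 - alpha nu) * (3 / 4)) in M0 *.
(* Any power strictly between 1/2 and 1 would do: [Lam t / M] must grow like a power of t, and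
   [Lam t / M ^+ 2], which bounds up to a constant the probability of a large gap, must vanish. *)
have LM : Lam t / M = t `^ ((1 - alpha nu) / 4).
  rewrite /M -powRN -powRD; last by rewrite (lt0r_neq0 t0) implybT.
  by congr (_ `^ _); field.
have LM2 : Lam t / M ^+ 2 = t `^ (- ((1 - alpha nu) / 2)).
  rewrite /M -powR_mulrn ?powR_ge0 // -powRrM -powRN -powRD; last by rewrite (lt0r_neq0 t0) implybT.
  by congr (_ `^ _); field.
have -> : s3 / M * Lam t = s3 * t `^ ((1 - alpha nu) / 4) by rewrite -LM; ring.
move: e1 e2 e3; set q1 := expR _; set q2 := expR _ => e1 e2 e3.
have q10 : 0 <= q1 by exact: expR_ge0.
have q20 : 0 <= q2 by exact: expR_ge0.
have WM0 : 0 <= W / M ^+ 2 by rewrite divr_ge0 ?exprn_ge0 // ltW.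
apply: (@le_trans _ _ (y * Lam t * (3 * q1 + q2 + W / M ^+ 2))).
  by rewrite ler_wpM2r // !addr_ge0 // mulr_ge0.
have A1 : y * Lam t * (3 * q1) <= e / 3.
  apply: le_trans e1; rewrite mulrA ler_wpM2r // [3 * y]mulrC mulrAC.
  by rewrite [leLHS]mulrAC [leRHS]mulrAC ler_wpM2r // ler_pM2l.
have A2 : y * Lam t * q2 <= e / 3.
  by apply: le_trans e2; rewrite ler_wpM2r // ler_pM2l.
have A3 : y * Lam t * (W / M ^+ 2) <= e / 3.
  have -> : y * Lam t * (W / M ^+ 2) = y * W * (Lam t / M ^+ 2) by ring.
  by rewrite LM2 mulrC -ler_pdivlMr // mulr_gt0.
have -> : e = e / 3 + e / 3 + e / 3 by field.
by rewrite !mulrDr !lerD.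
Unshelve. all: by end_near. Qed.

Let scaled_tail_ge z x y v e : 0 < z -> z < x -> 0 < y -> z < y * (u - ustar) ->
  y * (kappa * x `^ (nu + 1)) < v -> 0 < e ->
  \forall t \near +oo, ((expR (- v) - e)%:E
   <= P [set w | (z < ((sigma 0 t w)%:~R - c * t) / t `^ (1 - alpha nu))%R])%E.
Proof.
move=> z0 zx y0 zyU vy e0.
have [tau0 tau00 [C C0 [c2 c20 H]]] := position_lower_tail z0 zx y0 U0 zyU.
have x0 : 0 < x by rewrite (lt_trans z0).
have a0 := alpha_gt0 nu0; have a1 := alpha_lt_half nu0.
have b0 : 0 < 1 - 2 * alpha nu by lra.
near=> t.
have [t1 L1 tau1 tL Lt] : [/\ 1 <= t, 1 <= Lam t, 0 < tau t < tau0, t * tau t = Lam t & Lam t <= t].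
  by near: t; exact: near_time.
have t0 : 0 < t by rewrite (lt_le_trans ltr01).
have e1 : C * t * expR (- (c2 * t `^ (1 - 2 * alpha nu))) <= e.
  by near: t; apply: exp_decay => //; exact: ltW.
have vF : expR (- v) <= (1 - F (c + x * tau t)) ^+ (Num.truncn (y * Lam t)).+1.
  by near: t; exact: (no_slow_rate_ge nu0 F0 Fkappa).
have Ky : y * Lam t <= (Num.truncn (y * Lam t)).+1%:R by rewrite ltW // truncnS_gt.
have := H t (tau t) (Lam t) _ t1 tau1 tL Ky.
set K := (Num.truncn _).+1.
have mE : measurable [set w | ((sigma 0 t w)%:~R <= c * t + z * Lam t)%R].
  by apply: (measurable_position (fun v => v%:~R <= c * t + z * Lam t)); exact: ltW.
have mfast : measurable [set w | forall i, (i < K)%N -> (c + x * tau t < rate i%:Z w)%R].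
  apply: (@sigma_rates_measurable _ _ _ P rate).
  apply: (sigma_rates_forall (D := [set i | (i < K)%N])) => i _.
  exact: (@sigma_rates_preimage _ _ _ P rate i%:Z _ (measurable_gt (c + x * tau t))).
have -> : [set w | exists2 i, (i < K)%N & (rate i%:Z w <= c + x * tau t)%R]
    = ~` [set w | forall i, (i < K)%N -> (c + x * tau t < rate i%:Z w)%R].
  apply/seteqP; split => w /=.
    by move=> [i iK ri] /(_ i iK); rewrite ltNge ri.
  move=> nfast; have [//|nslow] := pselect (exists2 i, (i < K)%N & rate i%:Z w <= c + x * tau t).
  by case: nfast => i iK; rewrite ltNge; apply/negP => ri; apply: nslow; exists i.
rewrite scaled_position // probability_setC // (@prob_all_gt (fun i => i%:Z)); last by move=> i j [].
have -> : [set w | (c * t + z * Lam t < (sigma 0 t w)%:~R)%R]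
    = ~` [set w | ((sigma 0 t w)%:~R <= c * t + z * Lam t)%R].
  by apply/seteqP; split => w /=; rewrite ltNge => /negP.
rewrite probability_setC // tau_Lam //.
rewrite -(fineK (fin_num_measure P _ mE)) -!EFinB -EFinD !lee_fin => HE.
exact: complement_ge HE vF e1.
Unshelve. all: by end_near. Qed.

Let gap0 : 0 < u - ustar. Proof. by rewrite subr_gt0. Qed.

Lemma limf_esup_scaled_tail z : 0 < z ->
  (limf_esup (fun t => P [set w | (z < ((sigma 0 t w)%:~R - c * t) / t `^ (1 - alpha nu))%R])
     (pinfty_nbhs R)
   <= (expR (- ((Anu nu)^-1 * (kappa / (u - ustar)) * z `^ (nu + 2))))%:E)%E.
Proof.
move=> z0; have n1 : 0 < nu + 1 by rewrite addr_gt0.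
have n2 : 0 < nu + 2 by rewrite addr_gt0.
set V := (Anu nu)^-1 * _ * _.
have V0 : 0 < V by rewrite !mulr_gt0 ?invr_gt0 ?divr_gt0 ?powR_gt0.
apply/lee_addgt0Pr => e e0; apply: limf_esup_near.
have m0 : 0 < expR (- V) + e / 2 by rewrite addr_gt0 ?expR_gt0 // divr_gt0.
(* Half of e goes into the exponent and half into the error of [scaled_tail_le]. *)
have [v vE vV] : exists2 v, expR (- v) = expR (- V) + e / 2 & v < V.
  exists (- ln (expR (- V) + e / 2)); first by rewrite opprK lnK.
  by rewrite ltrNl -ltr_expR lnK // ltrDl divr_gt0.
have [s /andP[s0 s1] vs] := scale_lt n2 V0 vV.
(* The optimal window for [s * z] in place of z, so that the constraint holds strictly. *)
pose x := s * z * ((nu + 1) / (nu + 2)); pose y := s * z / ((nu + 2) * (u - ustar)).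
have x0 : 0 < x by rewrite !mulr_gt0 // invr_gt0.
have y0 : 0 < y by rewrite divr_gt0 // mulr_gt0.
have xyz : x + y * (u - ustar) < z.
  have -> : x + y * (u - ustar) = s * z.
    by rewrite /x /y; field; rewrite !gt_eqF.
  by rewrite gtr_pMl.
have xyV : s `^ (nu + 2) * V = y * (kappa * x `^ (nu + 1)).
  by rewrite /x /y [RHS]mulrCA optimal_window // /V; ring.
have e20 : 0 < e / 2 by rewrite divr_gt0.
rewrite xyV in vs; apply: filterS (scaled_tail_le z0 x0 y0 xyz vs e20) => t.
by move=> /le_trans; apply; rewrite -EFinD lee_fin vE -addrA -splitr.
Qed.

Lemma limf_einf_scaled_tail z : 0 < z ->
  ((expR (- (kappa / (u - ustar) * z `^ (nu + 2))))%:E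
   <= limf_einf (fun t => P [set w | (z < ((sigma 0 t w)%:~R - c * t) / t `^ (1 - alpha nu))%R])
        (pinfty_nbhs R))%E.
Proof.
move=> z0; have n2 : 0 < nu + 2 by rewrite addr_gt0.
set V := kappa / _ * _.
have V0 : 0 < V by rewrite mulr_gt0 ?divr_gt0 ?powR_gt0.
apply/lee_subgt0Pr => e e0; apply: limf_einf_near.
(* The minimum keeps the argument of the logarithm below positive. *)
have d0 : 0 < Num.min e (expR (- V)) by rewrite lt_min e0 expR_gt0.
have m0 : 0 < expR (- V) - Num.min e (expR (- V)) / 2.
  have : Num.min e (expR (- V)) <= expR (- V) by rewrite ge_min lexx orbT.
  by have := expR_gt0 (- V); lra.
have [v vE vV] : exists2 v, expR (- v) = expR (- V) - Num.min e (expR (- V)) / 2 & V < v.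
  exists (- ln (expR (- V) - Num.min e (expR (- V)) / 2)); first by rewrite opprK lnK.
  by rewrite ltrNr -ltr_expR lnK // gtrBl divr_gt0.
have [s s1 vs] := scale_gt n2 V0 vV.
have s0 : 0 < s by rewrite (lt_trans ltr01).
have zs : z < s * z by rewrite ltr_pMl.
(* Here [s * z] and [s * z / (u - ustar)] are, up to the factor s, the least x and y allowed by
   [scaled_tail_ge], whence the constant 1 in place of the inverse of [Anu nu]. *)
have y0 : 0 < s * z / (u - ustar) by rewrite divr_gt0 // mulr_gt0.
have zyU : z < s * z / (u - ustar) * (u - ustar) by rewrite divfK // gt_eqF.
have xyV : s `^ (nu + 2) * V = s * z / (u - ustar) * (kappa * (s * z) `^ (nu + 1)).
  rewrite /V powRM ?ltW // -!powR_succ //.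
  by field; rewrite gt_eqF.
have e20 : 0 < e / 2 by rewrite divr_gt0.
rewrite xyV in vs; apply: filterS (scaled_tail_ge z0 zs y0 zyU vs e20) => t.
apply: le_trans; rewrite -EFinB lee_fin vE.
have : Num.min e (expR (- V)) <= e by rewrite ge_min lexx.
lra.
Qed.

End RandomRates.

Unset Implicit Arguments.

Theorem theorem1 (R : realType) (d : measure_display) (T : measurableType d)
    (P : probability T R)
    (c nu kappa u : R) (F : cumulativeBounded (0 : R) (1 : R))
    (rate : int -> {RV P >-> R}) (N : int -> R -> T -> nat)
    (sigma : int -> R -> T -> int) :
  (* the distribution of the rates *)
  0 < c ->
  (forall p, p < c -> F p = 0) -> F c = 0 -> (forall p, c < p -> 0 < F p) ->
  F 1 = 1 ->
  0 < nu -> 0 < kappa ->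
  (F p / (p - c) `^ (nu + 1)) @[p --> c^'+] --> kappa ->
  (* the process *)
  disordered_tasep F rate N sigma ->
  (* the initial state *)
  {ae P, forall w, sigma 0 0 w = 0} ->
  iid P (initial_gap sigma) ->
  (forall i, ('E_P[fun w => (initial_gap sigma i w)%:~R] = u%:E)%E) ->
  (forall i, ('V_P[fun w => ((initial_gap sigma i w)%:~R : R)] < +oo)%E) ->
  (critical_gap c F < u%:E)%E ->
  forall z : R, 0 < z ->
    (limf_esup (fun t : R =>
         P [set w | (z < ((sigma 0 t w)%:~R - c * t) / t `^ (1 - alpha nu))%R])
       (pinfty_nbhs R)
     <= (expR (- ((Anu nu)^-1 * (kappa / (u - fine (critical_gap c F)))
                  * z `^ (nu + 2))))%:E)%E
    /\
    ((expR (- (kappa / (u - fine (critical_gap c F)) * z `^ (nu + 2))))%:E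
     <= limf_einf (fun t : R =>
         P [set w | (z < ((sigma 0 t w)%:~R - c * t) / t `^ (1 - alpha nu))%R])
       (pinfty_nbhs R))%E.
Proof.
move=> c0 Flt Fc _ F1 nu0 kappa0 Fkappa tasep sigma0 gaps_iid gaps_mean gaps_var cu z z0.
have c1 : c < 1.
  rewrite ltNge le_eqVlt; apply/negP => /predU1P[c1|/Flt].
    by move: Fc; rewrite -c1 F1 => /eqP; rewrite oner_eq0.
  by rewrite F1 => /eqP; rewrite oner_eq0.
have ufin : (critical_gap c F < +oo)%E by rewrite (lt_trans cu) // ltry.
have U0 : fine (critical_gap c F) < u by rewrite -lte_fin -critical_gapE.
split.
- exact: (limf_esup_scaled_tail c0 c1 Fc F1 tasep sigma0 gaps_iid gaps_mean gaps_var
    ufin nu0 kappa0 U0 Fkappa z0).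
- exact: (limf_einf_scaled_tail c0 c1 Fc F1 tasep sigma0 gaps_iid gaps_mean gaps_var
    ufin nu0 kappa0 U0 Fkappa z0).
Qed.
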